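(* There exist a positive constant $c$ and an integer $n_0$ such that for every integer $n\ge n_0$, every integer $m>c(\log n)^2$, and all intervals $I,J\subset[n]$ of length $2m$, there is a coprime matching of $I$ and $J$, i.e. a bijection $\sigma:I\to J$ with $\gcd(i,\sigma(i))=1$ for all $i\in I$.
   Context: $[n]=\{1,2,\dots,n\}$ and $\log$ is the natural logarithm. An interval of length $k$ means a set of $k$ consecutive positive integers. A coprime matching of two sets of integers of the same size is a bijection between them in which corresponding numbers are relatively prime. *)

(* Defs.v *)
From HB Require Import structures.
From mathcomp Require Import all_boot all_order all_algebra.
From mathcomp Require Import all_classical all_reals all_analysis.

Set Implicit Arguments.
Unset Strict Implicit.
Unset Printing Implicit Defensive.

Local Open Scope classical_set_scope.

Definition initial_segment (n : nat) : set nat := [set x | (1 <= x <= n)%N].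

Definition interval_of_length (k : nat) (I : set nat) : Prop :=
  exists a : nat, (0 < a)%N /\ I = [set x | (a <= x < a + k)%N].

(* Only the values of sigma on I matter: set_bij says that sigma restricts to
   a bijection from I onto J. *)
Definition coprime_matching (I J : set nat) (sigma : nat -> nat) : Prop :=
  set_bij I J sigma /\ forall i : nat, I i -> coprime i (sigma i).

(* Main.v *)
(* Odd elements of I are matched with even elements of J and conversely, so that only odd primes matter.
   Each of the two bipartite graphs joins a + 2i to b + 2j (i, j < m) when they are coprime, and Hall's
   condition follows from two facts. Every degree is at least m / (ln m)^2: this is Iwaniec's bound for
   Jacobsthal's function in quantitative form, and it needs a lower bound linear sieve that is sharp at
   the sifting limit 2. Secondly, for m / (ln m)^2 <= k < m / 2 at most k vertices have degree at most k:
   degrees are governed by the density that the small odd primes dividing a + 2i leave, whose inverse has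
   third moment at most 3.2 < 4.

   The sieve bounds X (F(s) / ln z + error) and X (f(s) / ln z - error), s = ln X / ln z, are proved by
   induction on z through Buchstab's identity, starting from Brun's sieve for large s. To have sums over
   primes telescope, ln z is replaced by the reciprocal of the sifting density; a Mertens-type estimate
   with error O(1 / ln z) makes this harmless. *)
Require Import Defs.
From HB Require Import structures.
From Stdlib Require Reals Lra Lia Factorial.
From Coquelicot Require Coquelicot.
From mathcomp Require zify.
From mathcomp Require Import all_boot all_order all_algebra.
From mathcomp Require Import all_classical all_reals all_analysis.

Set Implicit Arguments.
Unset Strict Implicit.
Unset Printing Implicit Defensive.

Module Sieve.
Import Reals Lra Lia Factorial Coquelicot.Coquelicot.
Import ssreflect ssrfun ssrbool eqtype ssrnat seq div fintype bigop binomial prime mathcomp.boot.finset.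
Import mathcomp.zify.zify.
Local Open Scope R_scope.

(** * Sums over primes *)

(** The obstacle is the sifting limit. With [z] just below the square root of [m], the main term of
    the lower bound has only the order [m / (ln m)^2] of the sieve error itself. So no power of a
    logarithm may be lost: the error must be [O(X / (ln X)^2)], uniformly along a recursion of
    unbounded depth; lowering [ln z] by a constant then makes the main term win. Buchstab's identity
    commutes with shifts of [ln X]. Hence the derivative of the main term in [ln X], which has
    exactly this order, is carried through the recursion without growing, and it serves as the
    profile of the error in [Err]. Whatever else the recursion produces has to be of smaller order.
    Replacing [ln p] by [tau p] is dangerous for this reason: it changes the sums over primes by a
    first-order term that is again of order [1 / (ln X)^2] when bounded term by term. Only its
    cancellation makes it smaller, and this is what the second-order Mertens estimate is for. *)

Fixpoint psum (f : nat -> R) (n : nat) : R :=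
  if n is S k then psum f k + (if prime k then f k else 0) else 0.

(** Sums over primes are estimated without integrals: it suffices to find [g] whose increments
    dominate [f] at the primes and are nonnegative elsewhere. *)
Lemma psum_tele_le (f g : nat -> R) (w z : nat) : (w <= z)%N ->
  (forall p, (w <= p < z)%N -> prime p -> f p <= g p.+1 - g p) ->
  (forall p, (w <= p < z)%N -> ~~ prime p -> 0 <= g p.+1 - g p) ->
  psum f z - psum f w <= g z - g w.
Proof.
move=> /subnKC <-; elim: (z - w)%N => [|d IH] Hp Hn; first by rewrite addn0; lra.
have {IH} : psum f (w + d) - psum f w <= g (w + d)%N - g w.
  by apply: IH => p hp; [apply: Hp|apply: Hn]; lia.
rewrite addnS /=; case: ifPn => pr.
  by have := Hp (w + d)%N ltac:(lia) pr; lra.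
by have := Hn (w + d)%N ltac:(lia) pr; lra.
Qed.

Lemma psum_diff_abs_le (f g h : nat -> R) (w z : nat) : (w <= z)%N ->
  (forall p, (w <= p < z)%N -> prime p -> Rabs (f p - (g p.+1 - g p)) <= h p) ->
  (forall p, (w <= p < z)%N -> ~~ prime p -> g p.+1 = g p) ->
  Rabs (psum f z - psum f w - (g z - g w)) <= psum h z - psum h w.
Proof.
move=> /subnKC <-; elim: (z - w)%N => [|d IH] Hp Hn.
  by rewrite addn0 (_ : _ - _ - _ = 0) ?Rabs_R0; lra.
have {IH} : Rabs (psum f (w + d) - psum f w - (g (w + d)%N - g w))
   <= psum h (w + d) - psum h w.
  by apply: IH => p hp; [apply: Hp|apply: Hn]; lia.
rewrite addnS /=; case: ifPn => pr.
  have := Hp (w + d)%N ltac:(lia) pr.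
  by split_Rabs; lra.
by have := Hn (w + d)%N ltac:(lia) pr; split_Rabs; lra.
Qed.

Lemma psum_le (f g : nat -> R) (w z : nat) : (w <= z)%N ->
  (forall p, (w <= p < z)%N -> prime p -> f p <= g p) ->
  psum f z - psum f w <= psum g z - psum g w.
Proof.
move=> wz H; apply: psum_tele_le => // p hp /= pr; rewrite ?pr; first by have := H p hp pr; lra.
by rewrite (negbTE pr); lra.
Qed.

Lemma psum_plus (f g : nat -> R) n : psum (fun p => f p + g p) n = psum f n + psum g n.
Proof. by elim: n => [|n IH] /=; [lra|rewrite IH; case: prime; lra]. Qed.

Lemma psum_scal (c : R) (f : nat -> R) n : psum (fun p => c * f p) n = c * psum f n.
Proof. by elim: n => [|n IH] /=; [lra|rewrite IH; case: prime; lra]. Qed.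

Lemma psum_ext (f g : nat -> R) n :
  (forall p, (p < n)%N -> prime p -> f p = g p) -> psum f n = psum g n.
Proof.
elim: n => [|n IH] H //=; rewrite IH; last by move=> p hp; apply: H; lia.
by case: ifP => // pr; rewrite H.
Qed.

Lemma psum_nonneg (f : nat -> R) (w z : nat) : (w <= z)%N ->
  (forall p, (w <= p < z)%N -> prime p -> 0 <= f p) -> 0 <= psum f z - psum f w.
Proof.
move=> wz H; have := @psum_tele_le (fun p => - f p) (fun _ => 0) w z wz.
rewrite -!(psum_ext (f := fun p => (-1) * f p) (g := fun p => - f p)); try by move=> *; lra.
rewrite !psum_scal => K.
suff: -1 * psum f z - -1 * psum f w <= 0 - 0 by lra.
by apply: K => p hp pr; [have := H p hp pr|]; lra.
Qed.

(** Summation by parts. As [Z] moves only at primes, its total variation is itself a sum over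
    primes. *)
Lemma psum_abel (x Z : nat -> R) (B : R) (w z : nat) : (w <= z)%N ->
  (forall n, (w <= n <= z)%N -> Rabs (psum x n) <= B) ->
  (forall p, (w <= p < z)%N -> ~~ prime p -> Z p.+1 = Z p) ->
  Rabs (psum (fun p => x p * Z p) z - psum (fun p => x p * Z p) w)
  <= B * (Rabs (Z z) + Rabs (Z w) +
     (psum (fun p => Rabs (Z p.+1 - Z p)) z - psum (fun p => Rabs (Z p.+1 - Z p)) w)).
Proof.
move=> wz HB Hn.
have E : Rabs (psum (fun p => x p * Z p) z - psum (fun p => x p * Z p) w
   - (psum x z * Z z - psum x w * Z w))
  <= B * (psum (fun p => Rabs (Z p.+1 - Z p)) z - psum (fun p => Rabs (Z p.+1 - Z p)) w).
  rewrite Rmult_minus_distr_l -!psum_scal.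
  apply: (@psum_diff_abs_le _ (fun n => psum x n * Z n)) => // p hp pr; last first.
    by rewrite /= (negbTE pr) (Hn p hp pr); lra.
  rewrite (_ : _ - _ = - (psum x p.+1 * (Z p.+1 - Z p))); last by rewrite /= pr; ring.
  rewrite Rabs_Ropp Rabs_mult; apply: Rmult_le_compat_r; first exact: Rabs_pos.
  by apply: HB; lia.
have H1 : Rabs (psum x z * Z z) <= B * Rabs (Z z).
  by rewrite Rabs_mult; apply: Rmult_le_compat_r; [apply: Rabs_pos|apply: HB; lia].
have H2 : Rabs (psum x w * Z w) <= B * Rabs (Z w).
  by rewrite Rabs_mult; apply: Rmult_le_compat_r; [apply: Rabs_pos|apply: HB; lia].
move: E H1 H2; split_Rabs; lra.
Qed.

(** The [n]-th power of [x / n <= exp (x / n)]. *)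
Lemma exp_ge_pow (n : nat) (x : R) : (0 < n)%N -> 0 <= x -> x ^ n <= INR n ^ n * exp x.
Proof.
move=> n0 x0; have nR : 0 < INR n by apply: lt_0_INR; lia.
have -> : exp x = exp (x / INR n) ^ n.
  by rewrite -Rpower_pow ?/Rpower ?ln_exp; [congr exp; field; lra|apply: exp_pos].
rewrite -Rpow_mult_distr; apply: pow_incr; split=> //.
have := exp_ineq1_le (x / INR n) => H.
have -> : x = INR n * (x / INR n) by field; lra.
have -> : INR n * (x / INR n) / INR n = x / INR n by field; lra.
apply: Rmult_le_compat_l; lra.
Qed.

Lemma exp_pow_neg (n : nat) (a x : R) : (0 < n)%N -> 0 <= x ->
  x ^ n * exp (- (a + 1) * x) <= INR n ^ n * exp (- a * x).
Proof.
move=> n0 x0; rewrite (_ : - (a + 1) * x = - x + - a * x) ?exp_plus; last ring.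
rewrite -Rmult_assoc; apply: Rmult_le_compat_r; first exact/Rlt_le/exp_pos.
have := exp_ge_pow n0 x0; rewrite exp_Ropp => H.
apply: (Rmult_le_reg_r (exp x)); first exact: exp_pos.
rewrite Rmult_assoc Rinv_l; first lra.
exact/Rgt_not_eq/exp_pos.
Qed.

Lemma ln_le_mono (x y : R) : 0 < x -> x <= y -> ln x <= ln y.
Proof. move=> x0 [/(ln_increasing _ _ x0)|->]; lra. Qed.

Lemma exp_le_mono (x y : R) : x <= y -> exp x <= exp y.
Proof. case=> [/exp_increasing|->]; lra. Qed.

Lemma ln_le_sub1 (x : R) : 0 < x -> ln x <= x - 1.
Proof. move=> x0; have := exp_ineq1_le (ln x); rewrite exp_ln //; lra. Qed.

(** * Regular sequences and Brun's sieve *)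

Definition rprod (s : seq nat) : R := foldr (fun p x => INR p * x) 1 s.

(* [E p i] reads "[i] lies in the class excluded by [p]"; [A] is sifted by primes in [P] with all
   remainders at most 1, as for an interval with one excluded class per prime. *)
Definition regular (P : pred nat) (X : R) (A : seq nat) (E : nat -> nat -> bool) :=
  forall s, uniq s -> all (fun p => prime p && P p) s ->
  Rabs (INR (count (fun i => all (E^~ i) s) A) - X / rprod s) <= 1.

Definition sift (A : seq nat) (E : nat -> nat -> bool) (s : seq nat) : nat :=
  count (fun i => all (fun p => ~~ E p i) s) A.

(** A count over [s] inside the class of [p] is a count over [p :: s] in [A]. The remainders
    therefore keep the same bound 1 however often Buchstab's identity is iterated. *)
Lemma regular_filter (P : pred nat) X A E p : prime p -> P p -> regular P X A E ->
  regular (fun q => P q && (q != p)) (X / INR p) [seq i <- A | E p i] E.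
Proof.
move=> pp Pp H s us hs; rewrite count_filter.
have := H (p :: s); rewrite /= us pp Pp andbT /=.
have -> : p \notin s.
  by apply/negP => ps; have := allP hs _ ps; rewrite eqxx !andbF.
have -> : all (fun q => prime q && P q) s.
  by apply/allP => q /(allP hs) /andP[-> /andP[-> _]].
move=> /(_ isT isT); congr (Rabs (INR _ - _) <= _).
  by apply: eq_count => i /=; rewrite andbC.
have hp : INR p <> 0 by apply: not_0_INR; have := prime_gt0 pp; lia.
have : rprod s <> 0.
  elim: s {us} hs => /= [|q s IH]; first by move=> _; lra.
  move=> /andP[/andP[qq _] /IH]; apply: Rmult_integral_contrapositive_currified.
  by apply: not_0_INR; have := prime_gt0 qq; lia.
by move=> h; rewrite /=; field.
Qed.

Lemma regular_sub (P Q : pred nat) X A E : (forall p, prime p -> Q p -> P p) ->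
  regular P X A E -> regular Q X A E.
Proof.
move=> QP H s us /allP hs; apply: H => //; apply/allP => p /hs /andP[pp Qp].
by rewrite pp QP.
Qed.

Lemma regular_card (P : pred nat) X A E : regular P X A E -> Rabs (INR (size A) - X) <= 1.
Proof.
move=> /(_ [::] isT isT) /=; rewrite (@eq_count _ _ predT) // count_predT.
by rewrite /Rdiv Rinv_1 Rmult_1_r.
Qed.

(** The survivors of [s] split according to the class of [p]: the single step behind both
    inclusion-exclusion and Buchstab's identity. *)
Lemma sift_cons A E p s : INR (sift A E (p :: s)) =
  INR (sift A E s) - INR (sift [seq i <- A | E p i] E s).
Proof.
have -> : sift A E s = (sift A E (p :: s) + sift [seq i <- A | E p i] E s)%N.
  by rewrite /sift; elim: A => //= i A IH; case: (E p i) => /=; rewrite IH; lia.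
by rewrite plus_INR; ring.
Qed.

(* Main term, and number of terms, of inclusion-exclusion over the subsets of [s] of size at most [r]. *)
Fixpoint Vtrunc (r : nat) (s : seq nat) : R :=
  if r is r'.+1 then
    (fix go s := if s is p :: s' then go s' - Vtrunc r' s' / INR p else 1) s
  else 1.

Fixpoint Ntrunc (r : nat) (s : seq nat) : R :=
  if r is r'.+1 then
    (fix go s := if s is p :: s' then go s' + Ntrunc r' s' else 1) s
  else 1.

Definition Vprod (s : seq nat) : R := foldr (fun p x => x * (1 - / INR p)) 1 s.
Definition sigma (s : seq nat) : R := foldr (fun p x => / INR p + x) 0 s.

(** A subset of size at most [r] is the set of letters of a word of length [r] over [s] and a
    blank. *)
Lemma Ntrunc_le r s : 0 <= Ntrunc r s <= (INR (size s) + 1) ^ r.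
Proof.
elim: r s => [|r IH] s; first by rewrite /=; lra.
elim: s => [|p s IHs]; first by rewrite /= !Rplus_0_l pow1; lra.
have -> : Ntrunc r.+1 (p :: s) = Ntrunc r.+1 s + Ntrunc r s by [].
have := IH s; set k := INR (size s) + 1 in IHs * => h.
have -> : INR (size (p :: s)) + 1 = k + 1 by rewrite [size _]/= S_INR /k; ring.
have k0 : 0 <= k by rewrite /k; have := pos_INR (size s); lra.
have m : k ^ r <= (k + 1) ^ r by apply: pow_incr; lra.
by split; [lra|rewrite /= in IHs *; nra].
Qed.

Lemma Vprod_bound s : all prime s -> 0 <= Vprod s <= 1 /\ 0 <= sigma s.
Proof.
elim: s => [|p s IH] /=; first by lra.
move=> /andP[/prime_gt1 pp /IH h].
have : 0 < / INR p <= / 2.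
  have : 2 <= INR p by rewrite (_ : 2 = INR 2) //; apply: le_INR; lia.
  by move=> h2; split; [apply: Rinv_0_lt_compat|apply: Rinv_le_contravar]; lra.
nra.
Qed.

Lemma pow_plus_ge (x y : R) n : 0 <= x -> 0 <= y ->
  x ^ n.+1 + INR n.+1 * y * x ^ n <= (x + y) ^ n.+1.
Proof.
move=> x0 y0; elim: n => [|n IH]; first by rewrite /=; lra.
have -> : (x + y) ^ n.+2 = (x + y) * (x + y) ^ n.+1 by [].
apply: Rle_trans (Rmult_le_compat_l _ _ _ _ IH); last lra.
have xn : 0 <= x ^ n by apply: pow_le.
rewrite (S_INR n.+1) -!tech_pow_Rmult; have := pos_INR n.+1.
have : 0 <= y * (y * x ^ n) by repeat apply: Rmult_le_pos.
nra.
Qed.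

(** Double induction; the bounds for the two recursive calls add up by [pow_plus_ge], two terms of
    the binomial theorem. Starting from the bound 1 at [r = 0] makes the exponent one less than the
    sharp one. *)
Lemma Vtrunc_close r s : all prime s ->
  Rabs (Vtrunc r s - Vprod s) <= sigma s ^ r / INR (fact r).
Proof.
elim: r s => [|r IH] s hs.
  by have [h _] := Vprod_bound hs; rewrite /= Rdiv_1_r; split_Rabs; lra.
elim: s hs => [|p s IHs].
  by move=> _; rewrite [Vtrunc _ _]/= [Vprod _]/= Rminus_diag Rabs_R0 /= Rmult_0_l /Rdiv Rmult_0_l; lra.
move=> /andP[pp hs]; have {}IHs := IHs hs; have {}IH := IH s hs.
rewrite [Vprod (_ :: _)]/= [sigma (_ :: _)]/=.
have [_ s0] := Vprod_bound hs.
have p0 : 0 < / INR p by apply: Rinv_0_lt_compat; apply: lt_0_INR; have := prime_gt0 pp; lia.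
have -> : Vtrunc r.+1 (p :: s) = Vtrunc r.+1 s - Vtrunc r s / INR p by [].
have -> : Vtrunc r.+1 s - Vtrunc r s / INR p - Vprod s * (1 - / INR p)
  = (Vtrunc r.+1 s - Vprod s) - / INR p * (Vtrunc r s - Vprod s) by rewrite /Rdiv; ring.
have f0 := INR_fact_lt_0 r; have f1 := INR_fact_lt_0 r.+1.
have : / INR p * Rabs (Vtrunc r s - Vprod s) <= / INR p * (sigma s ^ r / INR (fact r)).
  by apply: Rmult_le_compat_l => //; lra.
rewrite -{1}(Rabs_right (/ INR p)) -?Rabs_mult; last lra.
move=> Q3; have E : sigma s ^ r.+1 / INR (fact r.+1) + / INR p * (sigma s ^ r / INR (fact r))
   <= (/ INR p + sigma s) ^ r.+1 / INR (fact r.+1).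
  have := @pow_plus_ge (sigma s) (/ INR p) r s0 ltac:(lra) => Q.
  have -> : sigma s ^ r.+1 / INR (fact r.+1) + / INR p * (sigma s ^ r / INR (fact r))
    = (sigma s ^ r.+1 + INR r.+1 * / INR p * sigma s ^ r) / INR (fact r.+1).
    rewrite fact_simpl mult_INR.
    have h1 : INR r.+1 <> 0 by apply: not_0_INR.
    have h2 : INR (fact r) <> 0 by lra.
    have h3 : INR p <> 0 by move=> e; rewrite e Rinv_0 in p0; lra.
    by field.
  rewrite (Rplus_comm (/ INR p)); apply: Rmult_le_compat_r => //.
  by apply/Rlt_le/Rinv_0_lt_compat.
change (Rabs (Vtrunc r.+1 s - Vprod s) <= sigma s ^ r.+1 / INR (fact r.+1)) in IHs.
change (Rabs (Vtrunc r.+1 s - Vprod s - / INR p * (Vtrunc r s - Vprod s)) <= (/ INR p + sigma s) ^ r.+1 / INR (fact r.+1)).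
move: IHs E Q3; split_Rabs; lra.
Qed.

(** The subtracted term of [sift_cons] is estimated at level [r] and reverses the inequality, hence
    the alternation with the parity of [r]. *)
Lemma bonferroni r s (P : pred nat) X A E : regular P X A E -> uniq s ->
  all (fun p => prime p && P p) s ->
  if odd r then X * Vtrunc r s - Ntrunc r s <= INR (sift A E s)
  else INR (sift A E s) <= X * Vtrunc r s + Ntrunc r s.
Proof.
elim: r s P X A => [|r IH] s P X A reg us hs.
  have := regular_card reg => hc.
  have : INR (sift A E s) <= INR (size A) by apply: le_INR; have := count_size (fun i => all (fun p => ~~ E p i) s) A; rewrite /sift; lia.
  by rewrite /=; split_Rabs; lra.
elim: s us hs => [|p s IHs].
  move=> _ _; rewrite /sift (@eq_count _ _ predT) // count_predT.
  by have := regular_card reg; rewrite /=; case: (odd r); rewrite /=; split_Rabs; lra.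
move=> /andP[ps us] /andP[/andP[pp Pp] hs]; have {}IHs := IHs us hs.
have hs' : all (fun q => prime q && (P q && (q != p))) s.
  apply/allP => q qs; have /andP[-> ->] := allP hs q qs.
  by apply: contraNneq ps => <-.
have {IH} := IH s _ _ _ (regular_filter pp Pp reg) us hs'.
have -> : Vtrunc r.+1 (p :: s) = Vtrunc r.+1 s - Vtrunc r s / INR p by [].
have -> : Ntrunc r.+1 (p :: s) = Ntrunc r.+1 s + Ntrunc r s by [].
move: IHs; rewrite sift_cons [odd r.+1]/=.
have -> : X / INR p * Vtrunc r s = X * (Vtrunc r s / INR p) by rewrite /Rdiv; ring.
by case: (odd r) => /=; lra.
Qed.

(** Of the levels [r] and [r + 1] one bounds from below and the other from above. The condition on
    [sigma s] makes the tail bound at level [r + 1] no larger than the one at level [r]. *)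
Lemma brun r s (P : pred nat) X A E : regular P X A E -> uniq s ->
  all (fun p => prime p && P p) s -> 0 <= X -> sigma s <= INR r.+1 ->
  Rabs (INR (sift A E s) - X * Vprod s)
  <= X * (sigma s ^ r / INR (fact r)) + (INR (size s) + 1) ^ r.+1.
Proof.
move=> reg us hs X0 hr.
have ap : all prime s by apply: sub_all hs => q /andP[].
have [V01 s0] := Vprod_bound ap.
have C1 := Vtrunc_close r ap; have C2 := Vtrunc_close r.+1 ap.
have N1 := Ntrunc_le r s; have N2 := Ntrunc_le r.+1 s.
have Nm : (INR (size s) + 1) ^ r <= (INR (size s) + 1) ^ r.+1.
  by apply: Rle_pow; [have := pos_INR (size s); lra|lia].
have dec : sigma s ^ r.+1 / INR (fact r.+1) <= sigma s ^ r / INR (fact r).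
  have f0 := INR_fact_lt_0 r.
  have -> : sigma s ^ r.+1 / INR (fact r.+1) = sigma s ^ r / INR (fact r) * (sigma s / INR r.+1).
    rewrite fact_simpl mult_INR -tech_pow_Rmult.
    have h1 : INR r.+1 <> 0 by apply: not_0_INR.
    by field; lra.
  rewrite -[X in _ <= X]Rmult_1_r; apply: Rmult_le_compat_l.
    by apply: Rmult_le_pos; [apply: pow_le|apply/Rlt_le/Rinv_0_lt_compat].
  have r1 : 0 < INR r.+1 by apply: lt_0_INR; lia.
  by apply: (Rmult_le_reg_r (INR r.+1)) => //; rewrite /Rdiv Rmult_assoc Rinv_l; lra.
have D1 : X * Rabs (Vtrunc r s - Vprod s) <= X * (sigma s ^ r / INR (fact r)).
  exact: Rmult_le_compat_l.
have D2 : X * Rabs (Vtrunc r.+1 s - Vprod s) <= X * (sigma s ^ r / INR (fact r)).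
  by apply: Rmult_le_compat_l => //; lra.
rewrite -{1}(Rabs_right X) -?Rabs_mult in D1; last lra.
rewrite -{1}(Rabs_right X) -?Rabs_mult in D2; last lra.
rewrite Rmult_minus_distr_l in D1; rewrite Rmult_minus_distr_l in D2.
have B1 := bonferroni r reg us hs; have B2 := bonferroni r.+1 reg us hs.
clear C1 C2 dec reg us hs hr s0 V01 ap.
move: N1 N2 Nm D1 D2 B1 B2; set k1 := _ ^ r.+1; set k0 := _ ^ r; set U := X * (_ / _).
set v1 := X * Vtrunc r s; set v2 := X * Vtrunc r.+1 s; set v := X * Vprod s.
clearbody k1 k0 U v1 v2 v => N1 N2 Nm D1 D2.
rewrite [odd r.+1]/=; case: (odd r) => B1 B2;
  lazy beta iota delta [negb] in B1, B2; split_Rabs; lra.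
Qed.

(** Weak form of Stirling's formula, from [(1 + 1 / r) ^ r <= exp 1]. *)
Lemma pow_le_fact_exp r : INR r ^ r <= INR (fact r) * exp (INR r).
Proof.
elim: r => [|r IH]; first by rewrite /= exp_0; lra.
case: r IH => [|r] IH.
  by rewrite /= !Rmult_1_l; have := exp_ineq1_le 1; lra.
rewrite fact_simpl mult_INR -tech_pow_Rmult Rmult_assoc.
apply: Rmult_le_compat_l; first exact: pos_INR.
rewrite (S_INR r.+1) exp_plus -Rmult_assoc.
have n0 : 0 < INR r.+1 by apply: lt_0_INR; lia.
have -> : (INR r.+1 + 1) ^ r.+1 = INR r.+1 ^ r.+1 * (1 + / INR r.+1) ^ r.+1.
  by rewrite -Rpow_mult_distr; congr (_ ^ _); field; lra.
apply: Rmult_le_compat => //.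
- by apply: pow_le; lra.
- by apply: pow_le; have := Rinv_0_lt_compat _ n0; lra.
have -> : exp 1 = exp (/ INR r.+1) ^ r.+1.
  rewrite -Rpower_pow ?/Rpower ?ln_exp; last exact: exp_pos.
  by congr exp; field; lra.
apply: pow_incr; split; first by have := Rinv_0_lt_compat _ n0; lra.
exact: exp_ineq1_le.
Qed.

Lemma pow_fact_exp_neg (x k : R) r : 0 <= x -> x * exp k <= INR r ->
  x ^ r / INR (fact r) <= exp (- ((k - 1) * INR r)).
Proof.
move=> x0 h; have f0 := INR_fact_lt_0 r.
apply: (Rmult_le_reg_r (INR (fact r) * exp (k * INR r))).
  by apply: Rmult_lt_0_compat => //; apply: exp_pos.
have -> : x ^ r / INR (fact r) * (INR (fact r) * exp (k * INR r)) = (x * exp k) ^ r.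
  rewrite Rpow_mult_distr -(Rpower_pow _ (exp k)) ?/Rpower ?ln_exp; last exact: exp_pos.
  by rewrite (Rmult_comm k); field; lra.
have -> : exp (- ((k - 1) * INR r)) * (INR (fact r) * exp (k * INR r)) = INR (fact r) * exp (INR r).
  rewrite (Rmult_comm (exp _)) Rmult_assoc -exp_plus; congr (_ * exp _); ring.
apply: Rle_trans (pow_le_fact_exp r); apply: pow_incr; split=> //.
by apply: Rmult_le_pos => //; apply/Rlt_le/exp_pos.
Qed.

(* Decreasing enumeration, so that consing peels off the largest prime. *)
Fixpoint plist (n : nat) : seq nat :=
  if n is k.+1 then (if prime k then k :: plist k else plist k) else [::].

Lemma plistP n p : (p \in plist n) = prime p && (p < n)%N.
Proof.
elim: n => [|n IH] /=; first by rewrite ltn0 andbF.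
by case: ifP => pr; rewrite ?inE IH ltnS (leq_eqVlt p n); case: (eqVneq p n) => [e|_] /=; rewrite ?e ?pr ?andbF.
Qed.

Lemma plist_uniq n : uniq (plist n).
Proof. by elim: n => //= n IH; case: ifP => //= _; rewrite plistP ltnn andbF. Qed.

Lemma plist_size n : (size (plist n) <= n)%N.
Proof. by elim: n => //= n IH; case: ifP => //= _; lia. Qed.

Lemma plist_all n : all prime (plist n).
Proof. by apply/allP => p; rewrite plistP => /andP[]. Qed.

Lemma sigma_plist n : sigma (plist n) = psum (fun p => / INR p) n.
Proof. by elim: n => //= n IH; case: ifP => /= _; rewrite IH; ring. Qed.

Lemma mvt (f df : R -> R) (a b : R) : a <= b ->
  (forall x, a <= x <= b -> is_derive f x (df x)) ->
  exists c, a <= c <= b /\ f b - f a = df c * (b - a).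
Proof.
move=> ab H; have [||c [hc E]] := MVT_gen f a b df.
- by move=> x; rewrite Rmin_left // Rmax_right // => hx; apply: H; lra.
- move=> x; rewrite Rmin_left // Rmax_right // => hx.
  by apply/continuity_pt_filterlim/ex_derive_continuous; exists (df x); apply: H.
by exists c; rewrite Rmin_left // Rmax_right // in hc.
Qed.

Ltac fld := field; repeat split; lra.

(** * Telescoping Buchstab sums *)

(* [tau] plays the role of the logarithm. It is normalised so that the sifting density below [n] is
   exactly [kap / tau n]; then [L / tau p] moves by the factor [1 - 1/p] at each prime [p], and sums over
   primes of values of a smooth function at [L / tau p] telescope without integrals. *)
Section Sums.
Variable tau : nat -> R.
Hypothesis tau_pos : forall n, 0 < tau n.
Hypothesis tau_S : forall n, tau n.+1 = if prime n then tau n / (1 - / INR n) else tau n.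

Lemma prime_INR p : prime p -> 2 <= INR p.
Proof. by move/prime_gt1 => h; rewrite (_ : 2 = INR 2) //; apply: le_INR; lia. Qed.

Lemma tau_S_ratio L p : prime p -> L / tau p.+1 = L / tau p * (1 - / INR p).
Proof.
move=> pr; rewrite tau_S pr; have := prime_INR pr; have := tau_pos p => h1 h2.
have : / INR p <= / 2 by apply: Rinv_le_contravar; lra.
by move=> h3; field; split; lra.
Qed.

Lemma tau_S_np p : ~~ prime p -> tau p.+1 = tau p.
Proof. by rewrite tau_S => /negbTE ->. Qed.

Lemma tau_le w z : (w <= z)%N -> tau w <= tau z.
Proof.
move=> /subnKC <-; elim: (z - w)%N => [|d IH]; first by rewrite addn0; lra.
apply: Rle_trans IH _; rewrite addnS tau_S; case: ifP => pr; last lra.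
have := prime_INR pr; have := tau_pos (w + d)%N => h1 h2.
have h3 : / INR (w + d)%N <= / 2 by apply: Rinv_le_contravar; lra.
have h4 : 0 < / INR (w + d)%N by apply: Rinv_0_lt_compat; lra.
apply: (Rmult_le_reg_r (1 - / INR (w + d)%N)); first lra.
rewrite /Rdiv Rmult_assoc Rinv_l; nra.
Qed.

Lemma s_le L w z : 0 < L -> (w <= z)%N -> L / tau z <= L / tau w.
Proof.
move=> L0 wz; apply: Rmult_le_compat_l; first lra.
by apply: Rinv_le_contravar; [apply: tau_pos|apply: tau_le].
Qed.

Lemma s_pos L n : 0 < L -> 0 < L / tau n.
Proof. by move=> L0; apply: Rdiv_lt_0_compat. Qed.

(** At a prime [exp (- (L / tau p))] grows by at least [exp (- s) * s / p], where [s = L / tau p].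
    The errors at the nodes of the recursion are all bounded by multiples of this summand. *)
Lemma tele_exp L w z : 0 < L -> (w <= z)%N ->
  psum (fun p => / INR p * (L / tau p) * exp (- (L / tau p))) z
  - psum (fun p => / INR p * (L / tau p) * exp (- (L / tau p))) w
  <= exp (- (L / tau z)).
Proof.
move=> L0 wz.
apply: Rle_trans (_ : exp (- (L / tau z)) - exp (- (L / tau w)) <= _); last first.
  by have := exp_pos (- (L / tau w)); lra.
apply: (@psum_tele_le _ (fun n => exp (- (L / tau n)))) => // p hp pr; last first.
  by rewrite tau_S_np //; lra.
rewrite tau_S_ratio //; set s := L / tau p; have s0 : 0 < s by apply: s_pos.
rewrite (_ : - (s * (1 - / INR p)) = - s + / INR p * s); last ring.
rewrite exp_plus; have := exp_ineq1_le (/ INR p * s); have := exp_pos (- s); nra.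
Qed.

Variables (C1 K L : R) (w z : nat).
(** [N] stands for the sieve function met at the nodes [X / p]; [h] and [k] are the antiderivatives
    that make the sums of [N] and of its derivative telescope. The decay [exp (- 3 * x)] can absorb
    a factor [s ^ 3] and still leave [exp (- s)]. *)
Variables (N dN h k : R -> R) (smin xm : R).
Hypothesis C1_ge0 : 0 <= C1.
Hypothesis K_ge0 : 0 <= K.
Hypothesis L_ge1 : 1 <= L.
Hypothesis wz : (w <= z)%N.
Hypothesis smin_ge : 2 <= smin.
Hypothesis xm_le : xm + 3 / 2 <= smin.
Hypothesis sz_ge : smin <= L / tau z.
Hypothesis tau_w1 : 1 <= tau w.
Hypothesis tau_wC : 2 * C1 <= tau w.
Hypothesis w_ge : L ^ 2 <= INR w.
Hypothesis w_ge2 : 2 * L <= INR w.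
Hypothesis tau_ln : forall p, (w <= p <= z)%N -> Rabs (tau p - ln (INR p)) <= C1.
Hypothesis N_der : forall x, xm <= x -> is_derive N x (dN x).
Hypothesis dN_le : forall x, xm <= x -> Rabs (dN x) <= K * exp (- 3 * x).
Hypothesis dN_lip : forall x y, xm <= x -> x <= y ->
  Rabs (dN x - dN y) <= K * exp (- 3 * x) * (y - x).
Hypothesis h_der : forall s, smin <= s -> is_derive h s (N (s - 1)).
Hypothesis k_der : forall s, smin <= s -> is_derive k s (s * dN (s - 1)).

(** The price of moving the argument of [exp (- 3 * x)] from [s - 3 / 2] to [s]. *)
Let c0 := exp (9 / 2).

(** [w >= L ^ 2] makes the step [s / p] negligible, and [tau w >= 2 * C1] keeps the node argument
    within [1 / 2] of [s - 1]. *)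
Lemma node_facts p : (w <= p < z)%N -> prime p ->
  let s := L / tau p in
  [/\ smin <= s, smin <= s * (1 - / INR p), 0 < / INR p & s * / INR p <= / 2] /\
  [/\ s * / INR p <= s / L ^ 2, s <= L, Rabs ((tau p - ln (INR p)) / tau p) <= / 2 &
    (L - ln (INR p)) / tau p = s - 1 + (tau p - ln (INR p)) / tau p].
Proof.
move=> hp pr s; have p0 := prime_INR pr.
have ip : 0 < / INR p by apply: Rinv_0_lt_compat; lra.
have pw : INR w <= INR p by apply: le_INR; lia.
have tw : tau w <= tau p by apply: tau_le; lia.
have sL : s <= L.
  rewrite /s; apply: (Rmult_le_reg_r (tau p)); first exact: tau_pos.
  by rewrite /Rdiv Rmult_assoc Rinv_l; [nra|have := tau_pos p; lra].
have s0 : 0 < s by apply: s_pos; lra.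
have sp : smin <= s by apply: Rle_trans sz_ge _; apply: s_le; [lra|lia].
have i2 : / INR p <= / (2 * L) by apply: Rinv_le_contravar; lra.
have iL : / INR p <= / L ^ 2.
  by apply: Rinv_le_contravar; [apply: pow_lt; lra|lra].
split; split=> //.
- by rewrite /s -tau_S_ratio //; apply: Rle_trans sz_ge _; apply: s_le; [lra|lia].
- apply: Rle_trans (_ : L * / (2 * L) <= _); first by apply: Rmult_le_compat; lra.
  by right; field; lra.
- by apply: Rmult_le_compat_l; lra.
- rewrite Rabs_mult (Rabs_right (/ tau p)); last first.
    by apply/Rle_ge/Rlt_le/Rinv_0_lt_compat.
  apply: (Rmult_le_reg_r (tau p)); first exact: tau_pos.
  rewrite Rmult_assoc Rinv_l; last by have := tau_pos p; lra.
  by have := @tau_ln p ltac:(lia); lra.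
- by rewrite /s; field; have := tau_pos p; lra.
Qed.

Lemma N_mvt a b : xm <= a -> xm <= b ->
  exists c, [/\ Rmin a b <= c, c <= Rmax a b & N b - N a = dN c * (b - a)].
Proof.
move=> ha hb; have [ab|ba] := Rle_lt_dec a b.
  have [|c [hc E]] := @mvt N dN a b ab; first by move=> x hx; apply: N_der; lra.
  by exists c; rewrite Rmin_left // Rmax_right //; split; lra.
have [||c [hc E]] := @mvt N dN b a; first lra; first by move=> x hx; apply: N_der; lra.
by exists c; rewrite Rmin_right ?Rmax_left; [split; lra|lra|lra].
Qed.

Lemma dN_lip' x y : xm <= x -> xm <= y ->
  Rabs (dN x - dN y) <= K * exp (- 3 * Rmin x y) * Rabs (y - x).
Proof.
move=> hx hy; have [xy|yx] := Rle_lt_dec x y.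
  by rewrite Rmin_left // (Rabs_right (y - x)); [apply: dN_lip|lra].
rewrite Rmin_right; last lra.
by rewrite Rabs_minus_sym (Rabs_minus_sym y) (Rabs_right (x - y)); [apply: dN_lip; lra|lra].
Qed.

Lemma e3_shift s x : s - 3 / 2 <= x -> K * exp (- 3 * x) <= K * (c0 * exp (- 3 * s)).
Proof.
move=> H; apply: Rmult_le_compat_l => //; rewrite /c0 -exp_plus.
by apply: exp_le_mono; lra.
Qed.

Lemma s_e3 s : 0 <= s -> s * exp (- 3 * s) <= exp (- s) /\ s ^ 2 * exp (- 3 * s) <= 4 * exp (- s)
  /\ s ^ 3 * exp (- 3 * s) <= 27 * exp (-s) /\ exp (- 3 * s) <= exp (- s).
Proof.
move=> s0.
have H1 := @exp_pow_neg 1 2 s isT s0; have H2 := @exp_pow_neg 2 2 s isT s0.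
have H3 := @exp_pow_neg 3 2 s isT s0.
have -> : -3 * s = - (2 + 1) * s by ring.
have H4 : exp (- 2 * s) <= exp (- s) by apply: exp_le_mono; lra.
have H5 : exp (- (2 + 1) * s) <= exp (- s) by apply: exp_le_mono; lra.
have E : - (2) * s = - 2 * s by ring.
rewrite E /= in H1 H2 H3; split; [|split; [|split]] => //=; lra.
Qed.

(** The coefficient of [tau p - ln p] in the first-order Taylor term, once [tau p] is written as
    [L / s]. *)
Definition Zf s := s ^ 3 * dN (s - 1).

(** The node argument is [s - 1 + d] with [d = (tau p - ln p) / tau p]. Bounded in absolute value,
    the terms linear in [d] would add up to order [1 / L ^ 2], which is too much; so the linear term
    is kept exactly and only the rest is estimated. *)
Lemma main_increment p : (w <= p < z)%N -> prime p ->
  Rabs (/ INR p * (N ((L - ln (INR p)) / tau p) / tau p)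
        + (h (L / tau p.+1) - h (L / tau p)) / L
        - tau p / INR p * (tau p - ln (INR p)) * Zf (L / tau p) / L ^ 3)
  <= K * c0 * (4 * C1 ^ 2 + 1) / L ^ 3 * (/ INR p * (L / tau p) * exp (- (L / tau p))).
Proof.
move=> hp pr; have [ [h1 h2 h3 h4] [h5 h6 h7 h8]] := node_facts hp pr.
rewrite tau_S_ratio // h8; set s := L / tau p in h1 h2 h3 h4 h5 h6 h7 h8 *.
set e := tau p - ln (INR p) in h7 h8 *; set d := e / tau p in h7 h8 *.
have Ed : d = e / tau p by [].
clearbody d.
have t0 := tau_pos p.
have he : Rabs e <= C1 by apply: tau_ln; lia.
have it : / tau p = s / L by rewrite /s; field; lra.
have s0 : 0 < s by lra.
have [xi [hxi Exi]] : exists c, s * (1 - / INR p) <= c <= s /\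
   h s - h (s * (1 - / INR p)) = N (c - 1) * (s - s * (1 - / INR p)).
  apply: (@mvt h (fun x => N (x - 1))); first nra.
  by move=> x hx; apply: h_der; lra.
have dl : - / 2 <= d <= / 2 by move: h7; split_Rabs; lra.
have [c1 [hc1 hc1' E1]] := @N_mvt (s - 1) (s - 1 + d) ltac:(lra) ltac:(lra).
have [c2 [hc2 hc2' E2]] := @N_mvt (xi - 1) (s - 1) ltac:(lra) ltac:(lra).
have B1 : Rabs (dN c1 - dN (s - 1)) <= K * (c0 * exp (- 3 * s)) * Rabs d.
  have hc1a : s - 3 / 2 <= c1.
    by apply: Rle_trans hc1; apply: Rmin_glb; lra.
  apply: Rle_trans (dN_lip' _ _) _; try lra.
  apply: Rmult_le_compat; try exact: Rabs_pos.
  - by apply: Rmult_le_pos => //; apply/Rlt_le/exp_pos.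
  - by apply: e3_shift; apply: Rmin_glb; lra.
  - move: hc1 hc1'; rewrite /Rmin /Rmax; case: Rle_dec => ?; split_Rabs; lra.
have B2 : Rabs (dN c2) <= K * (c0 * exp (- 3 * s)).
  have hc2a : s - 3 / 2 <= c2.
    by apply: Rle_trans hc2; apply: Rmin_glb; lra.
  by apply: Rle_trans (dN_le _) _; [lra|apply: e3_shift].
have -> : / INR p * (N (s - 1 + d) / tau p) + (h (s * (1 - / INR p)) - h s) / L
   - tau p / INR p * e * Zf s / L ^ 3
   = / INR p * (s / L) * ((dN c1 - dN (s - 1)) * d + dN c2 * (s - xi)).
  have -> : h (s * (1 - / INR p)) - h s = - (N (xi - 1) * (s * / INR p)) by lra.
  have -> : N (s - 1 + d) = N (xi - 1) + dN c1 * d + dN c2 * (s - xi) by lra.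
  have -> : Zf s = s ^ 3 * dN (s - 1) by [].
  have -> : d = e * (s / L) by rewrite Ed /Rdiv it.
  have -> : tau p = L / s by rewrite /s; field; lra.
  by have := prime_INR pr => ?; fld.
rewrite Rabs_mult (Rabs_right (/ INR p * (s / L))); last first.
  apply/Rle_ge/Rmult_le_pos; first lra.
  by apply: Rmult_le_pos; [lra|apply/Rlt_le/Rinv_0_lt_compat; lra].
have -> : K * c0 * (4 * C1 ^ 2 + 1) / L ^ 3 * (/ INR p * s * exp (- s))
  = / INR p * (s / L) * (K * c0 * (4 * C1 ^ 2 + 1) * exp (- s) / L ^ 2).
  by have := prime_INR pr => ?; fld.
apply: Rmult_le_compat_l.
  apply/Rmult_le_pos; first lra.
  by apply: Rmult_le_pos; [lra|apply/Rlt_le/Rinv_0_lt_compat; lra].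
have [e1 [e2 [_ e4]]] := s_e3 (Rlt_le _ _ s0).
set X := K * (c0 * exp (- 3 * s)) in B1 B2.
have X0 : 0 <= X.
  by rewrite /X; apply: Rmult_le_pos => //; apply/Rlt_le/Rmult_lt_0_compat; apply: exp_pos.
apply: Rle_trans (Rabs_triang _ _) _; rewrite !Rabs_mult.
have d2 : Rabs d * Rabs d <= C1 ^ 2 * s ^ 2 / L ^ 2.
  have -> : C1 ^ 2 * s ^ 2 / L ^ 2 = (C1 * (s / L)) * (C1 * (s / L)) by field; lra.
  have A : Rabs d <= C1 * (s / L).
    rewrite Ed /Rdiv it Rabs_mult (Rabs_right (s * / L)).
      apply: Rmult_le_compat_r => //; apply: Rmult_le_pos; first lra.
      by apply/Rlt_le/Rinv_0_lt_compat; lra.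
    by apply/Rle_ge; apply: Rmult_le_pos; [lra|apply/Rlt_le/Rinv_0_lt_compat; lra].
  by apply: Rmult_le_compat => //; apply: Rabs_pos.
have q : 0 < / L ^ 2 by apply: Rinv_0_lt_compat; apply: pow_lt; lra.
have sx : Rabs (s - xi) <= s / L ^ 2.
  by rewrite Rabs_right; lra.
apply: Rle_trans (_ : X * (C1 ^ 2 * s ^ 2 / L ^ 2) + X * (s / L ^ 2) <= _).
  apply: Rplus_le_compat.
    apply: Rle_trans (_ : X * Rabs d * Rabs d <= _).
      by apply: Rmult_le_compat_r => //; apply: Rabs_pos.
    by rewrite Rmult_assoc; apply: Rmult_le_compat_l.
  by apply: Rmult_le_compat => //; apply: Rabs_pos.
have -> : X * (C1 ^ 2 * s ^ 2 / L ^ 2) + X * (s / L ^ 2)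
  = K * c0 * / L ^ 2 * (C1 ^ 2 * (s ^ 2 * exp (- 3 * s)) + s * exp (- 3 * s)).
  by rewrite /X; field; lra.
have -> : K * c0 * (4 * C1 ^ 2 + 1) * exp (- s) / L ^ 2
  = K * c0 * / L ^ 2 * (C1 ^ 2 * (4 * exp (- s)) + exp (- s)) by field; lra.
apply: Rmult_le_compat_l.
  by apply: Rmult_le_pos; [apply: Rmult_le_pos => //; apply/Rlt_le/exp_pos|lra].
apply: Rplus_le_compat => //; apply: Rmult_le_compat_l => //; exact: pow2_ge_0.
Qed.

Lemma Zf_lip x y : smin <= y -> y <= x -> x <= y + / 2 ->
  Rabs (Zf y - Zf x) <= K * c0 * 39 * exp (- x) * (x - y).
Proof.
move=> sy yx xy; rewrite /Zf.
have -> : y ^ 3 * dN (y - 1) - x ^ 3 * dN (x - 1)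
  = x ^ 3 * (dN (y - 1) - dN (x - 1)) - dN (y - 1) * (x ^ 3 - y ^ 3) by ring.
have B1 : Rabs (dN (y - 1) - dN (x - 1)) <= K * (c0 * exp (- 3 * x)) * (x - y).
  apply: Rle_trans (dN_lip _ _) _; try lra.
  rewrite (_ : x - 1 - (y - 1) = x - y); last ring.
  by apply: Rmult_le_compat_r; [lra|apply: e3_shift; lra].
have B2 : Rabs (dN (y - 1)) <= K * (c0 * exp (- 3 * x)).
  by apply: Rle_trans (dN_le _) _; [lra|apply: e3_shift; lra].
have x0 : 0 <= x by lra.
have [e1 [e2 [e3 e4]]] := s_e3 x0.
set X := K * (c0 * exp (- 3 * x)) in B1 B2.
have X0 : 0 <= X.
  by rewrite /X; apply: Rmult_le_pos => //; apply/Rlt_le/Rmult_lt_0_compat; apply: exp_pos.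
have D : 0 <= x ^ 3 - y ^ 3 <= 3 * x ^ 2 * (x - y).
  have -> : x ^ 3 - y ^ 3 = (x - y) * (x ^ 2 + x * y + y ^ 2) by ring.
  split; first by apply: Rmult_le_pos; nra.
  by rewrite Rmult_comm; apply: Rmult_le_compat_r; nra.
apply: Rle_trans (Rabs_triang _ _) _; rewrite Rabs_Ropp (Rabs_mult (x ^ 3)) (Rabs_mult (dN _)).
rewrite (Rabs_right (x ^ 3)); last by apply/Rle_ge/pow_le.
rewrite (Rabs_right (x ^ 3 - y ^ 3)); last lra.
apply: Rle_trans (_ : x ^ 3 * (X * (x - y)) + X * (3 * x ^ 2 * (x - y)) <= _).
  apply: Rplus_le_compat; first by apply: Rmult_le_compat_l => //; apply: pow_le.
  by apply: Rmult_le_compat => //; [apply: Rabs_pos|lra|lra].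
have -> : x ^ 3 * (X * (x - y)) + X * (3 * x ^ 2 * (x - y))
  = K * c0 * (x - y) * (x ^ 3 * exp (- 3 * x) + 3 * (x ^ 2 * exp (- 3 * x))).
  by rewrite /X; ring.
have -> : K * c0 * 39 * exp (- x) * (x - y) = K * c0 * (x - y) * (39 * exp (- x)) by ring.
apply: Rmult_le_compat_l; last lra.
by apply: Rmult_le_pos; [apply: Rmult_le_pos => //; apply/Rlt_le/exp_pos|lra].
Qed.

(** Signed sums of the deviation of [tau] from the logarithm; their smallness is a matter of
    cancellation, not of the size of the summands. *)
Definition Xi n := psum (fun p => tau p / INR p * (tau p - ln (INR p))) n.

Lemma Zf_le s : smin <= s -> Rabs (Zf s) <= K * c0 * 27 * exp (- s).
Proof.
move=> hs; rewrite /Zf Rabs_mult Rabs_right; last by apply/Rle_ge/pow_le; lra.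
have s0 : 0 <= s by lra.
have [_ [_ [e3 _]]] := s_e3 s0.
have B : Rabs (dN (s - 1)) <= K * (c0 * exp (- 3 * s)).
  by apply: Rle_trans (dN_le _) _; [lra|apply: e3_shift; lra].
apply: Rle_trans (_ : s ^ 3 * (K * (c0 * exp (- 3 * s))) <= _).
  by apply: Rmult_le_compat_l => //; apply: pow_le.
have -> : s ^ 3 * (K * (c0 * exp (- 3 * s))) = K * c0 * (s ^ 3 * exp (- 3 * s)) by ring.
apply: Rle_trans (_ : K * c0 * (27 * exp (- s)) <= _); last lra.
apply: Rmult_le_compat_l; last lra.
by apply: Rmult_le_pos => //; apply/Rlt_le/exp_pos.
Qed.

Lemma Kc0_ge0 : 0 <= K * c0.
Proof. by apply: Rmult_le_pos => //; apply/Rlt_le/exp_pos. Qed.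

(** The linear terms are summed by parts against [Xi], which yields [B / L ^ 3] instead of
    [1 / L ^ 2]. The constant is [4 * C1 ^ 2 + 1] from [main_increment] plus 93, that is 27 for each
    boundary term and 39 for the variation of [Zf]. *)
Lemma main_sum (B : R) : 1 <= B -> (forall n, (w <= n <= z)%N -> Rabs (Xi n) <= B) ->
  Rabs (psum (fun p => / INR p * (N ((L - ln (INR p)) / tau p) / tau p)) z
      - psum (fun p => / INR p * (N ((L - ln (INR p)) / tau p) / tau p)) w
      + (h (L / tau z) - h (L / tau w)) / L)
  <= K * c0 * (4 * C1 ^ 2 + 94) * B / L ^ 3 * exp (- (L / tau z)).
Proof.
move=> B1 HB; have kc := Kc0_ge0.
have L3 : 0 < / L ^ 3 by apply: Rinv_0_lt_compat; apply: pow_lt; lra.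
set f := fun p => / INR p * (N _ / tau p).
set x := fun p => tau p / INR p * (tau p - ln (INR p)).
set t := fun p => / INR p * (L / tau p) * exp (- (L / tau p)).
have T : psum t z - psum t w <= exp (- (L / tau z)) by apply: tele_exp => //; lra.
have T0 : 0 <= psum t z - psum t w.
  apply: psum_nonneg => // p hp pr; rewrite /t.
  apply: Rmult_le_pos; last exact/Rlt_le/exp_pos.
  have [ [h1 h2 h3 h4] _] := node_facts hp pr; apply: Rmult_le_pos; lra.
have ez := exp_pos (- (L / tau z)).
have ew : exp (- (L / tau w)) <= exp (- (L / tau z)).
  by apply: exp_le_mono; have := @s_le L w z ltac:(lra) wz; lra.
have A : Rabs (psum (fun p => x p * Zf (L / tau p)) z - psum (fun p => x p * Zf (L / tau p)) w)
   <= K * c0 * 93 * B * exp (- (L / tau z)).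
  apply: Rle_trans (@psum_abel x (fun p => Zf (L / tau p)) B w z wz HB _) _.
    by move=> p hp pr; rewrite tau_S_np.
  have -> : K * c0 * 93 * B * exp (- (L / tau z)) = B * (K * c0 * (93 * exp (- (L / tau z)))) by ring.
  apply: Rmult_le_compat_l; first lra.
  have Z1 := @Zf_le _ sz_ge.
  have Z2 := @Zf_le (L / tau w) ltac:(have := @s_le L w z ltac:(lra) wz; lra).
  have Z3 : psum (fun p => Rabs (Zf (L / tau p.+1) - Zf (L / tau p))) z
     - psum (fun p => Rabs (Zf (L / tau p.+1) - Zf (L / tau p))) w <=
     K * c0 * 39 * (psum t z - psum t w).
    rewrite Rmult_minus_distr_l -!psum_scal; apply: psum_le => // p hp pr.
    have [ [h1 h2 h3 h4] _] := node_facts hp pr.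
    rewrite tau_S_ratio //; set s := L / tau p in h1 h2 h3 h4 *.
    apply: Rle_trans (Zf_lip _ _ _) _ => //; try nra.
    by rewrite /t -/s; right; ring.
  have : K * c0 * 39 * (psum t z - psum t w) <= K * c0 * 39 * exp (- (L / tau z)).
    by apply: Rmult_le_compat_l; lra.
  have : K * c0 * 27 * exp (- (L / tau w)) <= K * c0 * 27 * exp (- (L / tau z)).
    by apply: Rmult_le_compat_l; lra.
  lra.
have M : Rabs (psum (fun p => f p - / L ^ 3 * (x p * Zf (L / tau p))) z
     - psum (fun p => f p - / L ^ 3 * (x p * Zf (L / tau p))) w
     - (- (h (L / tau z) / L) - - (h (L / tau w) / L)))
   <= K * c0 * (4 * C1 ^ 2 + 1) / L ^ 3 * (psum t z - psum t w).
  rewrite Rmult_minus_distr_l -!psum_scal.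
  apply: (@psum_diff_abs_le _ (fun n => - (h (L / tau n) / L))) => // p hp pr; last first.
    by rewrite tau_S_np.
  apply: Rle_trans (main_increment hp pr); right; congr Rabs; rewrite /f /x.
  by have := prime_INR pr; have := tau_pos p => ? ?; fld.
have split_sum n : psum (fun p => f p - / L ^ 3 * (x p * Zf (L / tau p))) n
   = psum f n - / L ^ 3 * psum (fun p => x p * Zf (L / tau p)) n.
  rewrite -psum_scal (_ : forall a b, a - b = a + (-1) * b) -?psum_scal -?psum_plus; last by move=> *; ring.
  by apply: psum_ext => p _ _; ring.
rewrite !split_sum in M.
have M2 : K * c0 * (4 * C1 ^ 2 + 1) / L ^ 3 * (psum t z - psum t w)
   <= K * c0 * (4 * C1 ^ 2 + 1) / L ^ 3 * exp (- (L / tau z)).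
  apply: Rmult_le_compat_l => //; apply: Rmult_le_pos; last lra.
  by apply: Rmult_le_pos => //; nra.
have M3 : K * c0 * (4 * C1 ^ 2 + 1) / L ^ 3 * exp (- (L / tau z))
   <= K * c0 * (4 * C1 ^ 2 + 1) * B / L ^ 3 * exp (- (L / tau z)).
  apply: Rmult_le_compat_r; first lra.
  apply: Rmult_le_compat_r; first lra.
  have : 0 <= K * c0 * (4 * C1 ^ 2 + 1) by apply: Rmult_le_pos => //; nra.
  nra.
have A2 : / L ^ 3 * Rabs (psum (fun p => x p * Zf (L / tau p)) z - psum (fun p => x p * Zf (L / tau p)) w)
   <= / L ^ 3 * (K * c0 * 93 * B * exp (- (L / tau z))) by apply: Rmult_le_compat_l; lra.
have -> : K * c0 * (4 * C1 ^ 2 + 94) * B / L ^ 3 * exp (- (L / tau z))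
  = K * c0 * (4 * C1 ^ 2 + 1) * B / L ^ 3 * exp (- (L / tau z)) +
    / L ^ 3 * (K * c0 * 93 * B * exp (- (L / tau z))) by field; lra.
move: A2; rewrite -{1}(Rabs_right (/ L ^ 3)); last lra.
rewrite -Rabs_mult Rmult_minus_distr_l (_ : (h _ - h _) / L = h (L / tau z) / L - h (L / tau w) / L); last by field; lra.
move: M M2 M3; split_Rabs; lra.
Qed.

(** This is the recursion of [main_sum] differentiated in [L]; it propagates the main part of [Err],
    which is up to sign the [L]-derivative of the main term. The factor [1 / L ^ 2] is already
    present, so a crude bound for [d] suffices. *)
Lemma k_sum :
  Rabs (psum (fun p => / INR p * (dN ((L - ln (INR p)) / tau p) / tau p ^ 2)) z
      - psum (fun p => / INR p * (dN ((L - ln (INR p)) / tau p) / tau p ^ 2)) w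
      + (k (L / tau z) - k (L / tau w)) / L ^ 2)
  <= K * c0 * (4 * C1 + 6) / L ^ 3 * exp (- (L / tau z)).
Proof.
have kc := Kc0_ge0.
have L3 : 0 < / L ^ 3 by apply: Rinv_0_lt_compat; apply: pow_lt; lra.
set f := fun p => / INR p * (dN _ / tau p ^ 2).
set t := fun p => / INR p * (L / tau p) * exp (- (L / tau p)).
have T : psum t z - psum t w <= exp (- (L / tau z)) by apply: tele_exp => //; lra.
have -> : (k (L / tau z) - k (L / tau w)) / L ^ 2
   = - (- (k (L / tau z) / L ^ 2) - - (k (L / tau w) / L ^ 2)) by field; lra.
apply: Rle_trans (_ : K * c0 * (4 * C1 + 6) / L ^ 3 * (psum t z - psum t w) <= _); last first.
  by apply: Rmult_le_compat_l => //; apply: Rmult_le_pos; [apply: Rmult_le_pos => //; lra|lra].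
rewrite Rmult_minus_distr_l -!psum_scal.
apply: (@psum_diff_abs_le _ (fun n => - (k (L / tau n) / L ^ 2))) => // p hp pr; last first.
  by rewrite tau_S_np.
have [ [h1 h2 h3 h4] [h5 h6 h7 h8]] := node_facts hp pr.
rewrite /f /t tau_S_ratio // h8; set s := L / tau p in h1 h2 h3 h4 h5 h6 h7 h8 *.
set e := tau p - ln (INR p) in h7 h8 *; set d := e / tau p in h7 h8 *.
have Ed : d = e / tau p by [].
clearbody d.
have t0 := tau_pos p.
have he : Rabs e <= C1 by apply: tau_ln; lia.
have it : / tau p = s / L by rewrite /s; field; lra.
have s0 : 0 < s by lra.
have [xi [hxi Exi]] : exists c, s * (1 - / INR p) <= c <= s /\
   k s - k (s * (1 - / INR p)) = c * dN (c - 1) * (s - s * (1 - / INR p)).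
  apply: (@mvt k (fun x => x * dN (x - 1))); first nra.
  by move=> x hx; apply: k_der; lra.
have dl : - / 2 <= d <= / 2 by move: h7; split_Rabs; lra.
have dd : Rabs d <= C1 * (s / L).
  rewrite Ed /Rdiv it Rabs_mult (Rabs_right (s * / L)).
    apply: Rmult_le_compat_r => //; apply: Rmult_le_pos; first lra.
    by apply/Rlt_le/Rinv_0_lt_compat; lra.
  by apply/Rle_ge; apply: Rmult_le_pos; [lra|apply/Rlt_le/Rinv_0_lt_compat; lra].
have B1 : Rabs (dN (s - 1 + d) - dN (xi - 1)) <= K * (c0 * exp (- 3 * s)) * (C1 * (s / L) + s / L).
  apply: Rle_trans (dN_lip' _ _) _; try lra.
  apply: Rmult_le_compat; try exact: Rabs_pos.
  - by apply: Rmult_le_pos => //; apply/Rlt_le/exp_pos.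
  - by apply: e3_shift; apply: Rmin_glb; lra.
  - have : Rabs (s - xi) <= s / L.
      rewrite Rabs_right; last lra.
      apply: Rle_trans (_ : s / L ^ 2 <= _); first lra.
      apply: Rmult_le_compat_l; first lra.
      by apply: Rinv_le_contravar; [lra|nra].
    by move: dd; split_Rabs; lra.
have B2 : Rabs (dN (xi - 1)) <= K * (c0 * exp (- 3 * s)).
  by apply: Rle_trans (dN_le _) _; [lra|apply: e3_shift; lra].
have -> : / INR p * (dN (s - 1 + d) / tau p ^ 2)
     - (- (k (s * (1 - / INR p)) / L ^ 2) - - (k s / L ^ 2))
   = / INR p * s * (/ L ^ 2) * (s * (dN (s - 1 + d) - dN (xi - 1)) + (s - xi) * dN (xi - 1)).
  have -> : k (s * (1 - / INR p)) = k s - xi * dN (xi - 1) * (s * / INR p) by lra.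
  have -> : tau p = L / s by rewrite /s; field; lra.
  by have := prime_INR pr => ?; fld.
have L2 : 0 < / L ^ 2 by apply: Rinv_0_lt_compat; apply: pow_lt; lra.
have g0 : 0 <= / INR p * s * / L ^ 2.
  by apply: Rmult_le_pos; [apply: Rmult_le_pos|]; lra.
rewrite Rabs_mult (Rabs_right (/ INR p * s * / L ^ 2)); last exact/Rle_ge.
have -> : K * c0 * (4 * C1 + 6) / L ^ 3 * (/ INR p * s * exp (- s))
  = / INR p * s * / L ^ 2 * (K * c0 * (4 * C1 + 6) / L * exp (- s)).
  by have := prime_INR pr => ?; fld.
apply: Rmult_le_compat_l => //.
have [e1 [e2 [e3 e4]]] := s_e3 (Rlt_le _ _ s0).
set X := K * (c0 * exp (- 3 * s)) in B1 B2.
have X0 : 0 <= X.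
  by rewrite /X; apply: Rmult_le_pos => //; apply/Rlt_le/Rmult_lt_0_compat; apply: exp_pos.
apply: Rle_trans (Rabs_triang _ _) _; rewrite (Rabs_mult s) (Rabs_mult (s - xi)) (Rabs_right s); last lra.
apply: Rle_trans (_ : s * (X * (C1 * (s / L) + s / L)) + s / L * X <= _).
  apply: Rplus_le_compat; first by apply: Rmult_le_compat_l; lra.
  apply: Rmult_le_compat => //; try exact: Rabs_pos.
  rewrite Rabs_right; last lra.
  apply: Rle_trans (_ : s / L ^ 2 <= _); first lra.
  apply: Rmult_le_compat_l; first lra.
  by apply: Rinv_le_contravar; [lra|nra].
have -> : s * (X * (C1 * (s / L) + s / L)) + s / L * X
   = K * c0 / L * ((C1 + 1) * (s ^ 2 * exp (- 3 * s)) + s * exp (- 3 * s)).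
  by rewrite /X; field; lra.
have -> : K * c0 * (4 * C1 + 6) / L * exp (- s) = K * c0 / L * ((4 * C1 + 6) * exp (- s)) by field; lra.
apply: Rmult_le_compat_l.
  by apply: Rmult_le_pos => //; apply/Rlt_le/Rinv_0_lt_compat; lra.
have := exp_pos (- s); nra.
Qed.

End Sums.

(** * The error term of the recursion *)

(** Fourth roots separate three scales: [room] gains [L ^ (-9/4)], the second part of [Err] has
    order [L ^ (-5/2)], and with [Xi] of order at most [q4 L] the error of [main_sum] is
    [L ^ (-11/4)]. *)
Definition q4 (x : R) : R := sqrt (sqrt x).

Lemma q4_pow x : 0 <= x -> q4 x ^ 4 = x.
Proof.
move=> x0; have s0 := sqrt_pos x.
rewrite (_ : q4 x ^ 4 = (q4 x * q4 x) * (q4 x * q4 x)); last ring.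
by rewrite /q4 sqrt_sqrt // sqrt_sqrt.
Qed.

Lemma q4_pos x : 0 < x -> 0 < q4 x.
Proof. by move=> x0; apply: sqrt_lt_R0; apply: sqrt_lt_R0. Qed.

Lemma q4_le x y : x <= y -> q4 x <= q4 y.
Proof. by move=> xy; apply: sqrt_le_1_alt; apply: sqrt_le_1_alt. Qed.

Lemma q4_scal_le a x y : 0 <= a -> 0 <= y -> x <= a ^ 4 * y -> q4 x <= a * q4 y.
Proof.
move=> a0 y0 /q4_le H; apply: Rle_trans H _; rewrite /q4.
have -> : a ^ 4 * y = (a * a) * (a * a) * y by ring.
rewrite sqrt_mult //; try nra.
rewrite sqrt_square; last nra.
rewrite sqrt_mult ?sqrt_square //; try nra.
exact: sqrt_pos.
Qed.

Lemma q4_scal_ge a x y : 0 <= a -> 0 <= y -> a ^ 4 * y <= x -> a * q4 y <= q4 x.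
Proof.
move=> a0 y0 /q4_le H; apply: Rle_trans H; rewrite /q4.
have -> : a ^ 4 * y = (a * a) * (a * a) * y by ring.
rewrite sqrt_mult //; try nra.
rewrite sqrt_square; last nra.
rewrite sqrt_mult ?sqrt_square //; try nra.
exact: sqrt_pos.
Qed.

Lemma crossing (u : nat -> R) (T : R) (a b : nat) : (a <= b)%N -> u a <= T -> T < u b ->
  exists c, [/\ (a <= c < b)%N, u c <= T & T < u c.+1].
Proof.
move=> /subnKC <-; elim: (b - a)%N => [|d IH] ha hb; first by rewrite addn0 in hb; lra.
have [h|h] := Rle_lt_dec (u (a + d)%N) T; last by have [c [h1 h2 h3]] := IH ha h; exists c; split=> //; lia.
by exists (a + d)%N; split=> //; [lia|rewrite addnS in hb].
Qed.

Section ErrStep.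
Variable tau : nat -> R.
Hypothesis tau_pos : forall n, 0 < tau n.
Hypothesis tau_S : forall n, tau n.+1 = if prime n then tau n / (1 - / INR n) else tau n.

(** At a prime [ln (tau p)] grows by [- ln (1 - / p)], which is at most [2 / p]. *)
Lemma recip_sum_ge a b : (a <= b)%N ->
  / 2 * (ln (tau b) - ln (tau a)) <= psum (fun p => / INR p) b - psum (fun p => / INR p) a.
Proof.
move=> ab.
have := @psum_tele_le (fun p => - / INR p) (fun n => - (/ 2 * ln (tau n))) a b ab.
rewrite -!(psum_ext (f := fun p => (-1) * / INR p) (g := fun p => - / INR p)); try by move=> *; lra.
rewrite !psum_scal => H.
suff: -1 * psum (fun p => / INR p) b - -1 * psum (fun p => / INR p) a <= - (/ 2 * ln (tau b)) - - (/ 2 * ln (tau a)) by lra.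
apply: H => p hp pr; last by rewrite tau_S (negbTE pr); lra.
rewrite tau_S pr; have p2 := prime_INR pr; have t0 := tau_pos p.
have ip : 0 < / INR p by apply: Rinv_0_lt_compat; lra.
have ip2 : / INR p <= / 2 by apply: Rinv_le_contravar; lra.
rewrite ln_div; try lra.
have := @ln_le_sub1 (/ (1 - / INR p)) ltac:(apply: Rinv_0_lt_compat; lra).
rewrite ln_Rinv; last lra.
have : / (1 - / INR p) - 1 <= 2 * / INR p; last lra.
have -> : / (1 - / INR p) - 1 = / INR p * / (1 - / INR p) by field; lra.
rewrite Rmult_comm; apply: Rmult_le_compat_r; first lra.
by rewrite -(Rinv_inv 2); apply: Rinv_le_contravar; lra.
Qed.

Variables (C1 L Ck k16 : R) (w z : nat).
Variables (nN nT : R -> R) (xm : R).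
Hypothesis C1_ge1 : 1 <= C1.
Hypothesis Ck_ge0 : 0 <= Ck.
Hypothesis k16_pos : 0 < k16.
Hypothesis L_C1 : 200 * C1 <= L.
Hypothesis wz : (w <= z)%N.
Hypothesis sz_ge : 2 <= L / tau z.
Hypothesis xm_le : xm + 3 / 2 <= L / tau z.
Hypothesis sw_ge : 18 <= L / tau w.
Hypothesis tau_wC : 20 * C1 <= tau w.
Hypothesis w_ge : L ^ 2 <= INR w.
Hypothesis tau_ln : forall p, (w <= p <= z)%N -> Rabs (tau p - ln (INR p)) <= C1.
Hypothesis nN_ge0 : forall x, xm <= x -> 0 <= nN x.
Hypothesis nN_ge : forall x, 14 <= x <= 18 -> k16 <= nN x.
Hypothesis nT_ge0 : 0 <= nT (L / tau z).
Hypothesis KS :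
  - (Ck / L ^ 3 * exp (- (L / tau z))) <=
  nT (L / tau z) / tau z ^ 2 -
   (psum (fun p => / INR p * (nN ((L - ln (INR p)) / tau p) / tau p ^ 2)) z
    - psum (fun p => / INR p * (nN ((L - ln (INR p)) / tau p) / tau p ^ 2)) w).
Hypothesis Y1 : 20 * Ck <= q4 L ^ 2.
Hypothesis Y2 : 10 * (67 + Ck) <= k16 * q4 L.

(* Along Buchstab's recursion [ell] decreases, hence so does the factor [1 - / q4 ell]; the gain this
   gives on the primes with [L / tau p] in (8, 9] absorbs every error of smaller order. *)
Definition Err (n : R -> R) (ell t : R) : R :=
  (1 - / q4 ell) * (n (ell / t) / t ^ 2) + exp (- (ell / t)) / q4 ell ^ 10.

Let y := q4 L.

Lemma L_pos : 0 < L. Proof. lra. Qed.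
Lemma yL : y ^ 4 = L. Proof. by apply: q4_pow; lra. Qed.
Lemma y1 : 1 <= y.
Proof.
have H := @q4_scal_ge 1 L 1 ltac:(lra) ltac:(lra) ltac:(lra).
by move: H; rewrite /y /q4 !sqrt_1; lra.
Qed.

Lemma pfacts p : (w <= p < z)%N -> prime p ->
  let s := L / tau p in let ell := L - ln (INR p) in
  [/\ L / tau z <= s, 0 < / INR p, 20 * C1 <= tau p & L / 4 <= ell] /\
  [/\ ell / tau p = s - 1 + (tau p - ln (INR p)) / tau p,
      Rabs ((tau p - ln (INR p)) / tau p) <= / 20, ell <= L & xm <= ell / tau p].
Proof.
move=> hp pr s ell; have p2 := prime_INR pr; have t0 := tau_pos p.
have tw : tau w <= tau p by apply: tau_le => //; lia.
have hs : L / tau z <= s by apply: (s_le tau_pos tau_S); [lra|lia].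
have hl : Rabs (tau p - ln (INR p)) <= C1 by apply: tau_ln; lia.
have ts : tau p <= L / 2.
  have : 2 * tau p <= s * tau p by apply: Rmult_le_compat_r; lra.
  by rewrite /s /Rdiv Rmult_assoc Rinv_l; lra.
have hd : Rabs ((tau p - ln (INR p)) / tau p) <= / 20.
  rewrite Rabs_mult (Rabs_right (/ tau p)); last exact/Rle_ge/Rlt_le/Rinv_0_lt_compat.
  by apply: (Rmult_le_reg_r (tau p)) => //; rewrite Rmult_assoc Rinv_l; lra.
have he : ell / tau p = s - 1 + (tau p - ln (INR p)) / tau p by rewrite /ell /s; field; lra.
have lnp : 0 <= ln (INR p) by rewrite -ln_1; apply: ln_le_mono; lra.
split; split=> //; try by rewrite /ell; move: hl; split_Rabs; lra.
- by apply: Rinv_0_lt_compat; lra.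
- by rewrite he; move: hd; split_Rabs; lra.
Qed.

Lemma q4_ell p : (w <= p < z)%N -> prime p ->
  0 < q4 (L - ln (INR p)) <= y /\ y ^ 10 / 32 <= q4 (L - ln (INR p)) ^ 10.
Proof.
move=> hp pr; have [ [h1 h2 h3 h4] [h5 h6 h7 h8]] := pfacts hp pr; have L0 := L_pos.
set ell := L - ln (INR p) in h4 h7 *.
split; first by split; [apply: q4_pos; lra|apply: q4_le].
have e0 : 0 <= ell by lra.
have H : (q4 ell ^ 4 * q4 ell ^ 4 * (q4 ell ^ 2)) = q4 ell ^ 10 by ring.
have Hy : (y ^ 4 * y ^ 4 * (y ^ 2)) = y ^ 10 by ring.
rewrite -H -Hy q4_pow // yL.
have q2 : y ^ 2 / 2 <= q4 ell ^ 2.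
  have A : 0 <= q4 ell ^ 2 by apply: pow2_ge_0.
  have B : 0 <= y ^ 2 by apply: pow2_ge_0.
  have C : (y ^ 2 / 2) * (y ^ 2 / 2) <= q4 ell ^ 2 * q4 ell ^ 2.
    have -> : q4 ell ^ 2 * q4 ell ^ 2 = q4 ell ^ 4 by ring.
    have -> : y ^ 2 / 2 * (y ^ 2 / 2) = y ^ 4 / 4 by field.
    by rewrite q4_pow // yL; lra.
  nra.
have -> : L * L * y ^ 2 / 32 = (L / 4 * (L / 4)) * (y ^ 2 / 2) by field.
have B : 0 <= y ^ 2 by apply: pow2_ge_0.
by apply: Rmult_le_compat; [nra|lra|nra|].
Qed.

(** The node exponent is [s - 1] up to [1 / 20], and [exp (21 / 20) <= 4]. *)
Lemma exp_node p : (w <= p < z)%N -> prime p ->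
  exp (- ((L - ln (INR p)) / tau p)) <= 4 * exp (- (L / tau p)).
Proof.
move=> hp pr; have [ [h1 h2 h3 h4] [h5 h6 h7 h8]] := pfacts hp pr.
rewrite h5; apply: Rle_trans (_ : exp (- (L / tau p)) * (exp 1 * exp (/ 20)) <= _).
  by rewrite -!exp_plus; apply: exp_le_mono; move: h6; split_Rabs; lra.
rewrite Rmult_comm; apply: Rmult_le_compat_r; first exact/Rlt_le/exp_pos.
have e1 := exp_le_3; have e0 := exp_pos 1.
have : exp (/ 20) <= 20 / 19.
  have E : exp (/ 20) * exp (- / 20) = 1 by rewrite -exp_plus Rplus_opp_r exp_0.
  have := exp_ineq1_le (- / 20); have := exp_pos (/ 20); nra.
have := exp_pos (/ 20); nra.
Qed.

Definition Psum n := psum (fun p => / INR p *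
   (exp (- ((L - ln (INR p)) / tau p)) / q4 (L - ln (INR p)) ^ 10)) n.

(** The summands are compared with those of [tele_exp], which carry an additional factor
    [L / tau p >= a]; this is the source of [1 / a], which beats the other constants when
    [L / tau z] is large. *)
Lemma Psum_le (c a : R) : 0 < a -> a <= L / tau z -> 0 < c ->
  (forall p, (w <= p < z)%N -> prime p -> y ^ 10 / c <= q4 (L - ln (INR p)) ^ 10) ->
  Psum z - Psum w <= 4 * c / a * (exp (- (L / tau z)) / y ^ 10).
Proof.
move=> a0 az c0 H; have y0 := y1; have L0 := L_pos.
have y10 : 0 < y ^ 10 by apply: pow_lt; lra.
have T := tele_exp tau_pos tau_S L0 wz.
set t := fun p => _ * _ * _ in T.
apply: Rle_trans (_ : 4 * c / a / y ^ 10 * (psum t z - psum t w) <= _); last first.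
  have -> : 4 * c / a * (exp (- (L / tau z)) / y ^ 10) = 4 * c / a / y ^ 10 * exp (- (L / tau z)) by field; lra.
  apply: Rmult_le_compat_l => //; apply/Rlt_le/Rdiv_lt_0_compat => //.
  by apply: Rdiv_lt_0_compat; lra.
rewrite Rmult_minus_distr_l -!psum_scal; apply: psum_le => // p hp pr.
have [ [h1 h2 h3 h4] _] := pfacts hp pr.
have H1 := exp_node hp pr; have H2 := H p hp pr; rewrite /t.
set Q := q4 _ ^ 10 in H2 *.
have Q0 : 0 < y ^ 10 / c by apply: Rdiv_lt_0_compat.
have H3 : / Q <= c / y ^ 10.
  have -> : c / y ^ 10 = / (y ^ 10 / c) by field; lra.
  exact: Rinv_le_contravar.
have e0 := exp_pos (- (L / tau p)).
have -> : 4 * c / a / y ^ 10 * (/ INR p * (L / tau p) * exp (- (L / tau p)))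
  = / INR p * (4 * exp (- (L / tau p)) * (L / tau p / a) * (c / y ^ 10)).
  by have := prime_INR pr; have := tau_pos p => ? ?; fld.
apply: Rmult_le_compat_l; first lra.
apply: Rmult_le_compat => //.
- exact/Rlt_le/exp_pos.
- by apply/Rlt_le/Rinv_0_lt_compat; lra.
- apply: Rle_trans H1 _; rewrite -[X in X <= _]Rmult_1_r; apply: Rmult_le_compat_l; first lra.
  apply: (Rmult_le_reg_r a) => //; rewrite /Rdiv Rmult_assoc Rinv_l; lra.
Qed.

(** From [L / tau w >= 18] to [L / tau z < 16] the recursion passes primes with [L / tau p] between
    16 and 18. For these [ln p >= L / 20], hence [q4 ell <= 99 / 100 * y], and the factor
    [1 - / q4 ell] is smaller than [1 - / y] by at least [1 / (100 * y)]. Their reciprocals add up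
    to at least [3 / 70]. *)
Lemma room : L / tau z < 16 ->
  k16 / 10 / y ^ 9 <=
  psum (fun p => / INR p * ((/ q4 (L - ln (INR p)) - / y) * (nN ((L - ln (INR p)) / tau p) / tau p ^ 2))) z
  - psum (fun p => / INR p * ((/ q4 (L - ln (INR p)) - / y) * (nN ((L - ln (INR p)) / tau p) / tau p ^ 2))) w.
Proof.
move=> s16; have y0 := y1; have L0 := L_pos; set g := fun p => _ * _.
have tz := tau_pos z; have tw := tau_pos w.
have tz16 : L / 16 < tau z.
  have : L / tau z * tau z < 16 * tau z by apply: Rmult_lt_compat_r.
  by rewrite /Rdiv Rmult_assoc Rinv_l; lra.
have tw18 : tau w <= L / 18.
  have : 18 * tau w <= L / tau w * tau w by apply: Rmult_le_compat_r; lra.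
  by rewrite /Rdiv Rmult_assoc Rinv_l; lra.
have tz18 : L / 18 < tau z by lra.
have [a [ha a1 a2]] := @crossing tau (L / 18) w z wz tw18 tz18.
(* The prime at which [tau] crosses [L / 18] overshoots it only slightly; [35 / 2] in place of 18
   allows for that. *)
have a3 : tau a.+1 <= L / (35 / 2).
  rewrite tau_S; case: ifP => pr; last lra.
  have pw : INR w <= INR a by apply: le_INR; lia.
  have ia : / INR a <= / 40000 by apply: Rinv_le_contravar; nra.
  have ta := tau_pos a.
  apply: (Rmult_le_reg_r (1 - / INR a)); first lra.
  rewrite /Rdiv Rmult_assoc Rinv_l; nra.
have az : (a.+1 <= z)%N by lia.
have [|b [hb b1 b2]] := @crossing tau (L / 16) a.+1 z az _ tz16; first lra.
have sub : psum g b.+1 - psum g a.+1 <= psum g z - psum g w.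
  have G0 : forall p, (w <= p < z)%N -> prime p -> 0 <= g p.
    move=> p hp pr; have [ [h1 h2 h3 h4] [h5 h6 h7 h8]] := pfacts hp pr.
    have [ [q1 q2] _] := q4_ell hp pr; rewrite /g.
    apply: Rmult_le_pos; first lra.
    apply: Rmult_le_pos; first by have := Rinv_le_contravar _ _ q1 q2; lra.
    apply: Rmult_le_pos; first exact: nN_ge0.
    by apply/Rlt_le/Rinv_0_lt_compat/pow_lt.
  have H1 : 0 <= psum g z - psum g b.+1 by apply: psum_nonneg; [lia|move=> p hp; apply: G0; lia].
  have H2 : 0 <= psum g a.+1 - psum g w by apply: psum_nonneg; [lia|move=> p hp; apply: G0; lia].
  lra.
apply: Rle_trans sub.
have M := @recip_sum_ge a.+1 b.+1 ltac:(lia).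
have lnr : 6 / 70 <= ln (tau b.+1) - ln (tau a.+1).
  have := @ln_le_sub1 (tau a.+1 / tau b.+1) ltac:(by apply: Rdiv_lt_0_compat).
  rewrite ln_div //.
  have : tau a.+1 / tau b.+1 <= 64 / 70; last lra.
  apply: (Rmult_le_reg_r (tau b.+1)) => //.
  by rewrite /Rdiv Rmult_assoc Rinv_l; [lra|have := tau_pos b.+1; lra].
set c := / 100 / y * (k16 * (256 / L ^ 2)).
apply: Rle_trans (_ : c * (psum (fun p => / INR p) b.+1 - psum (fun p => / INR p) a.+1) <= _).
  apply: Rle_trans (_ : c * (/ 2 * (6 / 70)) <= _).
    have -> : c = 256 / 100 * (k16 / y ^ 9) by rewrite /c -yL; field; lra.
    have : 0 < k16 / y ^ 9 by apply: Rdiv_lt_0_compat => //; apply: pow_lt; lra.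
    rewrite /Rdiv; nra.
  apply: Rmult_le_compat_l; last lra.
  rewrite /c; repeat (apply: Rmult_le_pos); try lra.
  + by apply/Rlt_le/Rinv_0_lt_compat; lra.
  + by apply/Rlt_le/Rinv_0_lt_compat/pow_lt.
rewrite Rmult_minus_distr_l -!psum_scal; apply: psum_le; first lia.
move=> p hp pr; have hp' : (w <= p < z)%N by lia.
have [ [h1 h2 h3 h4] [h5 h6 h7 h8]] := pfacts hp' pr.
have [ [q1 q2] _] := q4_ell hp' pr.
have t1 : L / 18 < tau p by apply: Rlt_le_trans a2 _; apply: tau_le => //; lia.
have t2 : tau p <= L / 16 by apply: Rle_trans b1; apply: tau_le => //; lia.
have hl : Rabs (tau p - ln (INR p)) <= C1 by apply: tau_ln; lia.
have lnp : L / 20 <= ln (INR p) by move: hl; split_Rabs; lra.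
rewrite /g Rmult_comm; apply: Rmult_le_compat_l; first lra.
rewrite /c; apply: Rmult_le_compat.
- by apply: Rmult_le_pos; [lra|apply/Rlt_le/Rinv_0_lt_compat; lra].
- by apply: Rmult_le_pos; [lra|apply: Rmult_le_pos; [lra|apply/Rlt_le/Rinv_0_lt_compat/pow_lt]].
- have := @q4_scal_le (99 / 100) (L - ln (INR p)) L ltac:(lra) ltac:(lra) ltac:(lra).
  rewrite -/y => q3.
  have : / (99 / 100 * y) <= / q4 (L - ln (INR p)) by apply: Rinv_le_contravar.
  have -> : / (99 / 100 * y) = 100 / 99 * / y by field; lra.
  have : 0 < / y by apply: Rinv_0_lt_compat; lra.
  rewrite /Rdiv; lra.
apply: Rmult_le_compat; first lra.
- by apply: Rmult_le_pos; [lra|apply/Rlt_le/Rinv_0_lt_compat/pow_lt].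
- apply: nN_ge; rewrite h5.
  have sp : 16 <= L / tau p <= 18.
    have tp := tau_pos p.
    split; apply: (Rmult_le_reg_r (tau p)) => //; rewrite /Rdiv Rmult_assoc Rinv_l; lra.
  by move: h6; split_Rabs; lra.
have -> : 256 / L ^ 2 = / (L / 16) ^ 2 by field; lra.
have tp := tau_pos p; apply: Rinv_le_contravar; first exact: pow_lt.
by apply: pow_incr; lra.
Qed.

(** For [L / tau z >= 16] the second part of [Err] reproduces itself with a factor at most
    [4 * 2 / 16], so it pays for itself and for the error in [KS]. Below 16 that factor is only
    known to be at most 64; then the gain of [room] pays, being larger by a factor of order
    [q4 L]. *)
Lemma err_step :
  3 / 10 * (exp (- (L / tau z)) / y ^ 10) <=
  Err nT L (tau z) - (psum (fun p => / INR p * Err nN (L - ln (INR p)) (tau p)) z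
    - psum (fun p => / INR p * Err nN (L - ln (INR p)) (tau p)) w).
Proof.
have y0 := y1; have L0 := L_pos.
set A := fun p => / INR p * (nN ((L - ln (INR p)) / tau p) / tau p ^ 2).
set G := fun p => / INR p * ((/ q4 (L - ln (INR p)) - / y) * (nN ((L - ln (INR p)) / tau p) / tau p ^ 2)).
have E n : psum (fun p => / INR p * Err nN (L - ln (INR p)) (tau p)) n
   = (1 - / y) * psum A n - psum G n + Psum n.
  rewrite (_ : (1 - / y) * psum A n - psum G n = (1 - / y) * psum A n + (-1) * psum G n); last ring.
  by rewrite -!psum_scal /Psum -!psum_plus; apply: psum_ext => p _ _; rewrite /Err /A /G; ring.
rewrite !E /Err -/y.
have y10 : 0 < / y ^ 10 by apply/Rinv_0_lt_compat/pow_lt; lra.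
have iy : 0 < / y <= 1.
  by split; [apply: Rinv_0_lt_compat; lra|rewrite -Rinv_1; apply: Rinv_le_contravar; lra].
have L3 : / L ^ 3 = / y ^ 10 * / y ^ 2 by rewrite -yL; field; lra.
have e0 := exp_pos (- (L / tau z)); set ez := exp (- (L / tau z)) in e0 *.
have ez1 : ez <= 1 by rewrite -exp_0; apply: exp_le_mono; lra.
have ks : - (Ck * / L ^ 3 * ez) <= (1 - / y) * (nT (L / tau z) / tau z ^ 2 - (psum A z - psum A w)).
  have KS' := KS; rewrite -/ez -/A in KS'.
  set d := _ - (psum A z - psum A w) in KS' *.
  have : 0 <= Ck / L ^ 3 * ez.
    apply: Rmult_le_pos; last lra.
    by apply: Rmult_le_pos => //; apply/Rlt_le/Rinv_0_lt_compat/pow_lt.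
  rewrite /Rdiv in KS' *; nra.
have ck : Ck * / L ^ 3 * ez <= / 20 * (/ y ^ 10) * ez.
  apply: Rmult_le_compat_r; first lra.
  rewrite L3.
  have : Ck * / y ^ 2 <= / 20; last by nra.
  have y2 : 0 < y ^ 2 by apply: pow_lt; lra.
  by apply: (Rmult_le_reg_r (y ^ 2)) => //; rewrite Rmult_assoc Rinv_l; have Y1' : 20 * Ck <= y ^ 2 := Y1; lra.
have [s16|s16] := Rlt_le_dec (L / tau z) 16.
- have R := room s16; rewrite -/G in R.
  have P := @Psum_le 32 2 ltac:(lra) sz_ge ltac:(lra) (fun p hp pr => (q4_ell hp pr).2).
  rewrite -/ez in P.
  have k : (67 + Ck) * / y ^ 10 <= k16 / 10 / y ^ 9.
    have -> : k16 / 10 / y ^ 9 = (k16 * y / 10) * / y ^ 10 by field; lra.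
    by apply: Rmult_le_compat_r; have Y2' : 10 * (67 + Ck) <= k16 * y := Y2; lra.
  have p2 : 4 * 32 / 2 * (ez / y ^ 10) <= 64 * / y ^ 10.
    rewrite /Rdiv; have : 0 <= (1 - ez) * / y ^ 10 by apply: Rmult_le_pos; lra.
    lra.
  have p3 : ez / y ^ 10 <= / y ^ 10.
    rewrite /Rdiv; have : 0 <= (1 - ez) * / y ^ 10 by apply: Rmult_le_pos; lra.
    lra.
  have p4 : 0 < ez / y ^ 10 by apply: Rmult_lt_0_compat.
  have p5 : 0 <= Ck * / y ^ 10 by apply: Rmult_le_pos; lra.
  rewrite /Rdiv in ks ck k p2 p3 p4 R *; lra.
have R : 0 <= psum G z - psum G w.
  apply: psum_nonneg => // p hp pr; have [ [h1 h2 h3 h4] [h5 h6 h7 h8]] := pfacts hp pr.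
  have [ [q1 q2] _] := q4_ell hp pr; rewrite /G.
  apply: Rmult_le_pos; first lra.
  apply: Rmult_le_pos; first by have := Rinv_le_contravar _ _ q1 q2; lra.
  apply: Rmult_le_pos; first exact: nN_ge0.
  by apply/Rlt_le/Rinv_0_lt_compat/pow_lt.
have P : Psum z - Psum w <= 4 * 2 / 16 * (ez / y ^ 10).
  apply: Psum_le => //; try lra; move=> p hp pr.
  have [ [h1 h2 h3 h4] [h5 h6 h7 h8]] := pfacts hp pr.
  have hl : Rabs (tau p - ln (INR p)) <= C1 by apply: tau_ln; lia.
  have ts : tau p <= L / 16.
    have tp := tau_pos p.
    have : 16 * tau p <= L / tau p * tau p by apply: Rmult_le_compat_r; lra.
    by rewrite /Rdiv Rmult_assoc Rinv_l; lra.
  have := @q4_scal_ge (95 / 100) (L - ln (INR p)) L ltac:(lra) ltac:(lra) ltac:(move: hl; split_Rabs; lra).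
  rewrite -/y => q.
  apply: Rle_trans (_ : (95 / 100 * y) ^ 10 <= _); last by apply: pow_incr; lra.
  rewrite Rpow_mult_distr; have : 0 < y ^ 10 by apply: pow_lt; lra.
  have : / 2 <= (95 / 100) ^ 10 by lra.
  rewrite /Rdiv; nra.
have p4 : 0 < ez / y ^ 10 by apply: Rmult_lt_0_compat.
rewrite /Rdiv in ks ck p4 P *; lra.
Qed.

End ErrStep.

(** * The linear sieve *)

Definition Sz (A : seq nat) (E : nat -> nat -> bool) (z : nat) : R := INR (sift A E (plist z)).

(** The elements lost between [w] and [z] are sorted by the least prime that excludes them. *)
Lemma buchstab A E w z : (w <= z)%N ->
  Sz A E z = Sz A E w - (psum (fun p => Sz [seq i <- A | E p i] E p) z
                        - psum (fun p => Sz [seq i <- A | E p i] E p) w).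
Proof.
move=> /subnKC <-; elim: (z - w)%N => [|d IH]; first by rewrite addn0; lra.
rewrite addnS /=; rewrite {1}/Sz /=; case: ifP => pr; last by rewrite -/(Sz A E (w + d)) IH; lra.
by rewrite sift_cons -!/(Sz _ _ _) IH; lra.
Qed.

Lemma Sz_ge0 A E z : 0 <= Sz A E z.
Proof. exact: pos_INR. Qed.

Lemma Sz_mono A E w z : (w <= z)%N -> Sz A E z <= Sz A E w.
Proof.
move=> wz; rewrite (buchstab _ _ wz).
have : 0 <= psum (fun p => Sz [seq i <- A | E p i] E p) z - psum (fun p => Sz [seq i <- A | E p i] E p) w.
  by apply: psum_nonneg => // p _ _; apply: Sz_ge0.
lra.
Qed.

Lemma Vprod_le_exp s : all prime s -> Vprod s <= exp (- sigma s).
Proof.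
elim: s => [|p s IH] /=; first by rewrite Ropp_0 exp_0; lra.
move=> /andP[/prime_INR p2 hs]; have [V0 _] := Vprod_bound hs.
rewrite Ropp_plus_distr exp_plus Rmult_comm.
have : 0 < / INR p by apply: Rinv_0_lt_compat; lra.
have : / INR p <= / 2 by apply: Rinv_le_contravar; lra.
move=> h1 h2; apply: Rmult_le_compat; try lra; last exact: IH.
have := exp_ineq1_le (- / INR p); lra.
Qed.

Lemma pow_exp_ln x n : 0 < x -> x ^ n = exp (INR n * ln x).
Proof. by move=> x0; rewrite -Rpower_pow. Qed.

Lemma cube_exp_ln x : 0 < x -> x ^ 3 = exp (3 * ln x).
Proof. by move=> x0; rewrite pow_exp_ln // (_ : INR 3 = 3) //=; ring. Qed.

Section Linear.
Variable tau : nat -> R.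
Hypothesis tau_pos : forall n, 0 < tau n.
Hypothesis tau_S : forall n, tau n.+1 = if prime n then tau n / (1 - / INR n) else tau n.
Variables (C1 kap om K k16 : R).
Variables (F f nF nf : R -> R).
Hypothesis C1_ge1 : 1 <= C1.
Hypothesis tau_ln : forall n, (2 <= n)%N -> Rabs (tau n - ln (INR n)) <= C1.
Hypothesis kap_pos : 0 < kap.
Hypothesis tau_V : forall n, Vprod (plist n) = kap / tau n.
Hypothesis Xi_le : forall n, 1 <= tau n -> Rabs (Xi tau n) <= C1 * q4 (tau n).
Hypothesis om_pos : 0 < om.
Hypothesis K_ge0 : 0 <= K.
Hypothesis k16_pos : 0 < k16.
Hypothesis F_der : forall x, 1 / 2 <= x -> is_derive F x (- nF x).
Hypothesis f_der : forall x, 3 / 2 <= x -> is_derive f x (nf x).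
Hypothesis nF_le : forall x, 1 / 2 <= x -> Rabs (nF x) <= K * exp (- 3 * x).
Hypothesis nf_le : forall x, 3 / 2 <= x -> Rabs (nf x) <= K * exp (- 3 * x).
Hypothesis nF_lip : forall x y, 1 / 2 <= x -> x <= y ->
  Rabs (nF x - nF y) <= K * exp (- 3 * x) * (y - x).
Hypothesis nf_lip : forall x y, 3 / 2 <= x -> x <= y ->
  Rabs (nf x - nf y) <= K * exp (- 3 * x) * (y - x).
Hypothesis nF_ge0 : forall x, 0 < x -> 0 <= nF x.
Hypothesis nf_ge0 : forall x, 3 / 2 <= x -> 0 <= nf x.
Hypothesis nF_ge : forall x, 14 <= x <= 18 -> k16 <= nF x.
Hypothesis nf_ge : forall x, 14 <= x <= 18 -> k16 <= nf x.
Hypothesis FE : forall s, 3 <= s -> F s - s * nF s = f (s - 1).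
Hypothesis fE : forall s, 2 <= s -> f s + s * nf s = F (s - 1).
Hypothesis F_small : forall x, 0 < x <= 3 -> F x = 2 / x /\ nF x = 2 / x ^ 2.
Hypothesis F_ge0 : forall x, 0 < x -> 0 <= F x.
Hypothesis f_neg : forall x, 3 / 2 <= x <= 2 -> f x <= 0.
Hypothesis F_lim : forall x, 3 / 2 <= x -> Rabs (F x - om) <= K * exp (- 3 * x).
Hypothesis f_lim : forall x, 3 / 2 <= x -> Rabs (f x - om) <= K * exp (- 3 * x).

(** The sieve functions tend to [om] instead of 1; with this factor the main terms approach the
    sifting density [kap / tau z]. *)
Definition al := kap / om.
Definition Bc := 6 * exp 10.
Definition pf z : pred nat := fun p => (p < z)%N.

Lemma al_pos : 0 < al. Proof. exact: Rdiv_lt_0_compat. Qed.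

Lemma Bc_ge : 18 <= Bc.
Proof. by rewrite /Bc; have := exp_ineq1_le 10; lra. Qed.

Lemma brun_claim (X : R) A E z : 0 < X -> let L := ln X in let s := L / tau z in
  (2 <= z)%N -> regular (pf z) X A E ->
  Bc * ln L <= s -> 20 * C1 + 20 <= tau z -> - ln kap <= ln L -> 1 <= ln L -> 40 * ln L <= L ->
  Rabs (Sz A E z - X * (kap / tau z)) <= X * (2 * (exp (- s) / L ^ 3)).
Proof.
move=> X0 L s z2 reg hs ht hk l1 l2; have t0 := tau_pos z.
have B12 := Bc_ge.
have s12 : 12 <= s by nra.
have L0 : 0 < L by lra.
have st : s * tau z = L by rewrite /s; field; lra.
have tL : tau z <= L by nra.
(* With [r] near [s / 2] the number of terms is at most [(2 * z) ^ (s / 2)], little more than the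
   square root of [X]. The constant in [Bc] yields [sigma * exp 10 <= s / 3 <= r], so the truncation
   error is at most [exp (- 9 * r)], well below [exp (- s) / L ^ 3]. *)
have [r [hr1 hr2]] := nfloor_ex (s / 2 - 1) ltac:(lra).
have ap := plist_all z.
have sg : sigma (plist z) <= 2 * ln L.
  have := Vprod_le_exp ap; rewrite tau_V => h.
  have h2 : ln (kap / tau z) <= - sigma (plist z).
    by rewrite -(ln_exp (- _)); apply: ln_le_mono => //; apply: Rdiv_lt_0_compat.
  rewrite ln_div // in h2; have := ln_le_mono t0 tL; lra.
have [_ sg0] := Vprod_bound ap.
have e10 := exp_pos 10; have e10' := exp_ineq1_le 10.
have sr : sigma (plist z) * exp 10 <= INR r.
  apply: Rle_trans (_ : 2 * ln L * exp 10 <= _); first by apply: Rmult_le_compat_r; lra.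
  apply: Rle_trans (_ : s / 3 <= _); last lra.
  rewrite /Bc in hs; lra.
have hreg : all (fun p => prime p && pf z p) (plist z).
  by apply/allP => p; rewrite plistP.
have sr1 : sigma (plist z) <= INR r.+1 by rewrite S_INR; nra.
have := brun reg (plist_uniq z) hreg (Rlt_le _ _ X0) sr1.
rewrite tau_V -/(Sz A E z) => H; apply: Rle_trans H _.
have P1 : sigma (plist z) ^ r / INR (fact r) <= exp (- s) / L ^ 3.
  apply: Rle_trans (pow_fact_exp_neg sg0 sr) _.
  rewrite cube_exp_ln //.
  rewrite /Rdiv -exp_Ropp -exp_plus; apply: exp_le_mono; nra.
have P2 : (INR (size (plist z)) + 1) ^ r.+1 <= X * (exp (- s) / L ^ 3).
  have z2R : 2 <= INR z by rewrite (_ : 2 = INR 2) //; apply: le_INR; lia.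
  apply: Rle_trans (_ : (2 * INR z) ^ r.+1 <= _).
    apply: pow_incr; have := pos_INR (size (plist z)).
    have : INR (size (plist z)) <= INR z by apply: le_INR; have := plist_size z; lia.
    lra.
  rewrite -{1}(exp_ln X) // cube_exp_ln //.
  rewrite /Rdiv -exp_Ropp -!exp_plus pow_exp_ln; last lra.
  rewrite ln_mult; try lra.
  apply: exp_le_mono; rewrite -/L.
  have l2' := @ln_le_sub1 2 ltac:(lra).
  have tz := tau_ln z2.
  have lz : ln 2 + ln (INR z) <= 21 / 20 * tau z by move: tz; split_Rabs; lra.
  have lz0 : 0 <= ln 2 + ln (INR z).
    have := @ln_le_mono 1 2 ltac:(lra) ltac:(lra); have := @ln_le_mono 1 (INR z) ltac:(lra) ltac:(lra).
    by rewrite ln_1; lra.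
  have r1 : INR r.+1 <= s / 2 by rewrite S_INR; lra.
  have : INR r.+1 * (ln 2 + ln (INR z)) <= s / 2 * (21 / 20 * tau z).
    by apply: Rmult_le_compat => //; apply: pos_INR.
  have -> : s / 2 * (21 / 20 * tau z) = 21 / 40 * L by rewrite -st; field.
  have : 20 * s <= L by rewrite -st; have := Rmult_le_compat_l s 20 (tau z) ltac:(lra) ltac:(lra); lra.
  lra.
have : X * (sigma (plist z) ^ r / INR (fact r)) <= X * (exp (- s) / L ^ 3).
  by apply: Rmult_le_compat_l => //; lra.
by move=> P3; apply: Rle_trans (Rplus_le_compat _ _ _ _ P3 P2) _; right; ring.
Qed.

(* The computation common to the lower and the upper bound: [N] is the function sent through
   Buchstab's identity, [T] the result and [sg] its direction of monotonicity. *)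
Lemma channel (N dN nN T nT h k : R -> R) (sg smin xm L : R) (w z : nat) :
  (forall x, xm <= x -> is_derive N x (dN x)) ->
  (forall x, dN x = sg * nN x) -> sg = 1 \/ sg = -1 ->
  (forall x, xm <= x -> Rabs (nN x) <= K * exp (- 3 * x)) ->
  (forall x y, xm <= x -> x <= y -> Rabs (nN x - nN y) <= K * exp (- 3 * x) * (y - x)) ->
  (forall x, xm <= x -> 0 <= nN x) ->
  (forall x, 14 <= x <= 18 -> k16 <= nN x) ->
  (forall s, smin <= s -> is_derive h s (N (s - 1))) ->
  (forall s, smin <= s -> is_derive k s (s * dN (s - 1))) ->
  (forall s, smin <= s -> h s = s * T s) ->
  (forall s, smin <= s -> k s = - sg * (s ^ 2 * nT s)) ->
  (forall s, smin <= s -> 0 <= nT s) ->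
  2 <= smin -> xm + 3 / 2 <= smin -> (2 <= w)%N -> (w <= z)%N ->
  200 * C1 <= L -> smin <= L / tau z -> 18 <= L / tau w -> 20 * C1 <= tau w ->
  L ^ 2 <= INR w ->
  20 * (K * exp (9 / 2) * (4 * C1 + 6)) <= q4 L ^ 2 ->
  10 * (67 + K * exp (9 / 2) * (4 * C1 + 6)) <= k16 * q4 L ->
  let S N := psum (fun p => / INR p * N (L - ln (INR p)) (tau p)) z
             - psum (fun p => / INR p * N (L - ln (INR p)) (tau p)) w in
  Rabs (S (fun ell t => N (ell / t) / t) - (T (L / tau w) / tau w - T (L / tau z) / tau z))
    <= K * exp (9 / 2) * (4 * C1 ^ 2 + 94) * (C1 * q4 L) / L ^ 3 * exp (- (L / tau z)) /\
  3 / 10 * (exp (- (L / tau z)) / q4 L ^ 10) <= Err nT L (tau z) - S (Err nN).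
Proof.
move=> Nd dNE sgE nNle nNlip nN0 nNge hd kd hE kE nT0 sm2 xms w2 wz LC sz sw tw wL Y1 Y2 S.
have L0 : 1 <= L by lra.
have t0 n := tau_pos n.
have Rsg : Rabs sg = 1 by case: sgE => ->; split_Rabs; lra.
have szw n : (w <= n <= z)%N -> smin <= L / tau n.
  by move=> hn; apply: Rle_trans sz _; apply: (s_le tau_pos tau_S); [lra|lia].
have dNle x : xm <= x -> Rabs (dN x) <= K * exp (- 3 * x).
  by move=> hx; rewrite dNE Rabs_mult Rsg Rmult_1_l; apply: nNle.
have dNlip x y : xm <= x -> x <= y -> Rabs (dN x - dN y) <= K * exp (- 3 * x) * (y - x).
  move=> hx xy; rewrite !dNE -Rmult_minus_distr_l Rabs_mult Rsg Rmult_1_l; exact: nNlip.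
have tln p : (w <= p <= z)%N -> Rabs (tau p - ln (INR p)) <= C1.
  by move=> hp; apply: tau_ln; lia.
have wL2 : 2 * L <= INR w by nra.
have tnL n : (w <= n <= z)%N -> 1 <= tau n <= L.
  move=> hn; split; first by apply: Rle_trans (tau_le tau_pos tau_S (_ : (w <= n)%N)); [lra|lia].
  have : 1 * tau n <= L / tau n * tau n.
    by apply: Rmult_le_compat_r; [apply/Rlt_le|have := szw n hn; lra].
  by rewrite /Rdiv Rmult_assoc Rinv_l; [lra|have := t0 n; lra].
have y1 : 1 <= q4 L.
  have := @q4_scal_ge 1 L 1 ltac:(lra) ltac:(lra) ltac:(lra).
  by rewrite /q4 !sqrt_1; lra.
have szE n : (w <= n <= z)%N -> h (L / tau n) / L = T (L / tau n) / tau n.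
  by move=> hn; rewrite hE; [field; split; [have := t0 n|]; lra|apply: szw].
have kzE n : (w <= n <= z)%N -> k (L / tau n) / L ^ 2 = - sg * (nT (L / tau n) / tau n ^ 2).
  by move=> hn; rewrite kE; [field; split; [have := t0 n|]; lra|apply: szw].
split.
  have M := @main_sum tau tau_pos tau_S C1 K L w z N dN h smin xm K_ge0 L0 wz sm2 xms sz ltac:(lra) ltac:(lra) wL wL2 tln Nd dNle dNlip hd (C1 * q4 L).
  rewrite /S; apply: Rle_trans (M _ _).
  - right; congr Rabs; rewrite /Rdiv Rmult_minus_distr_r -!/(Rdiv _ _).
    by rewrite !szE; [lra|lia|lia].
  - nra.
  - move=> n hn; have tn := tnL n hn; apply: Rle_trans (Xi_le tn.1) _.
    by apply: Rmult_le_compat_l; [lra|apply: q4_le; lra].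
have KK := @k_sum tau tau_pos tau_S C1 K L w z dN k smin xm ltac:(lra) K_ge0 L0 wz sm2 xms sz ltac:(lra) ltac:(lra) wL wL2 tln dNle dNlip kd.
set Ck := K * exp (9 / 2) * (4 * C1 + 6) in Y1 Y2 *.
have Ck0 : 0 <= Ck.
  by apply: Rmult_le_pos; [apply: Rmult_le_pos => //; apply/Rlt_le/exp_pos|lra].
apply: (@err_step tau tau_pos tau_S C1 L Ck k16 w z nN nT xm) => //; try lra.
rewrite /Rdiv Rmult_minus_distr_r -!/(Rdiv _ _) !kzE in KK; [|lia|lia].
have E n : psum (fun p => / INR p * (dN ((L - ln (INR p)) / tau p) / tau p ^ 2)) n
  = sg * psum (fun p => / INR p * (nN ((L - ln (INR p)) / tau p) / tau p ^ 2)) n.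
  by rewrite -psum_scal; apply: psum_ext => p _ _; rewrite dNE /Rdiv; ring.
rewrite !E in KK.
have nw : 0 <= nT (L / tau w) / tau w ^ 2.
  apply: Rmult_le_pos; first by apply/nT0/szw; lia.
  by apply/Rlt_le/Rinv_0_lt_compat/pow_lt.
have -> : Ck / L ^ 3 * exp (- (L / tau z)) = K * exp (9 / 2) * (4 * C1 + 6) / L ^ 3 * exp (- (L / tau z)) by [].
move: KK; set e := _ / L ^ 3 * _ => KK.
by case: sgE KK => ->; split_Rabs; lra.
Qed.

Definition T0 := 20 * C1 + 20.
Definition Ck := K * exp (9 / 2) * (4 * C1 + 6).
Definition D5 := al * (K * exp (9 / 2) * (4 * C1 ^ 2 + 94) * C1) + al * K + 2.
(** Each group of summands secures one of the lower bounds for [q4 L] listed in [Y0_facts]. *)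
Definition Y0 := 200 * C1 + 400 + / kap + 20 * Ck + 10 * (67 + Ck) / k16
  + 8 * Bc * (tau 2 + 20 * C1 + 28) + 10 * D5 + 40 * (al * (om + K)) * exp 4.

Lemma Ck_ge0 : 0 <= Ck.
Proof. by rewrite /Ck; apply: Rmult_le_pos; [apply: Rmult_le_pos => //; apply/Rlt_le/exp_pos|lra]. Qed.

Lemma D5_ge2 : 2 <= D5.
Proof.
have a0 := al_pos; have e := exp_pos (9 / 2).
have : 0 <= al * K by apply: Rmult_le_pos; lra.
have : 0 <= al * (K * exp (9 / 2) * (4 * C1 ^ 2 + 94) * C1).
  apply: Rmult_le_pos; first lra.
  apply: Rmult_le_pos; last lra.
  apply: Rmult_le_pos; last nra.
  by apply: Rmult_le_pos; lra.
rewrite /D5; lra.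
Qed.

Lemma Y0_facts L : Y0 <= q4 L -> 0 < L ->
  [/\ 400 <= q4 L, 200 * C1 <= q4 L, / kap <= q4 L & 20 * Ck <= q4 L] /\
  [/\ 10 * (67 + Ck) <= k16 * q4 L, 8 * Bc * (tau 2 + 20 * C1 + 28) <= q4 L,
      10 * D5 <= q4 L & 40 * (al * (om + K)) * exp 4 <= q4 L].
Proof.
have ck := Ck_ge0; have a0 := al_pos; have d5 := D5_ge2.
have h1 : 0 < / kap by apply: Rinv_0_lt_compat.
have h2 : 0 <= 10 * (67 + Ck) / k16.
  by apply: Rmult_le_pos; [lra|apply/Rlt_le/Rinv_0_lt_compat].
have h3 : 0 <= 8 * Bc * (tau 2 + 20 * C1 + 28).
  by have := Bc_ge; have := tau_pos 2; nra.
have h4 : 0 <= 40 * (al * (om + K)) * exp 4.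
  apply: Rmult_le_pos; last exact/Rlt_le/exp_pos.
  by apply: Rmult_le_pos; [lra|apply: Rmult_le_pos; lra].
rewrite /Y0 => H L0; split; split; try lra.
apply: (Rmult_le_reg_r (/ k16)); first exact: Rinv_0_lt_compat.
have -> : k16 * q4 L * / k16 = q4 L by field; lra.
rewrite /Rdiv in H h2; lra.
Qed.

Lemma Y0_ln L : Y0 <= q4 L -> 0 < L ->
  [/\ 200 * C1 <= L, - ln kap <= ln L, 1 <= ln L & 40 * ln L <= L] /\
  ln L <= 4 * q4 L.
Proof.
move=> HY L0; have [ [h1 h2 h3 h4] [h5 h6 h7 h8]] := Y0_facts HY L0.
have yL := q4_pow (Rlt_le _ _ L0); set y := q4 L in yL *.
have yy : y * 400 * 400 * 400 <= L.
  rewrite -yL (_ : y ^ 4 = y * y * y * y); last ring.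
  by repeat (apply: Rmult_le_compat; try lra); rewrite -/y in h1 *; nra.
have ly : ln L = 4 * ln y.
  have : 0 < y by rewrite -/y in h1; lra.
  move=> y0; rewrite -yL pow_exp_ln // ln_exp (_ : INR 4 = 4) //=; ring.
rewrite -/y in h1 h2 h3.
have l4 : ln y <= y - 1 by apply: ln_le_sub1; lra.
have l3 : 1 <= ln L.
  rewrite -(ln_exp 1); apply: ln_le_mono; first exact: exp_pos.
  by have := exp_le_3; lra.
split; last lra.
split; try lra.
rewrite -ln_Rinv //; apply: ln_le_mono; first exact: Rinv_0_lt_compat.
lra.
Qed.

(** The recursion starts at [tau w] of order [L / (Bc * ln L)], where Brun's sieve is still
    accurate. Such a [w] already exceeds [L ^ 2], so that replacing [s] by [s * (1 - / p)] at the
    later primes costs nothing. *)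
Lemma w_exists L z : Y0 <= q4 L -> 0 < L -> (2 <= z)%N -> L / tau z < Bc * ln L ->
  exists w, [/\ (2 <= w)%N, (w < z)%N, Bc * ln L <= L / tau w, T0 <= tau w & L ^ 2 <= INR w].
Proof.
move=> HY L0 z2 hs; have [ [h1 h2 h3 h4] [h5 h6 h7 h8]] := Y0_facts HY L0.
have [ [l1 l2 l3 l4] l5] := Y0_ln HY L0; have B18 := Bc_ge.
have t2 := tau_pos 2.
have BL : 0 < Bc * ln L by apply: Rmult_lt_0_compat; lra.
set T := L / (Bc * ln L).
have TB : T * (Bc * ln L) = L by rewrite /T; field; split; nra.
have yL := q4_pow (Rlt_le _ _ L0); set y := q4 L in yL h1 h2 h3 h4 h5 h6 h7 h8 l5 *.
have Tbig : 2 * y * (tau 2 + 20 * C1 + 28) <= T.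
  apply: (Rmult_le_reg_r (Bc * ln L)) => //; rewrite TB -[X in _ <= X]yL.
  apply: Rle_trans (_ : 2 * y * (tau 2 + 20 * C1 + 28) * (Bc * (4 * y)) <= _).
    apply: Rmult_le_compat_l; first by apply: Rmult_le_pos; lra.
    by apply: Rmult_le_compat_l; lra.
  have -> : 2 * y * (tau 2 + 20 * C1 + 28) * (Bc * (4 * y)) = 8 * Bc * (tau 2 + 20 * C1 + 28) * (y ^ 2) by ring.
  rewrite (_ : y ^ 4 = y ^ 2 * y ^ 2); last ring.
  apply: Rmult_le_compat_r; first exact: pow2_ge_0.
  nra.
have yt : tau 2 <= y * tau 2 by rewrite -{1}(Rmult_1_l (tau 2)); apply: Rmult_le_compat_r; lra.
have yC : C1 <= y * C1 by rewrite -{1}(Rmult_1_l C1); apply: Rmult_le_compat_r; lra.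
have c1 : tau 2 <= T by lra.
have c2 : T < tau z.
  apply: (Rmult_lt_reg_r (Bc * ln L)) => //; rewrite TB.
  have tz := tau_pos z.
  have : L / tau z * tau z < Bc * ln L * tau z by apply: Rmult_lt_compat_r.
  by rewrite /Rdiv Rmult_assoc Rinv_l; lra.
have [w [hw w1 w2]] := crossing z2 c1 c2.
have w2' : T <= 2 * tau w.
  move: w2; rewrite tau_S; have tw := tau_pos w; case: ifP => pr; last lra.
  have p2 := prime_INR pr.
  have : / INR w <= / 2 by apply: Rinv_le_contravar; lra.
  move=> iw h; apply: Rle_trans (Rlt_le _ _ h) _.
  by apply/Rle_div_l; [lra|nra].
exists w; split; try lia.
- have tw := tau_pos w; apply: (Rmult_le_reg_r (tau w)) => //.
  have -> : L / tau w * tau w = L by field; lra.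
  have : Bc * ln L * tau w <= Bc * ln L * T by apply: Rmult_le_compat_l; lra.
  lra.
- by rewrite /T0; lra.
have w0 : 0 < INR w by apply: lt_0_INR; lia.
rewrite pow_exp_ln // -(exp_ln (INR w)) //; apply: exp_le_mono.
have tl := @tau_ln w ltac:(lia); rewrite (_ : INR 2 = 2) //.
have : ln (INR w) >= tau w - C1 by move: tl; split_Rabs; lra.
lra.
Qed.

(** Both bounds carry the same constant [M], because each of them feeds the other through Buchstab's
    identity. *)
Definition LoC M X A E z := X * (al * (f (ln X / tau z) / tau z) - M * Err nf (ln X) (tau z)) <= Sz A E z.
Definition UpC M X A E z := Sz A E z <= X * (al * (F (ln X / tau z) / tau z) + M * Err nF (ln X) (tau z)).

Lemma q4_ge1 L : Y0 <= q4 L -> 0 < L -> 1 <= q4 L.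
Proof. by move=> HY L0; have [ [h _ _ _] _] := Y0_facts HY L0; lra. Qed.

Lemma Err_ge n L t : 1 <= q4 L -> 0 <= n (L / t) -> 0 < t -> exp (- (L / t)) / q4 L ^ 10 <= Err n L t.
Proof.
move=> y1 n0 t0; rewrite /Err.
have : / q4 L <= 1 by rewrite -Rinv_1; apply: Rinv_le_contravar; lra.
have : 0 <= n (L / t) / t ^ 2 by apply: Rmult_le_pos => //; apply/Rlt_le/Rinv_0_lt_compat/pow_lt.
nra.
Qed.

(** The errors of [main_sum] and of Brun's sieve at [w] are smaller than [q4 L ^ (- 10)] by a power
    of [q4 L]; together they use at most a third of the surplus left by [err_step]. *)
Lemma slack_bound L z : Y0 <= q4 L -> 0 < L ->
  al * (K * exp (9 / 2) * (4 * C1 ^ 2 + 94) * (C1 * q4 L) / L ^ 3 * exp (- (L / tau z)))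
  + (al * K + 2) / L ^ 3 * exp (- (L / tau z)) <= / 10 * (exp (- (L / tau z)) / q4 L ^ 10).
Proof.
move=> HY L0; have [_ [_ _ h7 _]] := Y0_facts HY L0; have y1 := q4_ge1 HY L0.
have yL := q4_pow (Rlt_le _ _ L0); set y := q4 L in yL h7 y1 *.
have a0 := al_pos.
have e0 := exp_pos (- (L / tau z)); set ez := exp _ in e0 *.
have -> : L ^ 3 = y ^ 12 by rewrite -yL; ring.
set c := K * exp (9 / 2) * (4 * C1 ^ 2 + 94).
have -> : al * (c * (C1 * y) / y ^ 12 * ez) + (al * K + 2) / y ^ 12 * ez
   = (al * (c * C1) * y + (al * K + 2)) / y ^ 2 * (ez / y ^ 10) by field; lra.
apply: Rmult_le_compat_r.
  by apply/Rlt_le/Rdiv_lt_0_compat => //; apply: pow_lt; lra.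
have y2 : 0 < y ^ 2 by apply: pow_lt; lra.
apply: (Rmult_le_reg_r (y ^ 2)) => //; rewrite /Rdiv Rmult_assoc Rinv_l; last lra.
rewrite Rmult_1_r; have : 0 <= al * K by apply: Rmult_le_pos; lra.
by rewrite /D5 -/c in h7; nra.
Qed.

(** The node argument is only approximately [s - 1], so for [s] near 3 it can fall slightly below
    the sifting limit 2. This is why the lower sieve function is carried down to [3 / 2]. *)
Lemma node_bound L p z : 2 <= L / tau z -> 0 < L -> (p < z)%N -> (2 <= p)%N -> T0 <= tau p ->
  L / 2 - C1 <= L - ln (INR p) /\ (3 <= L / tau z -> 3 / 2 <= (L - ln (INR p)) / tau p).
Proof.
move=> sz L0 pz p2 tp; have tl := tau_ln p2; have t0 := tau_pos p; have C := C1_ge1.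
have tpz : tau p <= tau z by apply: tau_le => //; lia.
have mulz c : c <= L / tau z -> c * tau z <= L.
  have tz := tau_pos z => h; have : c * tau z <= L / tau z * tau z by apply: Rmult_le_compat_r; lra.
  by rewrite /Rdiv Rmult_assoc Rinv_l; lra.
rewrite /T0 in tp; split; first by have := mulz _ sz; move: tl; split_Rabs; lra.
move=> /mulz h3; apply: (Rmult_le_reg_r (tau p)) => //.
have -> : (L - ln (INR p)) / tau p * tau p = L - ln (INR p) by field; lra.
by move: tl; split_Rabs; lra.
Qed.

Lemma brun_gap (g : R -> R) L w : Bc * ln L <= L / tau w -> 1 <= ln L -> 0 < L -> 1 <= tau w ->
  (Rabs (g (L / tau w) - om) <= K * exp (- 3 * (L / tau w))) ->
  Rabs (kap / tau w - al * (g (L / tau w) / tau w)) + 2 * (exp (- (L / tau w)) / L ^ 3)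
   <= (al * K + 2) / L ^ 3 * exp (- (L / tau w)).
Proof.
move=> hs l1 L0 tw hg; have a0 := al_pos; have B := Bc_ge.
set s := L / tau w in hs hg *.
have e3 : exp (- 3 * s) <= exp (- s) / L ^ 3.
  by rewrite cube_exp_ln // /Rdiv -exp_Ropp -exp_plus; apply: exp_le_mono; nra.
have -> : kap / tau w - al * (g s / tau w) = - (al / tau w) * (g s - om).
  by rewrite /al; field; lra.
rewrite Rabs_mult Rabs_Ropp (Rabs_right (al / tau w)); last first.
  by apply/Rle_ge/Rlt_le/Rdiv_lt_0_compat; lra.
have : al / tau w * Rabs (g s - om) <= al * (K * (exp (- s) / L ^ 3)).
  apply: Rmult_le_compat; first by apply/Rlt_le/Rdiv_lt_0_compat; lra.
  - exact: Rabs_pos.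
  - rewrite -[X in _ <= X]Rmult_1_r; apply: Rmult_le_compat_l; first lra.
    by rewrite -Rinv_1; apply: Rinv_le_contravar; lra.
  - by apply: Rle_trans hg _; apply: Rmult_le_compat_l.
have -> : (al * K + 2) / L ^ 3 * exp (- s) = al * (K * (exp (- s) / L ^ 3)) + 2 * (exp (- s) / L ^ 3) by field; lra.
lra.
Qed.

Section Step.
Variables (M X : R) (A : seq nat) (E : nat -> nat -> bool) (z : nat).
Let L := ln X.
Hypothesis M1 : 1 <= M.
Hypothesis X0 : 0 < X.
Hypothesis L0 : 0 < L.
Hypothesis HY : Y0 <= q4 L.
Hypothesis z2 : (2 <= z)%N.
Hypothesis tz : T0 <= tau z.
Hypothesis reg : regular (pf z) X A E.

Lemma reg_node p : prime p -> (p < z)%N -> regular (pf p) (X / INR p) [seq i <- A | E p i] E.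
Proof.
move=> pr pz; apply: regular_sub (regular_filter pr (pz : pf z p) reg) => q _ qp.
by rewrite /pf in qp *; rewrite neq_ltn qp /= andbT; lia.
Qed.

Lemma reg_sub w : (w <= z)%N -> regular (pf w) X A E.
Proof. by move=> wz; apply: regular_sub reg => q _; rewrite /pf; lia. Qed.

Lemma ln_node p : prime p -> 0 < X / INR p /\ ln (X / INR p) = L - ln (INR p).
Proof.
move=> /prime_INR p2; split; first by apply: Rdiv_lt_0_compat; lra.
by rewrite ln_div //; lra.
Qed.

Lemma brun_w (g : R -> R) w : (2 <= w)%N -> (w <= z)%N -> Bc * ln L <= L / tau w -> T0 <= tau w ->
  (Rabs (g (L / tau w) - om) <= K * exp (- 3 * (L / tau w))) ->
  Rabs (Sz A E w - X * (al * (g (L / tau w) / tau w))) <= X * ((al * K + 2) / L ^ 3 * exp (- (L / tau w))).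
Proof.
move=> w2 wz hs tw hg; have [ [l1 l2 l3 l4] l5] := Y0_ln HY L0; have C := C1_ge1.
have B := brun_claim X0 w2 (reg_sub wz) hs tw l2 l3 l4; rewrite -/L in B.
have G := brun_gap hs l3 L0 ltac:(rewrite /T0 in tw; lra) hg.
have : X * (Rabs (kap / tau w - al * (g (L / tau w) / tau w)) + 2 * (exp (- (L / tau w)) / L ^ 3))
   <= X * ((al * K + 2) / L ^ 3 * exp (- (L / tau w))) by apply: Rmult_le_compat_l; lra.
rewrite Rmult_plus_distr_l -{1}(Rabs_right X); last lra.
rewrite -Rabs_mult Rmult_minus_distr_l; move: B; split_Rabs; lra.
Qed.

Lemma step_low : 2 <= L / tau z ->
  (forall p, prime p -> (p < z)%N -> T0 <= tau p ->
     UpC M (X / INR p) [seq i <- A | E p i] E p) ->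
  LoC M X A E z.
Proof.
move=> s2 nodes; have [ [h1 h2 h3 h4] [h5 h6 h7 h8]] := Y0_facts HY L0.
have [ [l1 l2 l3 l4] l5] := Y0_ln HY L0; have y1 := q4_ge1 HY L0.
have SB := slack_bound z HY L0; have a0 := al_pos; have C := C1_ge1.
have e0 := exp_pos (- (L / tau z)).
have P0 : 0 < exp (- (L / tau z)) / q4 L ^ 10 by apply: Rdiv_lt_0_compat => //; apply: pow_lt; lra.
have MP := Rmult_le_compat_r _ _ _ (Rlt_le _ _ P0) M1; rewrite Rmult_1_l in MP.
have yy := Rle_pow (q4 L) 1 2 y1 ltac:(lia); rewrite pow_1 in yy.
have c0 : 0 <= al * (K * exp (9 / 2) * (4 * C1 ^ 2 + 94) * (C1 * q4 L) / L ^ 3 * exp (- (L / tau z))).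
  apply: Rmult_le_pos; first lra.
  apply: Rmult_le_pos; last lra.
  apply: Rmult_le_pos; last exact/Rlt_le/Rinv_0_lt_compat/pow_lt.
  apply: Rmult_le_pos; last nra.
  by apply: Rmult_le_pos; [apply: Rmult_le_pos => //; apply/Rlt_le/exp_pos|nra].
have nf0 : 0 <= nf (L / tau z) by apply: nf_ge0; lra.
have tz0 := tau_pos z.
have EG := Err_ge y1 nf0 tz0; have ME := Rmult_le_compat_l M _ _ ltac:(lra) EG.
have [hB|hB] := Rle_lt_dec (Bc * ln L) (L / tau z).
  have := @brun_w f z z2 (leqnn z) hB tz (@f_lim (L / tau z) ltac:(lra)).
  rewrite /LoC -/L Rmult_minus_distr_l => B.
  have : X * ((al * K + 2) / L ^ 3 * exp (- (L / tau z))) <= X * (M * Err nf L (tau z)).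
    by apply: Rmult_le_compat_l; lra.
  by move: B; split_Rabs; lra.
have [w [w2 wz ws tw wL]] := w_exists HY L0 z2 hB.
have B := Bc_ge.
have sw18 : 18 <= L / tau w by have := Rmult_le_compat 18 Bc 1 (ln L) ltac:(lra) ltac:(lra) B l3; lra.
(* [s * f s] has derivative [F (s - 1)], and [s * F (s - 1) - s * f s = s ^ 2 * nf s]; these are the
   two antiderivatives that telescope. *)
have [|||||||||||||||||||||||CH1 CH2] := @channel F (fun x => - nF x) nF f nf
   (fun s => s * f s) (fun s => s * F (s - 1) - s * f s) (-1) 2 (1 / 2) L w z.
- exact: F_der.
- by move=> x; ring.
- by right.
- exact: nF_le.
- exact: nF_lip.
- by move=> x hx; apply: nF_ge0; lra.
- exact: nF_ge.
- move=> s hs; have fd := @f_der s ltac:(lra).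
  evar_last; first by apply: is_derive_mult; [apply: is_derive_id|exact: fd|move=> *; apply: Rmult_comm].
  by rewrite /plus /mult /= /mult /= -fE //; rewrite /one /=; ring.
- move=> s hs; have fd := @f_der s ltac:(lra); have Fd := @F_der (s - 1) ltac:(lra).
  have Fd2 : is_derive (fun x => F (x - 1)) s (- nF (s - 1)).
    evar_last; first by apply: is_derive_comp; [exact: Fd|auto_derive].
    by rewrite /scal /= /mult /=; ring.
  evar_last.
    apply: is_derive_minus; apply: is_derive_mult.
    + exact: is_derive_id.
    + exact: Fd2.
    + by move=> *; apply: Rmult_comm.
    + exact: is_derive_id.
    + exact: fd.
    + by move=> *; apply: Rmult_comm.
  by rewrite /minus /plus /opp /mult /= /mult /one /= -(fE hs); ring.
- by [].
- by move=> s hs; rewrite -(fE hs); ring.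
- by move=> s hs; apply: nf_ge0; lra.
- lra.
- lra.
- by [].
- exact: ltnW.
- by [].
- by [].
- by [].
- by rewrite /T0 in tw; lra.
- by [].
- by rewrite -/Ck; lra.
- by rewrite -/Ck.
pose fa p := / INR p * (F ((L - ln (INR p)) / tau p) / tau p).
pose fb p := / INR p * Err nF (L - ln (INR p)) (tau p).
set SN := psum fa z - psum fa w in CH1.
set SE := psum fb z - psum fb w in CH2.
have BW := @brun_w f w w2 (ltnW wz) ws tw (@f_lim (L / tau w) ltac:(lra)).
have ewz : (al * K + 2) / L ^ 3 * exp (- (L / tau w)) <= (al * K + 2) / L ^ 3 * exp (- (L / tau z)).
  apply: Rmult_le_compat_l.
    apply: Rmult_le_pos; last exact/Rlt_le/Rinv_0_lt_compat/pow_lt.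
    have alK : 0 <= al * K by apply: Rmult_le_pos; lra.
    lra.
  by apply: exp_le_mono; have := s_le tau_pos tau_S L0 (ltnW wz); lra.
have NS : psum (fun p => Sz [seq i <- A | E p i] E p) z - psum (fun p => Sz [seq i <- A | E p i] E p) w
   <= X * (al * SN + M * SE).
  have -> : X * (al * SN + M * SE) = X * al * SN + X * M * SE by ring.
  have G n : psum (fun p => X * al * fa p + X * M * fb p) n = X * al * psum fa n + X * M * psum fb n.
    by rewrite psum_plus !psum_scal.
  rewrite (_ : X * al * SN + X * M * SE = psum (fun p => X * al * fa p + X * M * fb p) z - psum (fun p => X * al * fa p + X * M * fb p) w); last by rewrite !G /SN /SE; ring.
  apply: psum_le; first exact: ltnW.
  move=> p hp pr; have [Xp lp] := ln_node pr.
  have tp : T0 <= tau p by apply: Rle_trans tw _; apply: tau_le => //; lia.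
  have := nodes p pr ltac:(lia) tp; rewrite /UpC lp => H; apply: Rle_trans H _.
  by right; rewrite /fa /fb /Rdiv; ring.
rewrite /LoC -/L (buchstab _ _ (ltnW wz)).
have a1 : al * SN <= al * (f (L / tau w) / tau w) - al * (f (L / tau z) / tau z) +
   al * (K * exp (9 / 2) * (4 * C1 ^ 2 + 94) * (C1 * q4 L) / L ^ 3 * exp (- (L / tau z))).
  rewrite -Rmult_minus_distr_l -Rmult_plus_distr_l; apply: Rmult_le_compat_l; first lra.
  by move: CH1; split_Rabs; lra.
have a2 : M * SE <= M * Err nf L (tau z) - M * (3 / 10 * (exp (- (L / tau z)) / q4 L ^ 10)).
  by rewrite -Rmult_minus_distr_l; apply: Rmult_le_compat_l; lra.
have a3 : X * (al * (f (L / tau z) / tau z) - M * Err nf L (tau z)) <=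
   X * (al * (f (L / tau w) / tau w) - (al * K + 2) / L ^ 3 * exp (- (L / tau w)) - (al * SN + M * SE)).
  by apply: Rmult_le_compat_l; lra.
have a4 : X * (al * (f (L / tau w) / tau w)) - X * ((al * K + 2) / L ^ 3 * exp (- (L / tau w))) <= Sz A E w.
  by move: BW; split_Rabs; lra.
lra.
Qed.

(** Mirror image of [step_low], except that a tenth of [exp (- s) / q4 L ^ 10] is left over;
    [step_up_small] spends it on the overshoot past 3. *)
Lemma step_up : 3 <= L / tau z ->
  (forall p, prime p -> (p < z)%N -> T0 <= tau p ->
     LoC M (X / INR p) [seq i <- A | E p i] E p) ->
  Sz A E z <= X * (al * (F (L / tau z) / tau z) + M * Err nF L (tau z)
     - / 10 * (exp (- (L / tau z)) / q4 L ^ 10)).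
Proof.
move=> s2 nodes; have [ [h1 h2 h3 h4] [h5 h6 h7 h8]] := Y0_facts HY L0.
have [ [l1 l2 l3 l4] l5] := Y0_ln HY L0; have y1 := q4_ge1 HY L0.
have SB := slack_bound z HY L0; have a0 := al_pos; have C := C1_ge1.
have e0 := exp_pos (- (L / tau z)).
have P0 : 0 < exp (- (L / tau z)) / q4 L ^ 10 by apply: Rdiv_lt_0_compat => //; apply: pow_lt; lra.
have MP := Rmult_le_compat_r _ _ _ (Rlt_le _ _ P0) M1; rewrite Rmult_1_l in MP.
have yy := Rle_pow (q4 L) 1 2 y1 ltac:(lia); rewrite pow_1 in yy.
have c0 : 0 <= al * (K * exp (9 / 2) * (4 * C1 ^ 2 + 94) * (C1 * q4 L) / L ^ 3 * exp (- (L / tau z))).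
  apply: Rmult_le_pos; first lra.
  apply: Rmult_le_pos; last lra.
  apply: Rmult_le_pos; last exact/Rlt_le/Rinv_0_lt_compat/pow_lt.
  apply: Rmult_le_pos; last nra.
  by apply: Rmult_le_pos; [apply: Rmult_le_pos => //; apply/Rlt_le/exp_pos|nra].
have nF0 : 0 <= nF (L / tau z) by apply: nF_ge0; lra.
have tz0 := tau_pos z.
have EG := Err_ge y1 nF0 tz0; have ME := Rmult_le_compat_l M _ _ ltac:(lra) EG.
have [hB|hB] := Rle_lt_dec (Bc * ln L) (L / tau z).
  have B := @brun_w F z z2 (leqnn z) hB tz (@F_lim (L / tau z) ltac:(lra)).
  have : X * ((al * K + 2) / L ^ 3 * exp (- (L / tau z))) <=
     X * (M * Err nF L (tau z) - / 10 * (exp (- (L / tau z)) / q4 L ^ 10)).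
    by apply: Rmult_le_compat_l; lra.
  by move: B; split_Rabs; lra.
have [w [w2 wz ws tw wL]] := w_exists HY L0 z2 hB.
have B := Bc_ge.
have sw18 : 18 <= L / tau w by have := Rmult_le_compat 18 Bc 1 (ln L) ltac:(lra) ltac:(lra) B l3; lra.
have [|||||||||||||||||||||||CH1 CH2] := @channel f nf nf F nF
   (fun s => s * F s) (fun s => s * f (s - 1) - s * F s) 1 3 (3 / 2) L w z.
- exact: f_der.
- by move=> x; ring.
- by left.
- exact: nf_le.
- exact: nf_lip.
- exact: nf_ge0.
- exact: nf_ge.
- move=> s hs; have fd := @F_der s ltac:(lra).
  evar_last; first by apply: is_derive_mult; [apply: is_derive_id|exact: fd|move=> *; apply: Rmult_comm].
  by rewrite /plus /mult /= /mult /= -FE //; rewrite /one /=; ring.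
- move=> s hs; have Fd := @F_der s ltac:(lra); have fd := @f_der (s - 1) ltac:(lra).
  have fd2 : is_derive (fun x => f (x - 1)) s (nf (s - 1)).
    evar_last; first by apply: is_derive_comp; [exact: fd|auto_derive].
    by rewrite /scal /= /mult /=; ring.
  evar_last.
    apply: is_derive_minus; apply: is_derive_mult.
    + exact: is_derive_id.
    + exact: fd2.
    + by move=> *; apply: Rmult_comm.
    + exact: is_derive_id.
    + exact: Fd.
    + by move=> *; apply: Rmult_comm.
  by rewrite /minus /plus /opp /mult /= /mult /one /= -(FE hs); ring.
- by [].
- by move=> s hs; rewrite -(FE hs); ring.
- by move=> s hs; apply: nF_ge0; lra.
- lra.
- lra.
- by [].
- exact: ltnW.
- by [].
- by [].
- by [].
- by rewrite /T0 in tw; lra.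
- by [].
- by rewrite -/Ck; lra.
- by rewrite -/Ck.
pose fa p := / INR p * (f ((L - ln (INR p)) / tau p) / tau p).
pose fb p := / INR p * Err nf (L - ln (INR p)) (tau p).
set SN := psum fa z - psum fa w in CH1.
set SE := psum fb z - psum fb w in CH2.
have BW := @brun_w F w w2 (ltnW wz) ws tw (@F_lim (L / tau w) ltac:(lra)).
have ewz : (al * K + 2) / L ^ 3 * exp (- (L / tau w)) <= (al * K + 2) / L ^ 3 * exp (- (L / tau z)).
  apply: Rmult_le_compat_l.
    apply: Rmult_le_pos; last exact/Rlt_le/Rinv_0_lt_compat/pow_lt.
    have alK : 0 <= al * K by apply: Rmult_le_pos; lra.
    lra.
  by apply: exp_le_mono; have := s_le tau_pos tau_S L0 (ltnW wz); lra.
have NS : X * (al * SN - M * SE) <=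
   psum (fun p => Sz [seq i <- A | E p i] E p) z - psum (fun p => Sz [seq i <- A | E p i] E p) w.
  have -> : X * (al * SN - M * SE) = X * al * SN + (- (X * M)) * SE by ring.
  have G n : psum (fun p => X * al * fa p + (- (X * M)) * fb p) n = X * al * psum fa n + (- (X * M)) * psum fb n.
    by rewrite psum_plus !psum_scal.
  rewrite (_ : X * al * SN + (- (X * M)) * SE = psum (fun p => X * al * fa p + (- (X * M)) * fb p) z - psum (fun p => X * al * fa p + (- (X * M)) * fb p) w); last by rewrite !G /SN /SE; ring.
  apply: psum_le; first exact: ltnW.
  move=> p hp pr; have [Xp lp] := ln_node pr.
  have tp : T0 <= tau p by apply: Rle_trans tw _; apply: tau_le => //; lia.
  have := nodes p pr ltac:(lia) tp; rewrite /LoC lp => H; apply: Rle_trans H.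
  by right; rewrite /fa /fb /Rdiv; ring.
rewrite (buchstab _ _ (ltnW wz)).
have a1 : al * (F (L / tau w) / tau w) - al * (F (L / tau z) / tau z) -
   al * (K * exp (9 / 2) * (4 * C1 ^ 2 + 94) * (C1 * q4 L) / L ^ 3 * exp (- (L / tau z))) <= al * SN.
  rewrite -!Rmult_minus_distr_l; apply: Rmult_le_compat_l; first lra.
  by move: CH1; split_Rabs; lra.
have a2 : M * SE <= M * Err nF L (tau z) - M * (3 / 10 * (exp (- (L / tau z)) / q4 L ^ 10)).
  by rewrite -Rmult_minus_distr_l; apply: Rmult_le_compat_l; lra.
have a3 : X * (al * (F (L / tau w) / tau w) + (al * K + 2) / L ^ 3 * exp (- (L / tau w)) - (al * SN - M * SE))
  <= X * (al * (F (L / tau z) / tau z) + M * Err nF L (tau z)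
     - / 10 * (exp (- (L / tau z)) / q4 L ^ 10)).
  by apply: Rmult_le_compat_l; lra.
have a4 : Sz A E w <= X * (al * (F (L / tau w) / tau w)) + X * ((al * K + 2) / L ^ 3 * exp (- (L / tau w))).
  by move: BW; split_Rabs; lra.
lra.
Qed.

End Step.

(** Below 3 the main term [F s / tau z] equals [2 / L] whatever [z] is. So it suffices to stop at
    the last [v] with [L / tau v >= 3] and to use that sifting further only removes elements. As
    [tau] jumps, [L / tau v] may exceed 3 by up to [4 / L ^ 2], and this is absorbed by the surplus
    of [step_up]. *)
Lemma step_up_small M X A E z : let L := ln X in
  1 <= M -> 0 < X -> 0 < L -> Y0 <= q4 L -> (2 <= z)%N -> regular (pf z) X A E ->
  L / tau z < 3 ->
  (forall p, prime p -> (p < z)%N -> 3 / 2 <= (L - ln (INR p)) / tau p -> L / 2 - C1 <= L - ln (INR p) ->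
     T0 <= tau p -> LoC M (X / INR p) [seq i <- A | E p i] E p) ->
  UpC M X A E z.
Proof.
move=> L M1 X0 L0 HY z2 reg sz nodes; have [ [h1 h2 h3 h4] [h5 h6 h7 h8]] := Y0_facts HY L0.
have [ [l1 l2 l3 l4] l5] := Y0_ln HY L0; have y1 := q4_ge1 HY L0; have B := Bc_ge.
have a0 := al_pos.
have BL := Rmult_le_compat 18 Bc 1 (ln L) ltac:(lra) ltac:(lra) B l3.
have [w [w2 wz ws tw wL]] := w_exists HY L0 z2 ltac:(lra).
have tzp := tau_pos z; have twp := tau_pos w.
have mul n : L / tau n * tau n = L by have := tau_pos n => ?; field; lra.
have c1 : tau w <= L / 3.
  have m := mul w; have : 18 * tau w <= L / tau w * tau w by apply: Rmult_le_compat_r; lra.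
  lra.
have c2 : L / 3 < tau z.
  have m := mul z; have : L / tau z * tau z < 3 * tau z by apply: Rmult_lt_compat_r.
  lra.
have [v [hv v1 v2]] := crossing (ltnW wz) c1 c2.
have tvp := tau_pos v.
have sv3 : 3 <= L / tau v by apply: (Rmult_le_reg_r (tau v)) => //; rewrite mul; lra.
have prv : prime v by apply: contraT => np; rewrite tau_S_np // in v2; lra.
have vw : L ^ 2 <= INR v by apply: Rle_trans wL _; apply: le_INR; lia.
have v2' := prime_INR prv.
have sv : L / tau v * (1 - / INR v) < 3.
  rewrite -tau_S_ratio //; have := mul v.+1; have := tau_pos v.+1.
  by move=> t0 m; apply: (Rmult_lt_reg_r (tau v.+1)) => //; lra.
have L400 : 400 <= L.
  apply: Rle_trans h1 _; rewrite -[X in _ <= X](q4_pow (Rlt_le _ _ L0)) -{1}(pow_1 (q4 L)).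
  by apply: Rle_pow => //; lia.
have L24 := pow_incr 400 L 2 ltac:(lra).
have iv : / INR v <= / 4 by apply: Rinv_le_contravar; lra.
have ivL : / INR v <= / L ^ 2 by apply: Rinv_le_contravar => //; apply: pow_lt.
have ivp : 0 < / INR v by apply: Rinv_0_lt_compat; lra.
have svb : L / tau v - 3 <= 4 / L ^ 2.
  move: (L / tau v) sv sv3 => s sv sv3.
  have s4 : s < 4 by have := Rmult_le_compat_l s (3 / 4) (1 - / INR v) ltac:(lra) ltac:(lra); lra.
  have : s * / INR v <= 4 * / L ^ 2 by apply: Rmult_le_compat; lra.
  rewrite /Rdiv; lra.
have L2 : 0 < / L ^ 2 by apply/Rinv_0_lt_compat/pow_lt.
have L2b : / L ^ 2 <= / 4 by apply: Rinv_le_contravar; lra.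
have tv : T0 <= tau v by apply: Rle_trans tw _; apply: tau_le => //; lia.
have vz : (v <= z)%N by lia.
have U := @step_up M X A E v M1 X0 L0 HY ltac:(lia) tv
  (regular_sub (fun q _ (h : pf v q) => leq_trans h vz : pf z q) reg) sv3.
have {}U := U (fun p pr pv tp => nodes p pr (leq_trans pv vz)
   ((node_bound (Rle_trans _ _ _ (ltac:(lra) : 2 <= 3) sv3) L0 pv (prime_gt1 pr) tp).2 sv3)
   (node_bound (Rle_trans _ _ _ (ltac:(lra) : 2 <= 3) sv3) L0 pv (prime_gt1 pr) tp).1 tp).
rewrite -/L in U; rewrite /UpC -/L; apply: Rle_trans (Sz_mono _ _ vz) _; apply: Rle_trans U _.
apply: Rmult_le_compat_l; first lra.
have szp : 0 < L / tau z by apply: Rdiv_lt_0_compat.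
have [Fz nFz] := @F_small (L / tau z) ltac:(lra).
have [F3 nF3] := @F_small 3 ltac:(lra).
have Hh : F (L / tau v) / tau v <= 2 / L + (om + K) * 4 / L ^ 3.
  have [c [hc Ec]] : exists c, 3 <= c <= L / tau v /\
     L / tau v * F (L / tau v) - 3 * F 3 = f (c - 1) * (L / tau v - 3).
    apply: (@mvt (fun s => s * F s) (fun s => f (s - 1))) => // s hs.
    have fd := @F_der s ltac:(lra).
    evar_last; first by apply: is_derive_mult; [apply: is_derive_id|exact: fd|move=> *; apply: Rmult_comm].
    by rewrite /plus /mult /= /mult /= -FE; [rewrite /one /=; ring|lra].
  have fc : f (c - 1) <= om + K.
    have := @f_lim (c - 1) ltac:(lra).
    have : K * exp (-3 * (c - 1)) <= K * 1.
      by apply: Rmult_le_compat_l => //; rewrite -[X in _ <= X]exp_0; apply: exp_le_mono; lra.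
    by split_Rabs; lra.
  have hh : L / tau v * F (L / tau v) <= 2 + (om + K) * (4 / L ^ 2).
    have q : f (c - 1) * (L / tau v - 3) <= (om + K) * (4 / L ^ 2).
      apply: Rle_trans (_ : (om + K) * (L / tau v - 3) <= _).
        by apply: Rmult_le_compat_r => //; lra.
      by apply: Rmult_le_compat_l => //; lra.
    have e2 : 3 * (2 / 3) = 2 by field.
    by rewrite F3 e2 in Ec; lra.
  have -> : F (L / tau v) / tau v = / L * (L / tau v * F (L / tau v)) by field; lra.
  have -> : 2 / L + (om + K) * 4 / L ^ 3 = / L * (2 + (om + K) * (4 / L ^ 2)) by field; lra.
  by apply: Rmult_le_compat_l => //; apply/Rlt_le/Rinv_0_lt_compat.
(* [s ^ 2 * nF s = s * F s - s * f (s - 1)] does not increase beyond 3, its derivative being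
   [- s * nf (s - 1)], and equals 2 at 3. *)
have Hk : nF (L / tau v) / tau v ^ 2 <= 2 / L ^ 2.
  have [c [hc Ec]] : exists c, 3 <= c <= L / tau v /\
     (L / tau v * F (L / tau v) - L / tau v * f (L / tau v - 1)) - (3 * F 3 - 3 * f (3 - 1)) =
       - c * nf (c - 1) * (L / tau v - 3).
    apply: (@mvt (fun s => s * F s - s * f (s - 1)) (fun s => - s * nf (s - 1))) => // s hs.
    have Fd := @F_der s ltac:(lra); have fd := @f_der (s - 1) ltac:(lra).
    have fd2 : is_derive (fun x => f (x - 1)) s (nf (s - 1)).
      evar_last; first by apply: is_derive_comp; [exact: fd|auto_derive].
      by rewrite /scal /= /mult /=; ring.
    evar_last.
      apply: is_derive_minus; apply: is_derive_mult.
      + exact: is_derive_id.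
      + exact: Fd.
      + by move=> *; apply: Rmult_comm.
      + exact: is_derive_id.
      + exact: fd2.
      + by move=> *; apply: Rmult_comm.
    rewrite /minus /plus /opp /mult /= /mult /one /=.
    by have := FE (ltac:(lra) : 3 <= s) => FEs; rewrite -FEs; ring.
  have nfc := @nf_ge0 (c - 1) ltac:(lra).
  have e3 := FE (Rle_refl 3); have ev := FE sv3.
  have : 0 <= c * nf (c - 1) * (L / tau v - 3) by apply: Rmult_le_pos; [apply: Rmult_le_pos|]; lra.
  move=> q.
  have kv : (L / tau v) ^ 2 * nF (L / tau v) <= 2.
    have : (L / tau v) ^ 2 * nF (L / tau v) = L / tau v * F (L / tau v) - L / tau v * f (L / tau v - 1).
      by rewrite -ev; ring.
    have : 3 * F 3 - 3 * f (3 - 1) = 2 by rewrite -e3 nF3; field.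
    lra.
  have -> : nF (L / tau v) / tau v ^ 2 = / L ^ 2 * ((L / tau v) ^ 2 * nF (L / tau v)) by field; lra.
  by rewrite /Rdiv Rmult_comm (Rmult_comm 2); rewrite (Rmult_comm _ (/ L ^ 2)); apply: Rmult_le_compat_l; lra.
have EF : F (L / tau z) / tau z = 2 / L by rewrite Fz; field; lra.
have EnF : nF (L / tau z) / tau z ^ 2 = 2 / L ^ 2 by rewrite nFz; field; lra.
have yL := q4_pow (Rlt_le _ _ L0).
have y10 : 0 < / q4 L ^ 10 by apply/Rinv_0_lt_compat/pow_lt; lra.
have esz : exp (- (L / tau v)) / q4 L ^ 10 <= exp (- (L / tau z)) / q4 L ^ 10.
  by apply: Rmult_le_compat_r; [lra|apply: exp_le_mono; lra].
have EE : Err nF L (tau v) <= Err nF L (tau z).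
  rewrite /Err EnF; apply: Rplus_le_compat => //; apply: Rmult_le_compat_l => //.
  have : / q4 L <= 1 by rewrite -Rinv_1; apply: Rinv_le_contravar; lra.
  lra.
have ME : M * Err nF L (tau v) <= M * Err nF L (tau z) by apply: Rmult_le_compat_l; lra.
have AF : al * (F (L / tau v) / tau v) <= al * (F (L / tau z) / tau z) + al * ((om + K) * 4 / L ^ 3).
  by rewrite EF -Rmult_plus_distr_l; apply: Rmult_le_compat_l; lra.
have S1 : al * ((om + K) * 4 / L ^ 3) <= / 10 * (exp (- (L / tau v)) / q4 L ^ 10).
  have e4 : exp (- 4) <= exp (- (L / tau v)) by apply: exp_le_mono; lra.
  apply: Rle_trans (_ : / 10 * (exp (- 4) / q4 L ^ 10) <= _); last first.
    by apply: Rmult_le_compat_l; [lra|apply: Rmult_le_compat_r; lra].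
  set y := q4 L in yL y1 h8 y10 *; rewrite -yL exp_Ropp.
  have e0 := exp_pos 4.
  have -> : al * ((om + K) * 4 / (y ^ 4) ^ 3) = / 10 * / y ^ 10 * (40 * (al * (om + K)) / y ^ 2) by field; lra.
  have -> : / 10 * (/ exp 4 / y ^ 10) = / 10 * / y ^ 10 * / exp 4 by field; lra.
  apply: Rmult_le_compat_l; first by apply: Rmult_le_pos; lra.
  have y2 : 0 < y ^ 2 by apply: pow_lt; lra.
  apply: (Rmult_le_reg_r (y ^ 2)) => //; apply: (Rmult_le_reg_r (exp 4)) => //.
  have -> : 40 * (al * (om + K)) / y ^ 2 * y ^ 2 * exp 4 = 40 * (al * (om + K)) * exp 4 by field; lra.
  have -> : / exp 4 * y ^ 2 * exp 4 = y ^ 2 by field; lra.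
  by have := Rle_pow y 1 2 y1 ltac:(lia); rewrite pow_1; lra.
lra.
Qed.

Definition Lmin := Y0 ^ 4.

Lemma Y0_ge : 400 <= Y0.
Proof.
have ck := Ck_ge0; have a0 := al_pos; have d5 := D5_ge2.
have h1 : 0 < / kap by apply: Rinv_0_lt_compat.
have h2 : 0 <= 10 * (67 + Ck) / k16.
  by apply: Rmult_le_pos; [lra|apply/Rlt_le/Rinv_0_lt_compat].
have h3 : 0 <= 8 * Bc * (tau 2 + 20 * C1 + 28).
  by have := Bc_ge; have := tau_pos 2; nra.
have h4 : 0 <= 40 * (al * (om + K)) * exp 4.
  apply: Rmult_le_pos; last exact/Rlt_le/exp_pos.
  by apply: Rmult_le_pos; [lra|apply: Rmult_le_pos; lra].
have := C1_ge1; rewrite /Y0; lra.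
Qed.

Lemma Lmin_large L : Lmin <= L -> Y0 <= q4 L /\ 1 <= L.
Proof.
move=> h; have y0 := Y0_ge; have := @q4_scal_ge Y0 L 1 ltac:(lra) ltac:(lra).
rewrite Rmult_1_r => /(_ h); rewrite /q4 !sqrt_1 Rmult_1_r => h2; split=> //.
apply: Rle_trans h; rewrite /Lmin -(pow1 4); apply: pow_incr; lra.
Qed.

(** While [ln X <= b], this [M] makes the error term alone at least [(2 + al * (om + K)) * X], which
    exceeds both the main term of the lower bound and the trivial count [2 * X]. *)
Lemma base_claim b M X A E z : let L := ln X in
  M = (2 + al * (om + K)) * (b ^ 3 * exp b) -> 0 < X -> Lmin <= L <= b -> T0 <= tau z ->
  regular (pf z) X A E ->
  (3 / 2 <= L / tau z -> LoC M X A E z) /\ UpC M X A E z.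
Proof.
move=> L EM X0 hL tz reg; have [HY L1] := Lmin_large hL.1.
have L0 : 0 < L by lra.
have [ [l1 l2 l3 l4] l5] := Y0_ln HY L0; have y1 := q4_ge1 HY L0.
have a0 := al_pos; have C := C1_ge1; rewrite /T0 in tz.
have szp : 0 < L / tau z by apply: Rdiv_lt_0_compat; lra.
have sb : L / tau z <= b.
  apply: Rle_trans (proj2 hL); apply/Rle_div_l; first lra.
  nra.
have yL := q4_pow (Rlt_le _ _ L0).
have y12 : q4 L ^ 10 <= b ^ 3.
  apply: Rle_trans (_ : L ^ 3 <= _); last by apply: pow_incr; lra.
  rewrite -[X in _ <= X ^ 3]yL -pow_mult; apply: Rle_pow => //; lia.
have y10 : 0 < q4 L ^ 10 by apply: pow_lt; lra.
have P : 2 + al * (om + K) <= M * (exp (- (L / tau z)) / q4 L ^ 10).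
  rewrite EM Rmult_assoc -[X in X <= _]Rmult_1_r; apply: Rmult_le_compat_l.
    have : 0 <= al * (om + K) by apply: Rmult_le_pos; lra.
    lra.
  apply: Rle_trans (_ : b ^ 3 * exp b * (exp (- b) / b ^ 3) <= _).
    right; rewrite exp_Ropp; field; split; first by have := exp_pos b; lra.
    by apply: Rgt_not_eq; lra.
  apply: Rmult_le_compat_l.
    by apply: Rmult_le_pos; [apply: pow_le; lra|apply/Rlt_le/exp_pos].
  apply: Rmult_le_compat.
  - exact/Rlt_le/exp_pos.
  - by apply/Rlt_le/Rinv_0_lt_compat/pow_lt; lra.
  - by apply: exp_le_mono; lra.
  - exact: Rinv_le_contravar.
have alK : 0 <= al * (om + K) by apply: Rmult_le_pos; lra.
have M0 : 0 <= M.
  rewrite EM; apply: Rmult_le_pos; first lra.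
  by apply: Rmult_le_pos; [apply: pow_le; lra|apply/Rlt_le/exp_pos].
have X1 : 1 <= X.
  by rewrite -(exp_ln X) //; have := exp_ineq1_le (ln X); rewrite -/L; lra.
split.
  move=> s32; have EG := @Err_ge nf L (tau z) y1 (nf_ge0 s32) ltac:(lra).
  rewrite /LoC -/L; apply: Rle_trans (Sz_ge0 _ _ _).
  have fl : f (L / tau z) / tau z <= om + K.
    have := f_lim s32.
    have : K * exp (-3 * (L / tau z)) <= K * 1.
      by apply: Rmult_le_compat_l => //; rewrite -[X in _ <= X]exp_0; apply: exp_le_mono; lra.
    move=> k1 k2; apply/Rle_div_l; first lra.
    have : f (L / tau z) <= om + K by move: k2; split_Rabs; lra.
    nra.
  have : al * (f (L / tau z) / tau z) <= al * (om + K) by apply: Rmult_le_compat_l; lra.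
  have : M * (exp (- (L / tau z)) / q4 L ^ 10) <= M * Err nf L (tau z) by apply: Rmult_le_compat_l.
  nra.
have EG := @Err_ge nF L (tau z) y1 (nF_ge0 szp) ltac:(lra).
rewrite /UpC -/L; apply: Rle_trans (_ : X * 2 <= _).
  have := regular_card reg; have : Sz A E z <= INR (size A).
    by apply: le_INR; have := count_size (fun i => all (fun p => ~~ E p i) (plist z)) A; rewrite /sift; lia.
  by split_Rabs; lra.
apply: Rmult_le_compat_l; first lra.
have : M * (exp (- (L / tau z)) / q4 L ^ 10) <= M * Err nF L (tau z) by apply: Rmult_le_compat_l.
have : 0 <= al * (F (L / tau z) / tau z).
  apply: Rmult_le_pos; first lra.
  by apply: Rmult_le_pos; [apply: F_ge0|apply/Rlt_le/Rinv_0_lt_compat; lra].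
lra.
Qed.

Theorem linear_sieve : exists M, 1 <= M /\
  forall X A E z, 0 < X -> Lmin <= ln X -> (2 <= z)%N -> T0 <= tau z ->
  regular (pf z) X A E ->
  (3 / 2 <= ln X / tau z -> LoC M X A E z) /\ UpC M X A E z.
Proof.
(* Passing to a node replaces [L] by at least [L / 2 - C1]; from [L >= b] this stays above
   [Lmin]. *)
set b := 2 * Lmin + 2 * C1.
have a0 := al_pos; have C := C1_ge1.
have LM : 1 <= Lmin by rewrite /Lmin -(pow1 4); apply: pow_incr; have := Y0_ge; lra.
set M := (2 + al * (om + K)) * (b ^ 3 * exp b).
have M1 : 1 <= M.
  have : 0 <= al * (om + K) by apply: Rmult_le_pos; lra.
  have : 1 <= b ^ 3 by rewrite -(pow1 3); apply: pow_incr; rewrite /b; lra.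
  have : 1 <= exp b by have := exp_ineq1_le b; rewrite /b; lra.
  move=> h1 h2 h3; have : 1 <= b ^ 3 * exp b by nra.
  by rewrite /M; nra.
exists M; split=> //.
have ln2 : 0 < ln 2 by rewrite -ln_1; apply: ln_increasing; lra.
(* The induction runs over [ln X] in steps of [ln 2], the least possible drop from [X] to
   [X / p]. *)
suff H k : forall X A E z, 0 < X -> Lmin <= ln X -> ln X <= b + INR k * ln 2 -> (2 <= z)%N ->
  T0 <= tau z -> regular (pf z) X A E ->
  (3 / 2 <= ln X / tau z -> LoC M X A E z) /\ UpC M X A E z.
  move=> X A E z X0 hL z2 tz reg.
  have [k hk] : exists k, ln X / ln 2 <= INR k.
    have [k [_ hk]] := nfloor_ex (ln X / ln 2) ltac:(by apply/Rlt_le/Rdiv_lt_0_compat; lra).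
    by exists k.+1; rewrite S_INR; lra.
  apply: (H k) => //; move/Rle_div_l: hk => /(_ ln2); rewrite /b; lra.
elim: k => [|k IH] X A E z X0 hL hk z2 tz reg.
  by apply: (@base_claim b) => //; rewrite /= in hk; lra.
have [hb|hb] := Rle_lt_dec (ln X) (b + INR k * ln 2); first exact: IH.
have bk : b <= ln X by have := pos_INR k; nra.
have [HY L1] := Lmin_large hL.
have L0 : 0 < ln X by lra.
have sub p : prime p -> (p < z)%N -> T0 <= tau p -> ln X / 2 - C1 <= ln X - ln (INR p) ->
   (3 / 2 <= (ln X - ln (INR p)) / tau p -> LoC M (X / INR p) [seq i <- A | E p i] E p) /\
   UpC M (X / INR p) [seq i <- A | E p i] E p.
  move=> pr pz tp hp; have [Xp lp] := @ln_node X X0 p pr.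
  have := @IH (X / INR p) [seq i <- A | E p i] E p Xp; rewrite lp; apply=> //.
  - by rewrite /b in bk; lra.
  - have : ln 2 <= ln (INR p) by apply: ln_le_mono; [lra|apply: prime_INR].
    by move: hk; rewrite S_INR; lra.
  - exact: prime_gt1.
  - exact: (reg_node z2 reg pr pz).
have tz0 := tau_pos z.
split.
  move=> s32; have [s2|s2] := Rle_lt_dec 2 (ln X / tau z).
    apply: step_low => // p pr pz tp.
    have [n1 n2] := node_bound s2 L0 pz (prime_gt1 pr) tp.
    by have [] := sub p pr pz tp n1.
  (* Between [3 / 2] and the sifting limit [f] is nonpositive, so the lower bound holds
     trivially. *)
  rewrite /LoC; apply: Rle_trans (Sz_ge0 _ _ _).
  have fn := @f_neg (ln X / tau z) ltac:(lra).
  have E0 := @Err_ge nf (ln X) (tau z) (q4_ge1 HY L0) (nf_ge0 s32) tz0.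
  have P0 : 0 < exp (- (ln X / tau z)) / q4 (ln X) ^ 10.
    apply: Rdiv_lt_0_compat; first exact: exp_pos.
    by apply: pow_lt; have := q4_ge1 HY L0; lra.
  have : 0 <= M * Err nf (ln X) (tau z) by apply: Rmult_le_pos; lra.
  have : al * (f (ln X / tau z) / tau z) <= 0.
    have it : 0 < / tau z by apply: Rinv_0_lt_compat.
    have : f (ln X / tau z) * / tau z <= 0 by nra.
    rewrite /Rdiv; nra.
  nra.
have [s3|s3] := Rle_lt_dec 3 (ln X / tau z).
  have := @step_up M X A E z M1 X0 L0 HY z2 tz reg s3.
  have nodes p : prime p -> (p < z)%N -> T0 <= tau p -> LoC M (X / INR p) [seq i <- A | E p i] E p.
    move=> pr pz tp; have [n1 n2] := @node_bound (ln X) p z ltac:(lra) L0 pz (prime_gt1 pr) tp.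
    by have [h _] := sub p pr pz tp n1; apply/h/n2.
  move=> /(_ nodes) H; apply: Rle_trans H _; apply: Rmult_le_compat_l; first lra.
  have : 0 < exp (- (ln X / tau z)) / q4 (ln X) ^ 10.
    apply: Rdiv_lt_0_compat; first exact: exp_pos.
    by apply: pow_lt; have := q4_ge1 HY L0; lra.
  lra.
apply: step_up_small => // p pr pz h32 hp tp.
by have [h _] := sub p pr pz tp hp; apply: h.
Qed.

End Linear.

(** * The sieve functions *)

(* Up to a constant factor the sieve functions are F = Om + Ps and f = Om - Ps, where s Om(s) and s Ps(s)
   solve y' = c y(s - 1) / (s - 1) with c = 1 and c = -1. *)
Lemma continuous_Rmax_r (a x : R) : continuous (fun s => Rmax a s) x.
Proof.
apply: (continuous_ext (fun s => (a + s + Rabs (a - s)) / 2)).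
  by move=> s; rewrite /Rmax; case: Rle_dec => h; split_Rabs; lra.
apply: continuous_scal_l; apply: continuous_plus.
  by apply: continuous_plus; [apply: continuous_const|apply: continuous_id].
apply: continuous_comp; last exact: continuous_Rabs.
by apply: continuous_minus; [apply: continuous_const|apply: continuous_id].
Qed.

Section Delay.
Variable c : R.

(* Picard iterates; the n-th one is exact on (-oo, n + 2]. *)
Fixpoint yn (n : nat) (s : R) : R :=
  if n is m.+1 then 1 + c * RInt (fun x => yn m (x - 1) / Rmax 1 (x - 1)) 2 (Rmax 2 s) else 1.

(** [Rmax] keeps the denominator away from 0, so the integrand is continuous on the whole line; in
    the range of the equation it changes nothing. *)
Let gn n x := yn n (x - 1) / Rmax 1 (x - 1).

Lemma gn_cont n : (forall s, continuous (yn n) s) -> forall x, continuous (gn n) x.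
Proof.
move=> H x; rewrite /gn.
have sh : continuous (fun x => x - 1) x.
  by apply: continuous_minus; [apply: continuous_id|apply: continuous_const].
apply: continuous_mult; first by apply: continuous_comp => //; apply: H.
apply: continuous_Rinv_comp; last by have := Rmax_l 1 (x - 1); lra.
by apply: continuous_comp => //; apply: continuous_Rmax_r.
Qed.

Lemma gn_int n : (forall s, continuous (yn n) s) -> forall a b, ex_RInt (gn n) a b.
Proof. by move=> H a b; apply: ex_RInt_continuous => z _; apply: gn_cont. Qed.

Lemma gn_der n : (forall s, continuous (yn n) s) ->
  forall s, is_derive (fun s => RInt (gn n) 2 s) s (gn n s).
Proof.
move=> H s; apply: is_derive_RInt; last exact: gn_cont.
by apply: filter_forall => b; apply: RInt_correct; apply: gn_int.
Qed.

Lemma yn_cont n s : continuous (yn n) s.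
Proof.
elim: n s => [|n IH] s /=; first exact: continuous_const.
apply: continuous_plus; first exact: continuous_const.
apply: continuous_mult; first exact: continuous_const.
apply: (continuous_comp (fun s => Rmax 2 s) (fun s => RInt (gn n) 2 s)).
  exact: continuous_Rmax_r.
by apply: ex_derive_continuous; eexists; apply: gn_der.
Qed.

Lemma yn_2 n s : s <= 2 -> yn n s = 1.
Proof. by case: n => //= n hs; rewrite Rmax_left // RInt_point /zero /=; ring. Qed.

Lemma ynSE n s : yn n.+1 s = 1 + c * RInt (gn n) 2 (Rmax 2 s).
Proof. by []. Qed.

Lemma yn_S n s : s <= INR n + 2 -> yn n.+1 s = yn n s.
Proof.
elim: n s => [|n IH] s hs; first by rewrite yn_2 //; rewrite /= in hs; lra.
rewrite (ynSE n.+1) (ynSE n); congr (_ + _ * _); apply: RInt_ext => x; rewrite /gn.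
have m2 := Rmax_l 2 s; rewrite (Rmin_left 2 (Rmax 2 s)) // (Rmax_right 2 (Rmax 2 s)) //.
move=> [_ hx]; congr (_ / _); apply: IH; rewrite S_INR in hs.
by have : Rmax 2 s <= INR n + 3; [apply: Rmax_lub; have := pos_INR n; lra|lra].
Qed.

Lemma yn_stable n m s : s <= INR n + 2 -> (n <= m)%N -> yn m s = yn n s.
Proof.
move=> hs /subnKC <-; elim: (m - n)%N => [|d IH]; first by rewrite addn0.
by rewrite addnS yn_S // plus_INR; have := pos_INR d; lra.
Qed.

(** Diagonal choice: at [s], [up s] iterations are more than are needed for exactness. *)
Definition yy (s : R) : R := yn (BinInt.Z.to_nat (up s)) s.

Lemma up_le s : s <= INR (BinInt.Z.to_nat (up s)).
Proof.
have [h1 h2] := archimed s; have [h|h] := BinInt.Z.le_gt_cases BinNums.Z0 (up s).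
  by rewrite INR_IZR_INZ Znat.Z2Nat.id //; lra.
have : IZR (up s) <= 0 by apply: (IZR_le _ BinNums.Z0); lia.
have := pos_INR (BinInt.Z.to_nat (up s)); lra.
Qed.

Lemma yyE n s : s <= INR n + 2 -> yy s = yn n s.
Proof.
move=> hs; rewrite /yy; have := up_le s; set N := BinInt.Z.to_nat _ => hN.
by have [h|h] := leqP n N; [apply: yn_stable|symmetry; apply: yn_stable; [lra|lia]].
Qed.

Lemma yy_2 s : s <= 2 -> yy s = 1.
Proof. by move=> hs; rewrite (@yyE 0) //= ; lra. Qed.

Lemma yy_loc n s : s < INR n + 2 -> locally s (fun x => yn n x = yy x).
Proof.
move=> hs; have e0 : 0 < INR n + 2 - s by lra.
exists (mkposreal _ e0) => x /= hx; symmetry; apply: yyE.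
by move: hx; rewrite /ball /= /AbsRing_ball /abs /minus /plus /opp /=; split_Rabs; lra.
Qed.

Lemma yy_cont s : continuous yy s.
Proof.
have h := up_le s; set N := BinInt.Z.to_nat (up s) in h.
by apply: (continuous_ext_loc _ (yn N)); [apply: yy_loc; lra|apply: yn_cont].
Qed.

Lemma yy_der s : 2 < s -> is_derive yy s (c * (yy (s - 1) / (s - 1))).
Proof.
move=> hs; have h := up_le s; set N := BinInt.Z.to_nat (up s) in h.
apply: (is_derive_ext_loc (yn N.+1)); first by apply: yy_loc; rewrite S_INR; lra.
apply: (is_derive_ext_loc (fun s => 1 + c * RInt (gn N) 2 s)).
  have e0 : 0 < s - 2 by lra.
  exists (mkposreal _ e0) => x /= hx; rewrite Rmax_right //.
  by move: hx; rewrite /ball /= /AbsRing_ball /abs /minus /plus /opp /=; split_Rabs; lra.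
have -> : c * (yy (s - 1) / (s - 1)) = 0 + (0 * RInt (gn N) 2 s + c * gn N s).
  by rewrite /gn Rmax_right ?(@yyE N); [ring|lra|lra].
apply: is_derive_plus; first exact: is_derive_const.
apply: is_derive_mult; first exact: is_derive_const.
- exact/gn_der/yn_cont.
- by move=> *; apply: Rmult_comm.
Qed.

End Delay.

Lemma mvt_open (f df : R -> R) (a b : R) : a <= b ->
  (forall x, a <= x <= b -> continuous f x) ->
  (forall x, a < x < b -> is_derive f x (df x)) ->
  exists c, a <= c <= b /\ f b - f a = df c * (b - a).
Proof.
move=> ab C H; have [||c [hc E]] := MVT_gen f a b df.
- by move=> x; rewrite Rmin_left // Rmax_right // => hx; apply: H; lra.
- by move=> x; rewrite Rmin_left // Rmax_right // => hx; apply/continuity_pt_filterlim/C.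
by exists c; rewrite Rmin_left // Rmax_right // in hc.
Qed.

Lemma decr_of_der (f df : R -> R) (a b : R) : a <= b ->
  (forall x, a <= x <= b -> continuous f x) ->
  (forall x, a < x < b -> is_derive f x (df x)) ->
  (forall x, a < x < b -> df x <= 0) -> f b <= f a.
Proof.
move=> [ab|->] C H D; last lra.
(* The mean value point may be an endpoint, where the sign of [df] is not known; giving the
   derivative the value 0 there makes all cases agree. *)
have [c [hc E]] := @mvt_open f (fun x => if Rlt_dec a x then if Rlt_dec x b then df x else 0 else 0) a b (Rlt_le _ _ ab) C
  ltac:(by move=> x [h1 h2]; case: Rlt_dec => // ?; case: Rlt_dec => // ?; apply: H).
move: E => /=; case: Rlt_dec => h1 /=; last by move=> ?; lra.
case: Rlt_dec => h2 /= E; last by lra.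
have := D c (conj h1 h2); nra.
Qed.

Lemma const_of_der (f : R -> R) (a b : R) : a <= b ->
  (forall x, a <= x <= b -> continuous f x) ->
  (forall x, a < x < b -> is_derive f x 0) -> f b = f a.
Proof.
move=> ab C H; have [c [_ E]] := mvt_open ab C H; lra.
Qed.

(** Consider the supremum of the initial segments on which [h] is positive: [step] reaches it, and
    continuity goes beyond it. *)
Lemma real_induction (h : R -> R) (a : R) :
  (forall x, a <= x -> continuous h x) -> 0 < h a ->
  (forall s, a < s -> (forall x, a <= x < s -> 0 < h x) -> 0 < h s) ->
  forall s, a <= s -> 0 < h s.
Proof.
move=> C ha step s1 as1; apply: Rnot_le_lt => hs1.
pose E t := a <= t <= s1 /\ forall x, a <= x <= t -> 0 < h x.
have Ea : E a by split; [lra|move=> x hx; have -> : x = a by lra].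
have bE : bound E by exists s1 => t [ [_ ?] _].
have [t0 [ub lub]] := completeness E bE (ex_intro _ a Ea).
have at0 : a <= t0 by apply: ub.
have t0s : t0 <= s1 by apply: lub => t [ [_ ?] _].
have below x : a <= x < t0 -> 0 < h x.
  move=> hx; apply: Rnot_le_lt => hxl.
  suff : t0 <= x by lra.
  apply: lub => t [ [_ _] ht]; apply: Rnot_lt_le => xt.
  by have := ht x; lra.
have h0 : 0 < h t0.
  by case: at0 => [at0|<- //]; apply: step.
have [eps He] : exists eps : posreal, forall x, Rabs (x - t0) < eps -> 0 < h x.
  have P : locally (h t0) (fun y => 0 < y).
    exists (mkposreal _ h0) => y; rewrite /ball /= /AbsRing_ball /abs /minus /plus /opp /=.
    by split_Rabs; lra.
  by have [eps H] := C t0 at0 _ P; exists eps.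
have e0 := cond_pos eps.
have [h1|h1] := Rle_lt_dec s1 (t0 + eps / 2).
  suff : 0 < h s1 by lra.
  by apply: He; split_Rabs; lra.
suff : t0 + eps / 2 <= t0 by lra.
apply: ub; split; first lra.
move=> x hx; have [hx2|hx2] := Rlt_le_dec x t0; first by apply: below; lra.
by apply: He; split_Rabs; lra.
Qed.

(** On [s >= 1], [ph s / s] is Buchstab's function and [ps s] is Dickman's function at [s - 1]. *)
Definition ph := yy 1.
Definition ps := yy (-1).

Lemma ph_cont s : continuous ph s. Proof. exact: yy_cont. Qed.
Lemma ps_cont s : continuous ps s. Proof. exact: yy_cont. Qed.
Lemma ph_2 s : s <= 2 -> ph s = 1. Proof. exact: yy_2. Qed.
Lemma ps_2 s : s <= 2 -> ps s = 1. Proof. exact: yy_2. Qed.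
Lemma ph_der s : 2 < s -> is_derive ph s (ph (s - 1) / (s - 1)).
Proof. by move=> hs; have := yy_der 1 hs; rewrite Rmult_1_l. Qed.
Lemma ps_der s : 2 < s -> is_derive ps s (- (ps (s - 1) / (s - 1))).
Proof. by move=> hs; have := yy_der (-1) hs; rewrite (_ : -1 * _ = - (ps (s - 1) / (s - 1))) //; rewrite /ps; ring. Qed.

Lemma ps_shift_cont (g : R -> R) s : (forall x, continuous g x) -> continuous (fun x => g (x - 1)) s.
Proof.
move=> C; apply: continuous_comp; last exact: C.
by apply: continuous_minus; [apply: continuous_id|apply: continuous_const].
Qed.

Definition Th s := RInt ps 0 s.

Lemma Th_der s : is_derive Th s (ps s).
Proof.
apply: is_derive_RInt; last exact: ps_cont.
by apply: filter_forall => b; apply: RInt_correct; apply: ex_RInt_continuous => z _; apply: ps_cont.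
Qed.

Lemma shift_der (g : R -> R) d s : is_derive g (s - 1) d -> is_derive (fun x => g (x - 1)) s d.
Proof.
move=> H; evar_last; first by apply: is_derive_comp; [exact: H|auto_derive].
by rewrite /scal /= /mult /=; ring.
Qed.

(** Both sides have derivative [ps s - ps (s - 1)]. Since the right side is an integral of earlier
    values, [ps] cannot have a first zero, which its delay equation alone does not show. *)
Lemma ps_identity s : 2 <= s -> (s - 1) * ps s = Th s - Th (s - 1).
Proof.
move=> hs.
have E : (s - 1) * ps s - (Th s - Th (s - 1)) = (2 - 1) * ps 2 - (Th 2 - Th (2 - 1)).
  apply: (@const_of_der (fun x => (x - 1) * ps x - (Th x - Th (x - 1)))) => // x hx.
    have cTh y : continuous Th y by apply: ex_derive_continuous; eexists; apply: Th_der.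
    apply: continuous_minus.
      apply: continuous_mult; last exact: ps_cont.
      by apply: continuous_minus; [apply: continuous_id|apply: continuous_const].
    by apply: continuous_minus; [apply: cTh|apply: ps_shift_cont].
  have d1 := ps_der (proj1 hx); have d2 := Th_der x; have d3 := shift_der (Th_der (x - 1)).
  evar_last.
    apply: is_derive_minus; last by apply: is_derive_minus; [exact: d2|exact: d3].
    apply: is_derive_mult; [|exact: d1|by move=> *; apply: Rmult_comm].
    by apply: is_derive_minus; [apply: is_derive_id|apply: is_derive_const].
  by rewrite /minus /plus /opp /mult /= /mult /one /zero /=; field; lra.
have T : Th 2 - Th 1 = 1.
  have [c [hc Ec]] := @mvt_open Th ps 1 2 ltac:(lra)
    (fun x _ => ex_derive_continuous _ _ (ex_intro _ _ (Th_der x))) (fun x _ => Th_der x).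
  by have p2 := @ps_2 c (proj2 hc); rewrite p2 in Ec; lra.
have e21 : 2 - 1 = 1 by ring.
by rewrite e21 (@ps_2 2) in E; lra.
Qed.

Lemma Th_mono a b : a <= b -> (forall x, a < x < b -> 0 < ps x) -> a < b -> Th a < Th b.
Proof.
move=> ab P lt.
have [c [hc Ec]] : exists c, a < c < b /\ Th b - Th a = ps c * (b - a).
  have [c [E hc]] := MVT_cor2 Th ps a b lt ltac:(by move=> c _; apply/is_derive_Reals/Th_der).
  by exists c.
have := P c hc; nra.
Qed.

Lemma ps_pos s : 0 < ps s.
Proof.
have [h|h] := Rle_lt_dec s 2; first by rewrite ps_2; lra.
apply: (@real_induction ps 2) => //; try lra; first by move=> x _; apply: ps_cont.
  by rewrite ps_2; lra.
move=> t ht IH; have E := ps_identity (Rlt_le _ _ ht).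
have : Th (t - 1) < Th t.
  apply: Th_mono; try lra; move=> x hx.
  by have [h2|h2] := Rle_lt_dec x 2; [rewrite ps_2; lra|apply: IH; lra].
nra.
Qed.

Lemma ps_decr x y : x <= y -> ps y <= ps x.
Proof.
move=> xy; have [h|h] := Rle_lt_dec y 2; first by rewrite !ps_2; lra.
have H : forall a, 2 <= a -> a <= y -> ps y <= ps a.
  move=> a a2 ay; apply: (@decr_of_der ps (fun x => - (ps (x - 1) / (x - 1)))) => //.
  - by move=> t _; apply: ps_cont.
  - by move=> t ht; apply: ps_der; lra.
  - move=> t ht; have : 0 < ps (t - 1) / (t - 1) by apply: Rdiv_lt_0_compat; [apply: ps_pos|lra].
    lra.
have [h2|h2] := Rle_lt_dec 2 x; first exact: H.
by rewrite (@ps_2 x); [rewrite -(@ps_2 2); [apply: H|]|]; lra.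
Qed.

Lemma ps_step s : 2 <= s -> (s - 1) * ps s <= ps (s - 1).
Proof.
move=> hs; rewrite ps_identity //.
have [c [hc ->]] := @mvt_open Th ps (s - 1) s ltac:(lra)
  (fun x _ => ex_derive_continuous _ _ (ex_intro _ _ (Th_der x))) (fun x _ => Th_der x).
have := @ps_decr (s - 1) c ltac:(lra); lra.
Qed.

(** Beyond this point [s - 1 >= exp 4], so [ps_step] gains a factor [exp (- 4)] per unit length. *)
Definition S0 := 2 + exp 4.

Lemma ps_decay s : ps s <= exp (4 * (S0 - s)).
Proof.
suff H n x : x <= S0 + INR n -> ps x <= exp (4 * (S0 - x)).
  by apply: (H (BinInt.Z.to_nat (up s))); have := up_le s; have := exp_pos 4; rewrite /S0; lra.
elim: n x => [|n IH] x hx.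
  apply: Rle_trans (_ : 1 <= _).
    have [h|h] := Rle_lt_dec x 2; first by rewrite ps_2; lra.
    by rewrite -(@ps_2 2); [apply: ps_decr; lra|lra].
  by have := exp_ineq1_le (4 * (S0 - x)); rewrite /= in hx; lra.
have [h|h] := Rle_lt_dec x (S0 + INR n); first exact: IH.
have e0 := exp_pos 4; have n0 := pos_INR n.
have x2 : 2 <= x by rewrite /S0 in h; lra.
have := ps_step x2; have := IH (x - 1) ltac:(rewrite S_INR in hx; lra).
rewrite (_ : 4 * (S0 - (x - 1)) = 4 + 4 * (S0 - x)) ?exp_plus; last ring.
have := ps_pos x; have : exp 4 <= x - 1 by rewrite /S0 in h; lra.
move=> h1 h2 h3 h4.
apply: (Rmult_le_reg_l (exp 4)) => //; apply: Rle_trans h3.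
apply: Rle_trans h4; apply: Rmult_le_compat_r; lra.
Qed.

Definition Om s := ph s / s.
Definition Ps s := ps s / s.

Lemma Om_der s : 2 < s -> is_derive Om s ((Om (s - 1) - Om s) / s).
Proof.
move=> hs; have d := ph_der hs; evar_last.
  apply: is_derive_div; [exact: d|exact: is_derive_id|rewrite /=; lra].
by rewrite /Om /minus /plus /opp /scal /= /mult /one /=; field; lra.
Qed.

Lemma Ps_der s : 2 < s -> is_derive Ps s (- ((Ps (s - 1) + Ps s) / s)).
Proof.
move=> hs; have d := ps_der hs; evar_last.
  apply: is_derive_div; [exact: d|exact: is_derive_id|rewrite /=; lra].
by rewrite /Ps /minus /plus /opp /scal /= /mult /one /=; field; lra.
Qed.

Lemma Om_cont s : 0 < s -> continuous Om s.
Proof.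
move=> hs; apply: continuous_mult; first exact: ph_cont.
by apply: continuous_Rinv; lra.
Qed.

Lemma Ps_cont s : 0 < s -> continuous Ps s.
Proof.
move=> hs; apply: continuous_mult; first exact: ps_cont.
by apply: continuous_Rinv; lra.
Qed.

(* Positivity of [gap] means that Om + Ps decreases and Om - Ps increases. *)
Definition gap s := Ps (s - 1) + Ps s - Rabs (Om (s - 1) - Om s).

Lemma PsOm_12 s : s <= 2 -> Ps s = / s /\ Om s = / s.
Proof. by move=> hs; rewrite /Ps /Om ps_2 // ph_2 //; split; rewrite /Rdiv Rmult_1_l. Qed.

Lemma gap_mono (sg t : R) : sg = 1 \/ sg = -1 -> (forall x, 2 < x < t -> 0 < gap x) ->
  forall x y, 1 <= x -> x <= y -> y <= t -> Ps y + sg * Om y <= Ps x + sg * Om x.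
Proof.
move=> hsg G.
have H12 x y : 1 <= x -> x <= y -> y <= 2 -> Ps y + sg * Om y <= Ps x + sg * Om x.
  move=> h1 h2 h3; have [-> ->] := PsOm_12 h3; have [-> ->] := @PsOm_12 x ltac:(lra).
  have : / y <= / x by apply: Rinv_le_contravar; lra.
  by case: hsg => ->; lra.
have H2 x y : 2 <= x -> x <= y -> y <= t -> Ps y + sg * Om y <= Ps x + sg * Om x.
  move=> h1 h2 h3.
  apply: (@decr_of_der (fun s => Ps s + sg * Om s)
     (fun s => - ((Ps (s - 1) + Ps s) / s) + sg * ((Om (s - 1) - Om s) / s))) => //.
  - move=> s hs; apply: continuous_plus; first by apply: Ps_cont; lra.
    by apply: continuous_mult; [apply: continuous_const|apply: Om_cont; lra].
  - move=> s hs; apply: is_derive_plus; first by apply: Ps_der; lra.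
    by apply: is_derive_scal; apply: Om_der; lra.
  - move=> s hs; have := G s ltac:(lra); rewrite /gap => g.
    have -> : - ((Ps (s - 1) + Ps s) / s) + sg * ((Om (s - 1) - Om s) / s) =
      - (Ps (s - 1) + Ps s - sg * (Om (s - 1) - Om s)) * / s by field; lra.
    have : 0 < / s by apply: Rinv_0_lt_compat; lra.
    have : 0 <= Ps (s - 1) + Ps s - sg * (Om (s - 1) - Om s).
      by case: hsg => ->; move: g; split_Rabs; lra.
    nra.
move=> x y h1 h2 h3; have [y2|y2] := Rle_lt_dec y 2; first exact: H12.
have [x2|x2] := Rle_lt_dec 2 x; first exact: H2.
by apply: Rle_trans (H2 2 y _ _ _) (H12 x 2 _ _ _); lra.
Qed.

(** If [gap] is positive below [t], then [Ps + Om] and [Ps - Om] do not increase on [[t - 1, t]];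
    hence [|Om (t - 1) - Om t| <= Ps (t - 1) - Ps t], which says [gap t >= 2 * Ps t > 0]. Real
    induction closes the circle. *)
Lemma gap_pos s : 2 <= s -> 2 * Ps s <= gap s.
Proof.
have main t : 2 < t -> (forall x, 2 < x < t -> 0 < gap x) -> 2 * Ps t <= gap t.
  move=> ht G; have m1 := @gap_mono 1 t ltac:(by left) G (t - 1) t ltac:(lra) ltac:(lra) ltac:(lra).
  have m2 := @gap_mono (-1) t ltac:(by right) G (t - 1) t ltac:(lra) ltac:(lra) ltac:(lra).
  by rewrite /gap; split_Rabs; lra.
have Pp x : 0 < x -> 0 < Ps x by move=> x0; apply: Rdiv_lt_0_compat => //; apply: ps_pos.
have G2 : gap 2 = 1.
  rewrite /gap; have [-> ->] := @PsOm_12 2 ltac:(lra); have [-> ->] := @PsOm_12 (2 - 1) ltac:(lra).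
  have -> : / (2 - 1) = 1 by field.
  by split_Rabs; lra.
have P x : 2 <= x -> 0 < gap x.
  apply: real_induction.
  - move=> y hy; apply: continuous_minus.
      apply: continuous_plus; last by apply: Ps_cont; lra.
      apply: continuous_comp; last by apply: Ps_cont; lra.
      by apply: continuous_minus; [apply: continuous_id|apply: continuous_const].
    apply: continuous_comp; last exact: continuous_Rabs.
    apply: continuous_minus; last by apply: Om_cont; lra.
    apply: continuous_comp; last by apply: Om_cont; lra.
    by apply: continuous_minus; [apply: continuous_id|apply: continuous_const].
  - lra.
  - move=> t ht IH; have := main t ht ltac:(by move=> y hy; apply: IH; lra).
    have := Pp t ltac:(lra); lra.
case=> [hs|<-]; last by have [-> _] := @PsOm_12 2 ltac:(lra); lra.
by apply: main => // x hx; apply: P; lra.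
Qed.

Lemma mono_pm (sg x y : R) : sg = 1 \/ sg = -1 -> 1 <= x -> x <= y ->
  Ps y + sg * Om y <= Ps x + sg * Om x.
Proof.
move=> hsg h1 h2; apply: (@gap_mono sg y) => //; try lra.
move=> t ht; have := @gap_pos t ltac:(lra).
have : 0 < Ps t by apply: Rdiv_lt_0_compat; [apply: ps_pos|lra].
lra.
Qed.

(* The closed forms hold up to 3; below 2 they extend the functions past the range of the delay equation,
   and [nFF], [nff] are minus the derivative of [FF] and the derivative of [ff]. *)
Definition FF s := if Rle_dec s 3 then 2 / s else Om s + Ps s.
Definition ff s := if Rle_dec s 2 then 2 * ln (s - 1) / s else Om s - Ps s.
Definition nFF s := if Rle_dec s 3 then 2 / s ^ 2 else (FF s - ff (s - 1)) / s.
Definition nff s := (FF (s - 1) - ff s) / s.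

(** On [[2, 3]] the delayed values are 1, so [ph] and [ps] have the opposite derivatives
    [1 / (s - 1)] and [- 1 / (s - 1)]. *)
Lemma ph_ps_23 s : 1 <= s <= 3 -> ph s + ps s = 2 /\ (2 <= s -> ph s - ps s = 2 * ln (s - 1)).
Proof.
move=> hs; have [h|h] := Rle_lt_dec s 2.
  rewrite ph_2 // ps_2 //; split; first lra.
  move=> h2. have -> : s - 1 = 1 by lra.
  rewrite ln_1; lra.
have d x : 2 < x < s -> is_derive ph x (1 / (x - 1)) /\ is_derive ps x (- (1 / (x - 1))).
  move=> hx; have e1 := @ph_2 (x - 1) ltac:(lra); have e2 := @ps_2 (x - 1) ltac:(lra).
  by have := ph_der (proj1 hx); have := ps_der (proj1 hx); rewrite e1 e2; split.
split.
  have E : ph s + ps s = ph 2 + ps 2.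
    apply: (@const_of_der (fun x => ph x + ps x)); first lra.
    - by move=> x _; apply: continuous_plus; [apply: ph_cont|apply: ps_cont].
    - move=> x hx; have [d1 d2] := d x hx; evar_last; first by apply: is_derive_plus; [exact: d1|exact: d2].
      by rewrite /plus /=; ring.
  by rewrite E (@ph_2 2) ?(@ps_2 2); lra.
move=> _.
have E : ph s - ps s - 2 * ln (s - 1) = ph 2 - ps 2 - 2 * ln (2 - 1).
  have dl x : 2 <= x -> is_derive (fun x => 2 * ln (x - 1)) x (2 / (x - 1)).
    by move=> hx; auto_derive; [lra|field; lra].
  apply: (@const_of_der (fun x => ph x - ps x - 2 * ln (x - 1))); first lra.
  - move=> x hx; apply: continuous_minus; last by apply: ex_derive_continuous; eexists; apply: dl; lra.
    by apply: continuous_minus; [apply: ph_cont|apply: ps_cont].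
  - move=> x hx; have [d1 d2] := d x hx; evar_last.
      apply: is_derive_minus; last by apply: dl; lra.
      by apply: is_derive_minus; [exact: d1|exact: d2].
    by rewrite /minus /plus /opp /=; field; lra.
have p2 := @ph_2 2 ltac:(lra); have q2 := @ps_2 2 ltac:(lra); rewrite p2 q2 in E.
have e1 : 2 - 1 = 1 by ring.
by rewrite e1 ln_1 in E; lra.
Qed.

Lemma FF_small s : s <= 3 -> FF s = 2 / s.
Proof. by rewrite /FF; case: Rle_dec. Qed.

Lemma FF_eq s : 1 <= s -> FF s = Om s + Ps s.
Proof.
move=> hs; rewrite /FF; case: Rle_dec => h //=.
have [<- _] := @ph_ps_23 s ltac:(lra); rewrite /Om /Ps; field; lra.
Qed.

Lemma ff_eq s : 2 <= s -> ff s = Om s - Ps s.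
Proof.
move=> hs; rewrite /ff; case: Rle_dec => h //=.
have -> : s = 2 by lra.
rewrite /Om /Ps (@ph_2 2) ?(@ps_2 2); try lra.
have -> : 2 - 1 = 1 by ring.
rewrite ln_1; lra.
Qed.

Lemma ff_small s : 1 < s <= 3 -> ff s = 2 * ln (s - 1) / s.
Proof.
move=> hs; rewrite /ff; case: Rle_dec => h //=.
have [_ E] := @ph_ps_23 s ltac:(lra); rewrite -E; last lra.
by rewrite /Om /Ps; field; lra.
Qed.

Lemma loc_lt a s : s < a -> locally s (fun x => x < a).
Proof.
move=> h; have e0 : 0 < a - s by lra.
exists (mkposreal _ e0) => x; rewrite /ball /= /AbsRing_ball /abs /minus /plus /opp /=.
by split_Rabs; lra.
Qed.

Lemma loc_gt a s : a < s -> locally s (fun x => a < x).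
Proof.
move=> h; have e0 : 0 < s - a by lra.
exists (mkposreal _ e0) => x; rewrite /ball /= /AbsRing_ball /abs /minus /plus /opp /=.
by split_Rabs; lra.
Qed.

Lemma OP_12 s : s <= 2 -> Om s - Ps s = 0.
Proof. by move=> hs; have [-> ->] := PsOm_12 hs; ring. Qed.

Lemma nFF_eq s : 2 < s -> nFF s = (FF s - (Om (s - 1) - Ps (s - 1))) / s.
Proof.
move=> hs; rewrite /nFF; case: Rle_dec => h /=.
  by rewrite OP_12; [rewrite FF_small //; field|]; lra.
by rewrite ff_eq //; lra.
Qed.

Lemma FF_der x : 1 / 2 <= x -> is_derive FF x (- nFF x).
Proof.
move=> hx; have [h|h] := Rlt_le_dec x 3.
  apply: (is_derive_ext_loc (fun x => 2 / x)).
    by apply: filter_imp (loc_lt h) => y hy; rewrite FF_small; lra.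
  rewrite /nFF; case: Rle_dec => h2 /=; last lra.
  by auto_derive; [lra|field; lra].
apply: (is_derive_ext_loc (fun x => Om x + Ps x)).
  have L := @loc_gt 1 x ltac:(lra); by apply: filter_imp L => y hy; rewrite FF_eq; lra.
evar_last; first by apply: is_derive_plus; [apply: Om_der; lra|apply: Ps_der; lra].
by rewrite nFF_eq ?FF_eq /plus /=; [field|..]; lra.
Qed.

Lemma ff_der x : 3 / 2 <= x -> is_derive ff x (nff x).
Proof.
move=> hx; have [h|h] := Rlt_le_dec x 3.
  apply: (is_derive_ext_loc (fun x => 2 * ln (x - 1) / x)).
    have L := @loc_gt 1 x ltac:(lra); apply: filter_imp (filter_and _ _ (loc_lt h) L) => y hy.
    by rewrite ff_small; lra.
  rewrite /nff FF_small ?ff_small; try lra.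
  by auto_derive; [split; [lra|split; [lra|done]]|rewrite /Rminus; field; lra].
apply: (is_derive_ext_loc (fun x => Om x - Ps x)).
  have L := @loc_gt 2 x ltac:(lra); by apply: filter_imp L => y hy; rewrite ff_eq; lra.
evar_last; first by apply: is_derive_minus; [apply: Om_der; lra|apply: Ps_der; lra].
by rewrite /nff FF_eq ?ff_eq /minus /plus /opp /=; [field|..]; lra.
Qed.

Lemma Ps_pos x : 0 < x -> 0 < Ps x.
Proof. by move=> x0; apply: Rdiv_lt_0_compat => //; apply: ps_pos. Qed.

Lemma gap_abs s : 2 <= s -> 2 * Ps s + Rabs (Om (s - 1) - Om s) <= Ps (s - 1) + Ps s.
Proof. by move=> /gap_pos; rewrite /gap; lra. Qed.

Lemma nFF_bounds s : 2 < s -> 2 * Ps s / s <= nFF s /\ nFF s <= 2 * (Ps (s - 1) + Ps s) / s.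
Proof.
move=> hs; rewrite nFF_eq // FF_eq; last lra.
have G := @gap_abs s ltac:(lra); have P := @Ps_pos s ltac:(lra).
have is0 : 0 < / s by apply: Rinv_0_lt_compat; lra.
by split; apply: Rmult_le_compat_r; move: G; split_Rabs; lra.
Qed.

Lemma nff_bounds s : 2 <= s -> 2 * Ps s / s <= nff s /\ nff s <= 2 * (Ps (s - 1) + Ps s) / s.
Proof.
move=> hs; rewrite /nff FF_eq ?ff_eq; try lra.
have G := @gap_abs s ltac:(lra); have P := @Ps_pos s ltac:(lra).
have is0 : 0 < / s by apply: Rinv_0_lt_compat; lra.
by split; apply: Rmult_le_compat_r; move: G; split_Rabs; lra.
Qed.

Lemma nff_small s : 3 / 2 <= s <= 2 -> 0 <= nff s /\ nff s <= 12.
Proof.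
move=> hs; rewrite /nff FF_small ?ff_small; try lra.
have l0 : ln (s - 1) <= 0 by rewrite -ln_1; apply: ln_le_mono; lra.
have l1 : -1 <= ln (s - 1).
  have : ln (/ (s - 1)) <= / (s - 1) - 1 by apply: ln_le_sub1; apply: Rinv_0_lt_compat; lra.
  rewrite ln_Rinv; last lra.
  have : / (s - 1) <= / (1 / 2) by apply: Rinv_le_contravar; lra.
  lra.
have i1 : 0 < / s by apply: Rinv_0_lt_compat; lra.
have i2 : / s <= / (3 / 2) by apply: Rinv_le_contravar; lra.
have i3 : 0 < / (s - 1) by apply: Rinv_0_lt_compat; lra.
have i4 : / (s - 1) <= / (1 / 2) by apply: Rinv_le_contravar; lra.
have b0 : 0 <= 2 / (s - 1) - 2 * ln (s - 1) / s by rewrite /Rdiv; nra.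
have b1 : 2 / (s - 1) - 2 * ln (s - 1) / s <= 6 by rewrite /Rdiv; nra.
by split; [apply: Rmult_le_pos; lra|rewrite /Rdiv in b0 b1 *; nra].
Qed.

Definition K1 := 4 * exp (4 * (S0 + 1)).

Lemma Ps_bound s : 2 <= s -> 2 * (Ps (s - 1) + Ps s) / s <= K1 * exp (- 4 * s).
Proof.
move=> hs.
have d1 := ps_decay (s - 1); have d2 := @ps_decr (s - 1) s ltac:(lra).
have p1 := ps_pos (s - 1); have p2 := ps_pos s.
have Pl x : 1 <= x -> Ps x <= ps x.
  move=> hx; rewrite /Ps; apply/Rle_div_l; first lra.
  by have := ps_pos x; nra.
have h1 := Pl (s - 1) ltac:(lra); have h2 := Pl s ltac:(lra).
have -> : K1 * exp (- 4 * s) = 4 * exp (4 * (S0 - (s - 1))).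
  by rewrite /K1 Rmult_assoc -exp_plus; congr (_ * exp _); ring.
apply/Rle_div_l; first lra.
by have := exp_pos (4 * (S0 - (s - 1))); nra.
Qed.

Definition K2 := K1 + 12 * exp 9.

Lemma K1_pos : 0 < K1. Proof. by apply: Rmult_lt_0_compat; [lra|apply: exp_pos]. Qed.

Lemma exp9_le x c : x <= 3 -> 0 <= c <= 12 -> c <= K2 * exp (- 3 * x).
Proof.
move=> hx hc; apply: Rle_trans (_ : 12 * (exp 9 * exp (- 3 * x)) <= _).
  rewrite -exp_plus; have := exp_ineq1_le (9 + - 3 * x); lra.
have := K1_pos; have := exp_pos (- 3 * x); rewrite /K2; nra.
Qed.

Lemma exp43 x : 0 <= x -> K1 * exp (- 4 * x) <= K2 * exp (- 3 * x).
Proof.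
move=> hx; apply: Rmult_le_compat.
- exact/Rlt_le/K1_pos.
- exact/Rlt_le/exp_pos.
- by rewrite /K2; have := exp_pos 9; lra.
- by apply: exp_le_mono; lra.
Qed.

Lemma nFF_le x : 1 / 2 <= x -> 0 <= nFF x <= K2 * exp (- 3 * x).
Proof.
move=> hx; have [h|h] := Rle_lt_dec x 3.
  rewrite /nFF; case: Rle_dec => // _ /=.
  have i1 : 0 < / x by apply: Rinv_0_lt_compat; lra.
  have i2 : / x <= / (1 / 2) by apply: Rinv_le_contravar; lra.
  have E : 2 / (x * (x * 1)) = 2 * (/ x * / x) by field; lra.
  have b : 0 <= 2 / (x * (x * 1)) <= 12 by rewrite E; nra.
  by split; [lra|apply: exp9_le].
have [b1 b2] := @nFF_bounds x ltac:(lra); have P := @Ps_pos x ltac:(lra).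
split; first by apply: Rle_trans b1; apply/Rlt_le/Rdiv_lt_0_compat; lra.
by apply: Rle_trans b2 _; apply: Rle_trans (Ps_bound _) (exp43 _); lra.
Qed.

Lemma nff_le x : 3 / 2 <= x -> 0 <= nff x <= K2 * exp (- 3 * x).
Proof.
move=> hx; have [h|h] := Rle_lt_dec x 2.
  have [b1 b2] := nff_small (conj hx h).
  by split=> //; apply: exp9_le; lra.
have [b1 b2] := @nff_bounds x ltac:(lra); have P := @Ps_pos x ltac:(lra).
split; first by apply: Rle_trans b1; apply/Rlt_le/Rdiv_lt_0_compat; lra.
by apply: Rle_trans b2 _; apply: Rle_trans (Ps_bound _) (exp43 _); lra.
Qed.

Definition K3 := K2 * (exp 3 + 2) + 32 * exp 9.

Lemma exp_shift3 x : exp (- 3 * (x - 1)) = exp 3 * exp (- 3 * x).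
Proof. by rewrite -exp_plus; congr exp; ring. Qed.

Lemma K2_pos : 0 < K2.
Proof. by have := K1_pos; have := exp_pos 9; rewrite /K2; lra. Qed.

Lemma lip_of_der (g dg : R -> R) (K a : R) : 0 <= K ->
  (forall x, a <= x -> continuous g x) ->
  forall x y, a <= x -> x <= y ->
  (forall t, x < t < y -> is_derive g t (dg t) /\ Rabs (dg t) <= K * exp (- 3 * t)) ->
  Rabs (g x - g y) <= K * exp (- 3 * x) * (y - x).
Proof.
move=> K0 C x y ax [xy|<-] H; last by rewrite !Rminus_diag Rabs_R0 Rmult_0_r; lra.
have [c [hc E]] := @mvt_open g (fun t => if Rlt_dec x t then if Rlt_dec t y then dg t else 0 else 0) x y (Rlt_le _ _ xy)
  ltac:(by move=> t ht; apply: C; lra)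
  ltac:(by move=> t [h1 h2]; case: Rlt_dec => // ?; case: Rlt_dec => // ?; apply: (H t _).1).
rewrite Rabs_minus_sym E Rabs_mult (Rabs_right (y - x)); last lra.
apply: Rmult_le_compat_r; first lra.
have k0 : 0 <= K * exp (- 3 * x) by apply: Rmult_le_pos => //; apply/Rlt_le/exp_pos.
case: Rlt_dec => h1 /=; last by rewrite Rabs_R0.
case: Rlt_dec => h2 /=; last by rewrite Rabs_R0.
have [_ b] := H c (conj h1 h2); apply: Rle_trans b _.
by apply: Rmult_le_compat_l => //; apply: exp_le_mono; lra.
Qed.

Lemma nff_lip x y : 3 / 2 <= x -> x <= y -> Rabs (nff x - nff y) <= K3 * exp (- 3 * x) * (y - x).
Proof.
have d t : 3 / 2 <= t -> is_derive nff t (- (nFF (t - 1) + 2 * nff t) / t).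
  move=> ht; have d1 := shift_der (@FF_der (t - 1) ltac:(lra)); have d2 := ff_der ht.
  evar_last.
    apply: is_derive_div; [by apply: is_derive_minus; [exact: d1|exact: d2]|exact: is_derive_id|rewrite /=; lra].
  by rewrite /nff /minus /plus /opp /scal /= /mult /one /=; field; lra.
move=> hx xy; apply: (@lip_of_der nff (fun t => - (nFF (t - 1) + 2 * nff t) / t) K3 (3 / 2)) => //.
- by have := K2_pos; have := exp_pos 9; have := exp_pos 3; rewrite /K3; nra.
- by move=> t ht; apply: ex_derive_continuous; eexists; apply: d.
move=> t ht; split; first by apply: d; lra.
have [a1 a2] := @nFF_le (t - 1) ltac:(lra); have [b1 b2] := @nff_le t ltac:(lra).
have i1 : 0 < / t <= 1.
  by split; [apply: Rinv_0_lt_compat; lra|rewrite -Rinv_1; apply: Rinv_le_contravar; lra].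
rewrite exp_shift3 in a2.
rewrite /Rdiv Rabs_mult Rabs_Ropp (Rabs_right (/ t)); last lra.
rewrite Rabs_right; last lra.
apply: Rle_trans (_ : (nFF (t - 1) + 2 * nff t) * 1 <= _); first by apply: Rmult_le_compat_l; lra.
have := exp_pos (- 3 * t); have := exp_pos 9; rewrite /K3; nra.
Qed.

Lemma nFF_lip x y : 1 / 2 <= x -> x <= y -> Rabs (nFF x - nFF y) <= K3 * exp (- 3 * x) * (y - x).
Proof.
have K0 : 0 <= K3 by have := K2_pos; have := exp_pos 9; have := exp_pos 3; rewrite /K3; nra.
have small a b : 1 / 2 <= a -> a <= b -> b <= 3 -> Rabs (nFF a - nFF b) <= K3 * exp (- 3 * a) * (b - a).
  move=> ha hab hb.
  have E t : t <= 3 -> nFF t = 2 / t ^ 2 by rewrite /nFF; case: Rle_dec.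
  rewrite !E; try lra.
  have d t : 1 / 2 <= t -> is_derive (fun t => 2 / t ^ 2) t (- 4 / t ^ 3).
    by move=> ht; auto_derive; [apply: Rgt_not_eq; nra|field; lra].
  apply: (@lip_of_der (fun t => 2 / t ^ 2) (fun t => - 4 / t ^ 3) K3 (1 / 2)) => //.
  - by move=> t ht; apply: ex_derive_continuous; eexists; apply: d.
  move=> t ht; split; first by apply: d; lra.
  have i0 : 0 < / t by apply: Rinv_0_lt_compat; lra.
  have i2 : / t <= / (1 / 2) by apply: Rinv_le_contravar; lra.
  have -> : -4 / t ^ 3 = - (4 * (/ t * / t * / t)) by field; lra.
  rewrite Rabs_Ropp Rabs_right; last by apply: Rle_ge; repeat apply: Rmult_le_pos; lra.
  have i4 : / t * / t <= 4 by nra.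
  have : 4 * (/ t * / t * / t) <= 32 by nra.
  have : 1 <= exp 9 * exp (- 3 * t) by rewrite -exp_plus; have := exp_ineq1_le (9 + - 3 * t); lra.
  have := exp_pos (- 3 * t); have := exp_pos 3; have := K2_pos; rewrite /K3 => k e3 et e9 b9.
  have : 0 <= K2 * (exp 3 + 2) * exp (- 3 * t) by apply: Rmult_le_pos; [apply: Rmult_le_pos|]; lra.
  lra.
(* The formula for [nFF] beyond 3. It is differentiable across 3 and agrees there with the closed
   form, so the estimates on the two sides can be chained at 3. *)
pose G t := (FF t - ff (t - 1)) / t.
have dG t : 5 / 2 <= t -> is_derive G t (- (nff (t - 1) + (nFF t + G t)) / t).
  move=> ht; have d1 := @FF_der t ltac:(lra); have d2 := shift_der (@ff_der (t - 1) ltac:(lra)).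
  evar_last.
    apply: is_derive_div; [by apply: is_derive_minus; [exact: d1|exact: d2]|exact: is_derive_id|rewrite /=; lra].
  by rewrite /G /minus /plus /opp /scal /= /mult /one /=; field; lra.
have EG t : 3 <= t -> nFF t = G t.
  rewrite /nFF /G; case: Rle_dec => //= h ht; have -> : t = 3 by lra.
  rewrite FF_small ?ff_small; try lra.
  have -> : 3 - 1 - 1 = 1 by ring.
  rewrite ln_1; field.
have large a b : 3 <= a -> a <= b -> Rabs (nFF a - nFF b) <= K3 * exp (- 3 * a) * (b - a).
  move=> ha hab; rewrite !EG; try lra.
  apply: (@lip_of_der G (fun t => - (nff (t - 1) + (nFF t + G t)) / t) K3 (5 / 2)) => //; try lra.
  - by move=> t ht; apply: ex_derive_continuous; eexists; apply: dG.
  move=> t ht; split; first by apply: dG; lra.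
  rewrite -EG; last lra.
  have [a1 a2] := @nff_le (t - 1) ltac:(lra); have [b1 b2] := @nFF_le t ltac:(lra).
  have i1 : 0 < / t <= 1.
    by split; [apply: Rinv_0_lt_compat; lra|rewrite -Rinv_1; apply: Rinv_le_contravar; lra].
  rewrite exp_shift3 in a2.
  rewrite /Rdiv Rabs_mult Rabs_Ropp (Rabs_right (/ t)); last lra.
  rewrite Rabs_right; last lra.
  apply: Rle_trans (_ : (nff (t - 1) + (nFF t + nFF t)) * 1 <= _); first by apply: Rmult_le_compat_l; lra.
  have := exp_pos (- 3 * t); have := exp_pos 9; rewrite /K3; nra.
move=> hx xy; have [y3|y3] := Rle_lt_dec y 3; first exact: small.
have [x3|x3] := Rle_lt_dec 3 x; first by apply: large; lra.
have h1 := @small x 3 hx ltac:(lra) ltac:(lra); have h2 := @large 3 y ltac:(lra) ltac:(lra).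
have h3 : K3 * exp (-3 * 3) * (y - 3) <= K3 * exp (- 3 * x) * (y - 3).
  apply: Rmult_le_compat_r; first lra.
  by apply: Rmult_le_compat_l => //; apply: exp_le_mono; lra.
have -> : nFF x - nFF y = (nFF x - nFF 3) + (nFF 3 - nFF y) by ring.
apply: Rle_trans (Rabs_triang _ _) _; lra.
Qed.

Lemma FF_decr x y : 1 <= x -> x <= y -> Om y + Ps y <= Om x + Ps x.
Proof. by move=> h1 h2; have := @mono_pm 1 x y ltac:(by left) h1 h2; lra. Qed.

Lemma ff_incr x y : 1 <= x -> x <= y -> Om x - Ps x <= Om y - Ps y.
Proof. by move=> h1 h2; have := @mono_pm (-1) x y ltac:(by right) h1 h2; lra. Qed.

(** The intervals from [Om x - Ps x] to [Om x + Ps x] are nested by monotonicity; the left end at 3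
    is [2 * ln 2 / 3], which makes the common point positive. *)
Lemma om_exists : exists om, 0 < om /\ forall x, 1 <= x ->
  Om x - Ps x <= om <= Om x + Ps x.
Proof.
have cross x y : 1 <= x -> 1 <= y -> Om x - Ps x <= Om y + Ps y.
  move=> hx hy; have mx := Rmax_l x y; have my := Rmax_r x y.
  have := ff_incr hx mx; have := FF_decr hy my.
  have : 0 < Ps (Rmax x y) by apply: Ps_pos; lra.
  lra.
pose E v := exists x, 1 <= x /\ v = Om x - Ps x.
have bE : bound E by exists (Om 1 + Ps 1) => v [x [hx ->]]; apply: cross; lra.
have [om [ub lub]] := completeness E bE (ex_intro _ _ (ex_intro _ 1 (conj (Rle_refl 1) (erefl _)))).
exists om; split.
  apply: Rlt_le_trans (ub (Om 3 - Ps 3) _); last by exists 3; split; lra.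
  have [_ E3] := @ph_ps_23 3 ltac:(lra).
  have -> : Om 3 - Ps 3 = (ph 3 - ps 3) / 3 by rewrite /Om /Ps; field.
  rewrite E3; last lra.
  have : 0 < ln (3 - 1) by rewrite -ln_1; apply: ln_increasing; lra.
  lra.
move=> x hx; split; first by apply: ub; exists x.
by apply: lub => v [y [hy ->]]; apply: cross.
Qed.

Theorem sieve_functions : exists (F f nF nf : R -> R) (om K k16 : R),
  [/\ 0 < om, 0 <= K & 0 < k16] /\
  [/\ forall x, 1 / 2 <= x -> is_derive F x (- nF x),
      forall x, 3 / 2 <= x -> is_derive f x (nf x),
      forall x, 1 / 2 <= x -> Rabs (nF x) <= K * exp (- 3 * x) &
      forall x, 3 / 2 <= x -> Rabs (nf x) <= K * exp (- 3 * x)] /\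
  [/\ forall x y, 1 / 2 <= x -> x <= y -> Rabs (nF x - nF y) <= K * exp (- 3 * x) * (y - x),
      forall x y, 3 / 2 <= x -> x <= y -> Rabs (nf x - nf y) <= K * exp (- 3 * x) * (y - x),
      forall x, 0 < x -> 0 <= nF x & forall x, 3 / 2 <= x -> 0 <= nf x] /\
  [/\ forall x, 14 <= x <= 18 -> k16 <= nF x, forall x, 14 <= x <= 18 -> k16 <= nf x,
      forall s, 3 <= s -> F s - s * nF s = f (s - 1) &
      forall s, 2 <= s -> f s + s * nf s = F (s - 1)] /\
  [/\ forall x, 0 < x <= 3 -> F x = 2 / x /\ nF x = 2 / x ^ 2, forall x, 0 < x -> 0 <= F x &
      forall x, 3 / 2 <= x <= 2 -> f x <= 0] /\
  [/\ forall x, 3 / 2 <= x -> Rabs (F x - om) <= K * exp (- 3 * x),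
      forall x, 3 / 2 <= x -> Rabs (f x - om) <= K * exp (- 3 * x) &
      forall x, 2 <= x <= 3 -> f x = 2 * ln (x - 1) / x].
Proof.
have [om [om0 Hom]] := om_exists.
have k16p : 0 < 2 * ps 18 / 18 ^ 2.
  by apply: Rdiv_lt_0_compat; [have := ps_pos 18|]; lra.
have k16le x : 14 <= x <= 18 -> 2 * ps 18 / 18 ^ 2 <= 2 * Ps x / x.
  move=> hx; have -> : 2 * Ps x / x = 2 * ps x / x ^ 2 by rewrite /Ps; field; lra.
  apply: Rmult_le_compat.
  - by have := ps_pos 18; lra.
  - by apply/Rlt_le/Rinv_0_lt_compat; lra.
  - by have := @ps_decr x 18 ltac:(lra); lra.
  - by apply: Rinv_le_contravar; [apply: pow_lt; lra|apply: pow_incr; lra].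
have k0 : K2 <= K3 by have := exp_pos 9; have := exp_pos 3; have := K2_pos; rewrite /K3; nra.
have k2 := K2_pos.
set K := K3 + (12 + om) * exp 9.
have KK : K3 <= K by have := exp_pos 9; rewrite /K; nra.
have sm c x : 0 <= c <= 12 + om -> x <= 3 -> c <= K * exp (- 3 * x).
  move=> hc hx; have : 1 <= exp 9 * exp (- 3 * x) by rewrite -exp_plus; have := exp_ineq1_le (9 + - 3 * x); lra.
  have := exp_pos (- 3 * x) => e0 e9; have : 0 <= K3 * exp (- 3 * x) by apply: Rmult_le_pos; lra.
  rewrite /K; nra.
have lift x c : c <= K2 * exp (- 3 * x) -> c <= K * exp (- 3 * x).
  move=> h; apply: Rle_trans h _; apply: Rmult_le_compat_r; last lra.
  exact/Rlt_le/exp_pos.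
have Pse x : 2 <= x -> 2 * Ps x <= K2 * exp (- 3 * x).
  move=> hx; apply: Rle_trans (exp43 (_ : 0 <= x)); last lra.
  have := ps_decay x; have := @ps_pos x => p d.
  have -> : K1 * exp (- 4 * x) = 4 * (exp 4 * exp (4 * (S0 - x))).
    by rewrite /K1 Rmult_assoc -!exp_plus; congr (_ * exp _); ring.
  have : Ps x <= ps x by rewrite /Ps; apply/Rle_div_l; [lra|nra].
  have := exp_ineq1_le 4; have := exp_pos (4 * (S0 - x)); nra.
exists FF, ff, nFF, nff, om, K, (2 * ps 18 / 18 ^ 2).
split; first by split => //; lra.
split.
  split; [exact: FF_der|exact: ff_der|move=> x hx|move=> x hx].
  - by have [a b] := nFF_le hx; rewrite Rabs_right; [apply: lift|lra].
  - by have [a b] := nff_le hx; rewrite Rabs_right; [apply: lift|lra].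
have lip x y : x <= y -> K3 * exp (- 3 * x) * (y - x) <= K * exp (- 3 * x) * (y - x).
  move=> xy; apply: Rmult_le_compat_r; first lra.
  by apply: Rmult_le_compat_r; [apply/Rlt_le/exp_pos|].
split.
  split.
  - by move=> x y hx xy; apply: Rle_trans (nFF_lip hx xy) (lip _ _ xy).
  - by move=> x y hx xy; apply: Rle_trans (nff_lip hx xy) (lip _ _ xy).
  - move=> x hx; have [h|h] := Rle_lt_dec (1 / 2) x; first by have [] := nFF_le h.
    rewrite /nFF; case: Rle_dec => h2 /=; last lra.
    by apply/Rlt_le/Rdiv_lt_0_compat; nra.
  - by move=> x hx; have [] := nff_le hx.
split.
  split.
  - by move=> x hx; apply: Rle_trans (k16le x hx) _; apply: (nFF_bounds _).1; lra.
  - by move=> x hx; apply: Rle_trans (k16le x hx) _; apply: (nff_bounds _).1; lra.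
  - move=> s hs; rewrite nFF_eq ?(@ff_eq (s - 1)); try lra.
    by field; lra.
  - by move=> s hs; rewrite /nff; field; lra.
split.
  split.
  - by move=> x hx; rewrite FF_small /nFF; [case: Rle_dec => h /=; [split|lra]|lra].
  - move=> x hx; have [h|h] := Rle_lt_dec x 3; first by rewrite FF_small //; apply/Rlt_le/Rdiv_lt_0_compat; lra.
    by rewrite FF_eq; [have := Hom x ltac:(lra)|]; lra.
  - move=> x hx; rewrite ff_small; last lra.
    have l0 : ln (x - 1) <= 0 by rewrite -ln_1; apply: ln_le_mono; lra.
    have ix : 0 < / x by apply: Rinv_0_lt_compat; lra.
    have := Rmult_le_pos (- ln (x - 1)) (/ x) ltac:(lra) (Rlt_le _ _ ix).
    by rewrite /Rdiv; lra.
have i32 x : 3 / 2 <= x -> 0 < / x <= 2 / 3.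
  move=> hx; split; first by apply: Rinv_0_lt_compat; lra.
  have -> : 2 / 3 = / (3 / 2) by field.
  apply: Rinv_le_contravar; lra.
split.
- move=> x hx; have [h|h] := Rle_lt_dec x 2.
    apply: sm; last lra.
    split; first exact: Rabs_pos.
    by rewrite FF_small /Rdiv; [have := i32 x hx; split_Rabs; lra|lra].
  apply: lift; apply: Rle_trans (Pse x _); last lra.
  by rewrite FF_eq; [have := Hom x ltac:(lra); have := @Ps_pos x ltac:(lra); split_Rabs; lra|lra].
- move=> x hx; have [h|h] := Rle_lt_dec x 2.
    apply: sm; last lra.
    split; first exact: Rabs_pos.
    rewrite ff_small; last lra.
    have l0 : ln (x - 1) <= 0 by rewrite -ln_1; apply: ln_le_mono; lra.
    have l1 : -1 <= ln (x - 1).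
      have : ln (/ (x - 1)) <= / (x - 1) - 1 by apply: ln_le_sub1; apply: Rinv_0_lt_compat; lra.
      rewrite ln_Rinv; last lra.
      have : / (x - 1) <= / (1 / 2) by apply: Rinv_le_contravar; lra.
      lra.
    have b : - 2 <= 2 * ln (x - 1) / x <= 0 by rewrite /Rdiv; have := i32 x hx; nra.
    by split_Rabs; lra.
  apply: lift; apply: Rle_trans (Pse x _); last lra.
  by rewrite ff_eq; [have := Hom x ltac:(lra); have := @Ps_pos x ltac:(lra); split_Rabs; lra|lra].
- by move=> x hx; rewrite ff_small; lra.
Qed.

(** * Chebyshev and Mertens estimates *)

Definition Ln (k : nat) : R := ln (INR k).

Lemma INR_ge (a k : nat) : (a <= k)%N -> INR a <= INR k.
Proof. by move=> h; apply: le_INR; lia. Qed.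

Lemma INR_ge1 k : (1 <= k)%N -> 1 <= INR k.
Proof. by move=> /INR_ge. Qed.

Lemma INR_ge2 k : (2 <= k)%N -> 2 <= INR k.
Proof. by move=> h; rewrite (_ : 2 = INR 2) //; apply: INR_ge. Qed.

Lemma Ln_0 : Ln 0 = 0.
Proof. by rewrite /Ln /ln /=; destruct (Rlt_dec 0 0) as [h|h]; [case: (Rlt_irrefl 0)|]. Qed.

Lemma Ln_ge0 k : 0 <= Ln k.
Proof.
case: k => [|k]; first by rewrite Ln_0; lra.
by rewrite /Ln -ln_1; apply: ln_le_mono; [lra|apply: INR_ge1].
Qed.

Lemma Ln_le a b : (1 <= a)%N -> (a <= b)%N -> Ln a <= Ln b.
Proof. by move=> h1 h2; apply: ln_le_mono; [have := INR_ge1 h1; lra|apply: INR_ge]. Qed.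

Lemma LnM a b : (1 <= a)%N -> (1 <= b)%N -> Ln (a * b) = Ln a + Ln b.
Proof. by move=> /INR_ge1 ha /INR_ge1 hb; rewrite /Ln mult_INR ln_mult //; lra. Qed.

Lemma Ln_S k : (1 <= k)%N -> / INR k.+1 <= Ln k.+1 - Ln k <= / INR k.
Proof.
move=> h; have k1 := INR_ge1 h; have kS := S_INR k.
have E : Ln k.+1 - Ln k = ln (INR k.+1 / INR k) by rewrite /Ln ln_div; lra.
have E2 : Ln k.+1 - Ln k = - ln (INR k / INR k.+1) by rewrite /Ln ln_div; lra.
split.
  have := @ln_le_sub1 (INR k / INR k.+1) ltac:(apply: Rdiv_lt_0_compat; lra).

  by have : INR k / INR k.+1 = 1 - / INR k.+1; [rewrite kS; field; lra|lra].
rewrite E; have := @ln_le_sub1 (INR k.+1 / INR k) ltac:(apply: Rdiv_lt_0_compat; lra).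
by have : INR k.+1 / INR k = 1 + / INR k; [rewrite kS; field; lra|lra].
Qed.

(* Bounds [sum_(k >= w) (ln k + 1)^2 / (k (k - 1))]. *)
Definition log_tail (k : nat) : R := (Ln k ^ 2 + 4 * Ln k + 8) / (INR k - 1).

Lemma log_tail_step k : (2 <= k)%N ->
  (Ln k ^ 2 + 2 * Ln k + 3) / (INR k * (INR k - 1)) <= log_tail k - log_tail k.+1.
Proof.
move=> h; have k2 := INR_ge2 h; have [l1 l2] := @Ln_S k ltac:(lia); have l0 := Ln_ge0 k.
set d := Ln k.+1 - Ln k in l1 l2; rewrite /log_tail.
have -> : Ln k.+1 = Ln k + d by rewrite /d; ring.
have -> : INR k.+1 - 1 = INR k by rewrite S_INR; ring.
have d0 : 0 <= d by apply: Rle_trans l1; apply/Rlt_le/Rinv_0_lt_compat; rewrite S_INR; lra.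
have dk : (INR k - 1) * d <= 1.
  apply: Rle_trans (_ : INR k * / INR k <= 1); last by rewrite Rinv_r; lra.
  by apply: Rmult_le_compat; lra.
have d1 : d <= 1 by nra.
have -> : (Ln k ^ 2 + 4 * Ln k + 8) / (INR k - 1) - ((Ln k + d) ^ 2 + 4 * (Ln k + d) + 8) / INR k
  = ((Ln k ^ 2 + 4 * Ln k + 8) - (INR k - 1) * d * (2 * Ln k + d + 4)) / (INR k * (INR k - 1)).
  by field; lra.
apply: Rmult_le_compat_r; first by apply/Rlt_le/Rinv_0_lt_compat; nra.
have : (INR k - 1) * d * (2 * Ln k + d + 4) <= 1 * (2 * Ln k + d + 4) by apply: Rmult_le_compat_r; lra.
lra.
Qed.

Lemma log_tail_ge0 k : (2 <= k)%N -> 0 <= log_tail k.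
Proof.
move=> h; have k2 := INR_ge2 h; have l0 := Ln_ge0 k.
by apply: Rmult_le_pos; [nra|apply/Rlt_le/Rinv_0_lt_compat; lra].
Qed.

Lemma log_tail_psum (f : nat -> R) (C : R) w z : (2 <= w)%N -> (w <= z)%N -> 0 <= C ->
  (forall p, (w <= p)%N -> prime p ->
     f p <= C * ((Ln p ^ 2 + 2 * Ln p + 3) / (INR p * (INR p - 1)))) ->
  psum f z - psum f w <= C * log_tail w.
Proof.
move=> w2 wz C0 H.
apply: Rle_trans (_ : - C * log_tail z - (- C * log_tail w) <= _); last first.
  by have := @log_tail_ge0 z ltac:(lia); nra.
apply: (@psum_tele_le _ (fun k => - C * log_tail k)) => // p hp pr.
  by apply: Rle_trans (H p _ pr) _; [lia|have := @log_tail_step p ltac:(lia); nra].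
have := @log_tail_step p ltac:(lia); have l0 := Ln_ge0 p; have p2 := @INR_ge2 p ltac:(lia).
have : 0 <= (Ln p ^ 2 + 2 * Ln p + 3) / (INR p * (INR p - 1)).
  by apply: Rmult_le_pos; [nra|apply/Rlt_le/Rinv_0_lt_compat; nra].
nra.
Qed.

Lemma psum2 f : psum f 2 = 0. Proof. by rewrite /=; lra. Qed.

Lemma psum_0 f n : (forall p, prime p -> f p = 0) -> psum f n = 0.
Proof. by move=> H; elim: n => //= n ->; case: ifP => [/H ->|_]; ring. Qed.

Lemma psum_mono (f : nat -> R) w z : (w <= z)%N -> (forall p, prime p -> 0 <= f p) -> psum f w <= psum f z.
Proof. by move=> wz H; have := @psum_nonneg f w z wz ltac:(by move=> *; apply: H); lra. Qed.

Lemma psum_abs (f g : nat -> R) w z : (w <= z)%N ->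
  (forall p, (w <= p < z)%N -> prime p -> Rabs (f p) <= g p) ->
  Rabs (psum f z - psum f w) <= psum g z - psum g w.
Proof.
move=> wz H; rewrite (_ : _ - _ = psum f z - psum f w - (0 - 0)); last ring.
by apply: (@psum_diff_abs_le f (fun=> 0)) => // p hp pr; rewrite Rminus_diag Rminus_0_r; apply: H.
Qed.

Lemma log_tail_le k : (2 <= k)%N -> log_tail k <= 10 ^ 5 / Ln k ^ 2.
Proof.
move=> h; have k2 := INR_ge2 h; have l0 : 0 < Ln k by rewrite /Ln -ln_1; apply: ln_increasing; lra.
have := @exp_ge_pow 4 (Ln k) isT (Rlt_le _ _ l0); have := @exp_ge_pow 3 (Ln k) isT (Rlt_le _ _ l0).
have := @exp_ge_pow 2 (Ln k) isT (Rlt_le _ _ l0).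
rewrite {2 4 6}/Ln exp_ln; last lra.
have i4 : INR 4 = 4 by rewrite /=; ring.
have i3 : INR 3 = 3 by rewrite /=; ring.
have i2 : INR 2 = 2 by rewrite /=; ring.
rewrite i4 i3 i2 => e2 e3 e4; have p0 : 0 < Ln k ^ 2 by nra.
apply/(Rle_div_r _ _ _ p0).
rewrite /log_tail (_ : _ / _ * _ = (Ln k ^ 4 + 4 * Ln k ^ 3 + 8 * Ln k ^ 2) / (INR k - 1)); last by field; lra.
apply/Rle_div_l; first lra.
nra.
Qed.

(** Any two of the intervals [[u w - e w, u w + e w]] meet, so the supremum of the left ends lies in
    all of them. *)
Lemma nested_limit (u e : nat -> R) (N : nat) :
  (forall w z, (N <= w)%N -> (w <= z)%N -> Rabs (u z - u w) <= e w) ->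
  exists l, forall w, (N <= w)%N -> Rabs (u w - l) <= e w.
Proof.
move=> H; have e0 w : (N <= w)%N -> 0 <= e w.
  by move=> h; apply: Rle_trans (Rabs_pos _) (H w w h (leqnn w)).
have X w z : (N <= w)%N -> (N <= z)%N -> u w - e w <= u z + e z.
  move=> hw hz; have := e0 w hw; have := e0 z hz; have [wz|zw] := leqP w z.
    by have := H w z hw wz; split_Rabs; lra.
  by have := H z w hz (ltnW zw); split_Rabs; lra.
pose E v := exists w, (N <= w)%N /\ v = u w - e w.
have bE : bound E by exists (u N + e N) => v [w [hw ->]]; apply: X.
have [l [ub lub]] := completeness E bE (ex_intro _ _ (ex_intro _ N (conj (leqnn N) (erefl _)))).
exists l => w hw.
have : u w - e w <= l by apply: ub; exists w.
have : l <= u w + e w by apply: lub => v [z [hz ->]]; apply: X.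
by split_Rabs; lra.
Qed.

Fixpoint nat_sum (f : nat -> R) (n : nat) : R := if n is k.+1 then nat_sum f k + f k.+1 else 0.

(** Only the multiples [k = p * j] contribute, with valuation [1 + logn p j]. *)
Lemma logn_mult_rec (phi : nat -> R) p N : prime p ->
  nat_sum (fun k => INR (logn p k) * phi k) N =
  nat_sum (fun j => (1 + INR (logn p j)) * phi (p * j)%N) (N %/ p).
Proof.
move=> pr; have p0 := prime_gt0 pr.
elim: N => [|N IH]; first by rewrite div0n.
rewrite /= IH {IH}; have [dv|ndv] := boolP (p %| N.+1).
  have [q E] := dvdnP dv; case: q E => [|q] E //.
  have -> : (N %/ p = q)%N.
    have -> : N = (q * p + p.-1)%N by lia.
    by rewrite divnMDl // divn_small ?addn0 //; lia.
  rewrite E mulnK //= (mulnC p) lognM // (_ : logn p p = 1%N) ?pfactorK //; last by rewrite -(@pfactorK p 1 pr) expn1.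
  by rewrite plus_INR /=; ring.
have -> : (N.+1 %/ p = N %/ p)%N.
  have := divn_eq N p; have := ltn_pmod N p0; have := divn_eq N.+1 p; have := ltn_pmod N.+1 p0.
  have : N.+1 %% p <> 0%N by move=> e; move: ndv; rewrite /dvdn e.
  move: (N %% p)%N (N.+1 %% p)%N (N %/ p)%N (N.+1 %/ p)%N; nia.
have -> : logn p N.+1 = 0%N by rewrite lognE pr (negbTE ndv) andbF.
by rewrite /=; ring.
Qed.

Lemma Ln_logn k n : (1 <= k)%N -> (k < n)%N -> Ln k = psum (fun p => Ln p * INR (logn p k)) n.
Proof.
elim/ltn_ind: k => k IH k1 kn; case: (leqP k 1) => [k1'|k2].
  have -> : k = 1%N by lia.
  rewrite psum_0; first by rewrite /Ln /= ln_1.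
  by move=> p _; rewrite logn1 /=; ring.
have pr := pdiv_prime k2; set q := pdiv k in pr.
have [m E] := dvdnP (pdiv_dvd k); rewrite -/q in E.
have q2 := prime_gt1 pr; have m1 : (1 <= m)%N by case: m E => //; lia.
have mk : (m < k)%N by rewrite E; nia.
have qn : (q < n)%N by apply: leq_ltn_trans kn; rewrite E; nia.
rewrite {1}E LnM; try lia.
rewrite (IH m mk m1 (ltn_trans mk kn)).
have D : forall j, (q < j)%N -> psum (fun p => Ln p * (if p == q then 1 else 0)) j = Ln q.
  have D0 : forall j, (j <= q)%N -> psum (fun p => Ln p * (if p == q then 1 else 0)) j = 0.
    by elim=> //= j IHj hj; rewrite IHj ?(ltnW hj) // (_ : (j == q) = false) ?Rmult_0_r; [case: prime; ring|lia].
  elim=> //= j IHj hj; have [e|ne] := eqVneq j q; first by rewrite e pr D0 //; ring.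
  by rewrite IHj; [case: prime; ring|lia].
rewrite -{1}(D n qn) Rplus_comm -psum_plus; apply: psum_ext => p _ pp.
rewrite E lognM //; last by lia.
by rewrite (logn_prime _ pr) plus_INR; case: (p == q) => /=; ring.
Qed.

Lemma log_sum_swap (phi : nat -> R) N n : (N < n)%N ->
  nat_sum (fun k => Ln k * phi k) N = psum (fun p => Ln p * nat_sum (fun k => INR (logn p k) * phi k) N) n.
Proof.
elim: N => [|N IH] hn /=.
  by rewrite psum_0 // => p _; ring.
rewrite IH ?(ltnW hn) // (@Ln_logn N.+1 n) // Rmult_comm -psum_scal -psum_plus.
by apply: psum_ext => p _ _; ring.
Qed.

Lemma INRM2 m : INR (2 * m)%N = 2 * INR m.
Proof. by rewrite mult_INR. Qed.

Definition theta n := psum Ln n.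

(** Every prime in [(m, 2 m]] divides the central binomial coefficient, which is at most [4 ^ m]. *)
Lemma theta_bin m : theta (2 * m).+1 - theta m.+1 <= 2 * INR m.
Proof.
have b0 : (0 < 'C(2 * m, m))%N by rewrite bin_gt0; lia.
have bu : ('C(2 * m, m) <= 2 ^ (2 * m))%N.
  rewrite -[2%N]/(1 + 1)%N expnDn.
  have h : (m < (2 * m).+1)%N by lia.
  by rewrite (bigD1 (Ordinal h)) //= !exp1n !muln1; apply: leq_addr.
have E := @Ln_logn _ ('C(2 * m, m) + 2 * m).+1 b0 ltac:(lia).
have lb : Ln 'C(2 * m, m) <= 2 * INR m.
  apply: Rle_trans (_ : Ln (2 ^ (2 * m)) <= _); first exact: Ln_le.
  have -> : INR m = INR (2 * m) / 2 by rewrite mult_INR (_ : INR 2 = 2) //; field.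
  elim: (2 * m)%N => [|k IH]; first by rewrite /Ln expn0 /= ln_1; lra.
  rewrite expnS LnM ?expn_gt0 // S_INR.
  have : Ln 2 <= 1 by rewrite /Ln (_ : INR 2 = 2) //; have := @ln_le_sub1 2 ltac:(lra); lra.
  lra.
apply: Rle_trans lb; rewrite E.
have F p : 0 <= Ln p * INR (logn p 'C(2 * m, m)) by apply: Rmult_le_pos; [apply: Ln_ge0|apply: pos_INR].
apply: Rle_trans (_ : psum (fun p => Ln p * INR (logn p 'C(2 * m, m))) (2 * m).+1
   - psum (fun p => Ln p * INR (logn p 'C(2 * m, m))) m.+1 <= _).
  apply: psum_le; first lia.
  move=> p hp pr; rewrite -[X in X <= _]Rmult_1_r; apply: Rmult_le_compat_l; first exact: Ln_ge0.
  apply: INR_ge1; rewrite logn_gt0 mem_primes pr b0 /=.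
  have := bin_fact (_ : (m <= 2 * m)%N); rewrite (_ : (2 * m - m = m)%N); last lia.
  move=> /(_ ltac:(lia)) Ef.
  have : p %| (2 * m)`! by apply: dvdn_fact; lia.
  rewrite -Ef !Euclid_dvdM // => /orP[//|].
  have nd : ~~ (p %| m`!).
    have mp : (m < p)%N by lia.
    elim: (m) mp => [|k IH] hk.
    - by rewrite fact0 dvdn1; have := prime_gt1 pr; lia.
    - by rewrite factS Euclid_dvdM // negb_or IH ?(ltnW hk) // andbT; apply/negP => /dvdn_leq; lia.
  by rewrite (negbTE nd).
have := @psum_mono _ (2 * m).+1 ('C(2 * m, m) + 2 * m).+1 ltac:(lia) (fun p _ => F p).
have := @psum_mono _ 0 m.+1 ltac:(lia) (fun p _ => F p); rewrite /=; lra.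
Qed.

Lemma theta_le n : theta n.+1 <= 4 * INR n.
Proof.
elim/ltn_ind: n => n IH.
have st k : theta k.+2 <= theta k.+1 + INR k.+1.
  have : Ln k.+1 <= INR k.+1.
    have k1 := @INR_ge1 k.+1 isT.
    by have := @ln_le_sub1 (INR k.+1) ltac:(lra); rewrite /Ln; lra.
  have -> : theta k.+2 = theta k.+1 + (if prime k.+1 then Ln k.+1 else 0) by [].
  by case: prime; have := pos_INR k.+1; lra.
case: n IH => [|n] IH; first by rewrite /theta /=; lra.
have := odd_double_half n.+1; set m := (n.+1)./2; rewrite -mul2n => Em.
have mn : (m < n.+1)%N by case: (odd _) Em => /=; lia.
have H := theta_bin m; have Hm := IH m mn.
case: (odd n.+1) Em => Em; last first.
  have -> : n.+1 = (2 * m)%N by lia.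
  by rewrite INRM2; have := pos_INR m; lra.
have -> : n.+1 = (2 * m).+1 by lia.
have := st (2 * m)%N; rewrite S_INR INRM2.
move: H Hm; case: (m) => [|k] H Hm; first by rewrite /theta /=; lra.
by have := @INR_ge1 k.+1 isT; lra.
Qed.

Lemma nat_sum_ext f g n : (forall k, f k = g k) -> nat_sum f n = nat_sum g n.
Proof. by move=> H; elim: n => //= n ->; rewrite H. Qed.

Lemma nat_sum_plus f g n : nat_sum (fun k => f k + g k) n = nat_sum f n + nat_sum g n.
Proof. by elim: n => [|n IH] /=; [ring|rewrite IH; ring]. Qed.

Lemma nat_sum_scal c f n : nat_sum (fun k => c * f k) n = c * nat_sum f n.
Proof. by elim: n => [|n IH] /=; [ring|rewrite IH; ring]. Qed.

Lemma nat_sum_one n : nat_sum (fun=> 1) n = INR n.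
Proof. by elim: n => [//|n IH]; rewrite S_INR -IH. Qed.

Lemma Ln2_ge : / 2 <= Ln 2.
Proof. by have [] := @Ln_S 1 isT; rewrite /Ln (_ : INR 2 = 2) // (_ : INR 1 = 1) // ln_1; lra. Qed.

Lemma Ln_prime p : prime p -> 2 <= INR p /\ / 2 <= Ln p.
Proof.
move=> /prime_gt1 h; split; first exact: INR_ge2.
by have := @Ln_le 2 p isT h; have := Ln2_ge; lra.
Qed.

Lemma divn_R N p : prime p -> INR p * INR (N %/ p) <= INR N < INR p * (INR (N %/ p) + 1).
Proof.
move=> pr; have p0 := prime_gt0 pr; have := divn_eq N p; have := ltn_pmod N p0.
set M := (N %/ p)%N => h1 h2; rewrite -S_INR -!mult_INR; split.
  by apply: INR_ge; lia.
by apply: lt_INR; lia.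
Qed.

Lemma div_facts N p : prime p -> (p <= N)%N -> let M := (N %/ p)%N in
  [/\ (1 <= M)%N, (M < N)%N, Ln M + Ln p <= Ln N <= Ln M + Ln p + / INR M & / INR M <= 2 * INR p / INR N].
Proof.
move=> pr pN M; have [p2 lp] := Ln_prime pr; have [d1 d2] := divn_R N pr; rewrite -/M in d1 d2.
have M1 : (1 <= M)%N by rewrite /M divn_gt0 // prime_gt0.
have m1 := INR_ge1 M1; have n1 : 1 <= INR N by nra.
have p0 := prime_gt0 pr; split=> //.
- by rewrite /M; apply: ltn_Pdiv; [apply: prime_gt1|lia].
- split.
    rewrite -LnM //; apply: Ln_le; last exact: leq_divM.
    by rewrite muln_gt0 M1 prime_gt0.
  have [_ h] := Ln_S M1.
  have : Ln N <= Ln (p * M.+1).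
    by apply: ln_le_mono; [lra|rewrite mult_INR S_INR; lra].
  by rewrite LnM //; lra.
- apply: (Rmult_le_reg_r (INR M * INR N)); first by apply: Rmult_lt_0_compat; lra.
  have -> : / INR M * (INR M * INR N) = INR N by field; lra.
  by have -> : 2 * INR p / INR N * (INR M * INR N) = 2 * INR p * INR M by [field; lra]; nra.
Qed.

(** The exponent of [p] in the factorial of [N], written with weight 1 to match [log_sum_swap]. *)
Definition val_fact p N := nat_sum (fun k => INR (logn p k) * 1) N.

Lemma val_fact_rec p N : prime p -> val_fact p N = INR (N %/ p) + val_fact p (N %/ p).
Proof.
move=> pr; rewrite /val_fact (logn_mult_rec (fun=> 1)) //.
rewrite (@nat_sum_ext _ (fun j => 1 + INR (logn p j) * 1)); last by move=> k; ring.
by rewrite nat_sum_plus nat_sum_one.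
Qed.

Lemma val_fact_ge0 p N : 0 <= val_fact p N.
Proof. by rewrite /val_fact; elim: N => [|N IH] /=; [lra|have := pos_INR (logn p N.+1); lra]. Qed.

Lemma val_fact_bounds p N : prime p -> INR N / INR p - 1 <= val_fact p N <= INR N / (INR p - 1).
Proof.
move=> pr; have [p2 _] := Ln_prime pr; split.
  rewrite val_fact_rec //; have [d1 d2] := divn_R N pr; have := val_fact_ge0 p (N %/ p).
  have : INR N / INR p <= INR (N %/ p) + 1 by apply/Rle_div_l; lra.
  lra.
elim/ltn_ind: N => N IH; case: (leqP p N) => pN.
  have [_ MN _ _] := div_facts pr pN; rewrite val_fact_rec //.
  have [d1 d2] := divn_R N pr; have := IH _ MN.
  set M := INR (N %/ p) in d1 d2 * => h.
  apply: Rle_trans (_ : M + M / (INR p - 1) <= _); first lra.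
  have -> : M + M / (INR p - 1) = (INR p * M) / (INR p - 1) by field; lra.
  by apply: Rmult_le_compat_r => //; apply/Rlt_le/Rinv_0_lt_compat; lra.
rewrite val_fact_rec // divn_small // /val_fact /=.
have : 0 <= INR N / (INR p - 1).
  by apply: Rmult_le_pos; [apply: pos_INR|apply/Rlt_le/Rinv_0_lt_compat; lra].
lra.
Qed.

Lemma lnfact_bounds N : (1 <= N)%N ->
  INR N * Ln N - INR N <= nat_sum (fun k => Ln k * 1) N <= INR N * Ln N.
Proof.
elim: N => // N IH _; case: N IH => [|N] IH.
  by rewrite /= /Ln /= ln_1; lra.
have {IH} := IH isT; set m := N.+1; rewrite -[nat_sum _ m.+1]/(nat_sum _ m + Ln m.+1 * 1).
have [d1 d2] := @Ln_S m isT; have m1 := @INR_ge1 m isT; rewrite (S_INR m) => IH.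
have : INR m * (Ln m.+1 - Ln m) <= INR m * / INR m by apply: Rmult_le_compat_l; lra.
have : 0 <= INR m * (Ln m.+1 - Ln m).
  by apply: Rmult_le_pos; [lra|apply: Rle_trans d1; apply/Rlt_le/Rinv_0_lt_compat; rewrite S_INR; lra].
rewrite Rinv_r; lra.
Qed.

Definition mertens_sum n := psum (fun p => Ln p / INR p) n.
Definition mertens_sum2 n := psum (fun p => Ln p ^ 2 / INR p) n.

Lemma psum_le0 f g n : (forall p, prime p -> (p < n)%N -> f p <= g p) -> psum f n <= psum g n.
Proof. by move=> H; have := @psum_le f g 0 n isT ltac:(by move=> p hp pr; apply: H); rewrite /=; lra. Qed.

Lemma psum_abs0 f g n : (forall p, prime p -> (p < n)%N -> Rabs (f p) <= g p) -> Rabs (psum f n) <= psum g n.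
Proof.
move=> H; have := @psum_abs f g 0 n isT ltac:(by move=> p hp pr; apply: H).
by rewrite /= !Rminus_0_r.
Qed.

Lemma log_tail_psum0 f C n : 0 <= C ->
  (forall p, prime p -> f p <= C * ((Ln p ^ 2 + 2 * Ln p + 3) / (INR p * (INR p - 1)))) ->
  psum f n <= C * log_tail 2.
Proof.
move=> C0 H; have t2 := @log_tail_ge0 2 isT.
case: n => [|[|n]]; try by rewrite /=; nra.
by have := @log_tail_psum f C 2 n.+2 isT isT C0 (fun p _ pr => H p pr); rewrite psum2; lra.
Qed.

(** The logarithm of the factorial of [N] is computed directly and over its prime factors. Rounding
    [N / p] down costs at most [theta N.+1], which Chebyshev's bound controls. *)
Lemma mertens1 : exists CA, 0 <= CA /\ forall N, (1 <= N)%N -> Rabs (mertens_sum N.+1 - Ln N) <= CA.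
Proof.
exists (10 + log_tail 2); split; first by have := @log_tail_ge0 2 isT; lra.
move=> N N1; have n1 := INR_ge1 N1; have [f1 f2] := lnfact_bounds N1; have t2 := @log_tail_ge0 2 isT.
have S := log_sum_swap (fun=> 1) (ltnSn N).
have U : psum (fun p => Ln p * val_fact p N) N.+1 <= INR N * mertens_sum N.+1 + INR N * log_tail 2.
  have := @psum_le0 (fun p => Ln p * val_fact p N)
    (fun p => INR N * (Ln p / INR p) + INR N * (Ln p / (INR p * (INR p - 1)))) N.+1.
  rewrite !psum_plus !psum_scal => H.
  apply: Rle_trans (_ : INR N * mertens_sum N.+1 + INR N * psum (fun p => Ln p / (INR p * (INR p - 1))) N.+1 <= _).
    apply: H => p pr _; have [p2 lp] := Ln_prime pr; have [_ h] := val_fact_bounds N pr.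
    have -> : INR N * (Ln p / INR p) + INR N * (Ln p / (INR p * (INR p - 1))) = Ln p * (INR N / (INR p - 1)) by field; lra.
    by apply: Rmult_le_compat_l; lra.
  apply: Rplus_le_compat_l; apply: Rmult_le_compat_l; first lra.
  rewrite -(Rmult_1_l (log_tail 2)); apply: log_tail_psum0; first lra.
  move=> p pr; have [p2 lp] := Ln_prime pr; rewrite Rmult_1_l.
  by apply: Rmult_le_compat_r; [apply/Rlt_le/Rinv_0_lt_compat|]; nra.
have L : INR N * mertens_sum N.+1 - theta N.+1 <= psum (fun p => Ln p * val_fact p N) N.+1.
  have := @psum_le0 (fun p => INR N * (Ln p / INR p) + (-1) * Ln p) (fun p => Ln p * val_fact p N) N.+1.
  rewrite !psum_plus !psum_scal /mertens_sum /theta => H.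
  suff : INR N * psum (fun p => Ln p / INR p) N.+1 + -1 * psum Ln N.+1
    <= psum (fun p => Ln p * val_fact p N) N.+1 by lra.
  apply: H => p pr _; have [p2 lp] := Ln_prime pr; have [h _] := val_fact_bounds N pr.
  have -> : INR N * (Ln p / INR p) + -1 * Ln p = Ln p * (INR N / INR p - 1) by field; lra.
  by apply: Rmult_le_compat_l; lra.
rewrite S -/(val_fact _ _) in f1 f2.
have T := theta_le N.
have : INR N * (mertens_sum N.+1 - Ln N) <= INR N * (10 + log_tail 2) by rewrite /val_fact in L; nra.
have : INR N * (- (10 + log_tail 2)) <= INR N * (mertens_sum N.+1 - Ln N) by rewrite /val_fact in U; nra.
move=> /Rmult_le_reg_l h1 /Rmult_le_reg_l h2.
by have := h1 ltac:(lra); have := h2 ltac:(lra); split_Rabs; lra.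
Qed.

Definition harmonic M := nat_sum (fun j => / INR j) M.

Lemma harmonic_asym : exists g, forall M, (1 <= M)%N -> Rabs (harmonic M - Ln M - g) <= / INR M.
Proof.
suff H : forall w z, (1 <= w)%N -> (w <= z)%N -> Rabs (harmonic z - Ln z - (harmonic w - Ln w)) <= / INR w.
  by have [g Hg] := nested_limit H; exists g.
move=> w z w1 /subnKC <-.
suff : / INR (w + (z - w))%N - / INR w <= harmonic (w + (z - w)) - Ln (w + (z - w)) - (harmonic w - Ln w) <= 0.
  have : 0 < / INR (w + (z - w))%N by apply: Rinv_0_lt_compat; have := @INR_ge1 (w + (z - w)) ltac:(lia); lra.
  by split_Rabs; lra.
elim: (z - w)%N => [|d IH]; first by rewrite addn0; lra.
rewrite addnS; have [h1 h2] := @Ln_S (w + d) ltac:(lia).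
have -> : harmonic (w + d).+1 = harmonic (w + d) + / INR (w + d).+1 by [].
by move: h1 h2 IH; lra.
Qed.

Definition val_harmonic p N := nat_sum (fun k => INR (logn p k) * / INR k) N.

Lemma val_harmonic_rec p N : prime p -> val_harmonic p N = / INR p * (harmonic (N %/ p) + val_harmonic p (N %/ p)).
Proof.
move=> pr; rewrite /val_harmonic (logn_mult_rec (fun k => / INR k)) //.
rewrite /harmonic -nat_sum_plus -nat_sum_scal; apply: nat_sum_ext => k.
by rewrite mult_INR Rinv_mult; ring.
Qed.

(** Unfolding [val_harmonic_rec] divides [N] by [p] and multiplies earlier errors by
    [1 / p <= 1 / 2], so the errors stay within a geometric series while the main terms sum to
    [ln N / (p - 1)]. *)
Lemma val_harmonic_asym : exists C, 0 <= C /\ forall p N, prime p -> (1 <= N)%N ->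
  Rabs (val_harmonic p N - Ln N / (INR p - 1)) <= C * (Ln p / INR p).
Proof.
have [g Hg] := harmonic_asym; set G := Rabs g + 1; have G0 : 0 <= G by have := Rabs_pos g; rewrite /G; lra.
exists (12 + 4 * G); split; first lra.
move=> p N pr; have [p2 lp] := Ln_prime pr; have ip : 0 < / INR p by apply: Rinv_0_lt_compat; lra.
have ip2 : / INR p <= / 2 by apply: Rinv_le_contravar; lra.
have pm : / (INR p - 1) <= 2 * / INR p.
  have -> : 2 * / INR p = / (INR p / 2) by field; lra.
  by apply: Rinv_le_contravar; lra.
have pm0 : 0 < / (INR p - 1) by apply: Rinv_0_lt_compat; lra.
elim/ltn_ind: N => N IH N1; rewrite val_harmonic_rec //; case: (leqP p N) => pN.
  have [M1 MN [l1 l2] _] := div_facts pr pN; have {IH} := IH _ MN M1.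
  have := Hg _ M1; move: M1 l1 l2; set M := (N %/ p)%N => M1 l1 l2.
  have im : / INR M <= 1 by rewrite -Rinv_1; apply: Rinv_le_contravar; [lra|apply: INR_ge1].
  set e := val_harmonic p M - _; set e1 := harmonic M - Ln M - g => He1 He.
  have -> : / INR p * (harmonic M + val_harmonic p M) - Ln N / (INR p - 1)
    = / INR p * (e1 + g + e) - (Ln N - Ln M) * / (INR p - 1).
    by rewrite /e1 /e; field; lra.
  have : Rabs (/ INR p * (e1 + g + e)) <= / INR p * (G + (12 + 4 * G) * Ln p * / 2).
    rewrite Rabs_mult (Rabs_right (/ INR p)); last lra.
    apply: Rmult_le_compat_l; first lra.
    have : (12 + 4 * G) * (Ln p / INR p) <= (12 + 4 * G) * Ln p * / 2.
      by rewrite /Rdiv -Rmult_assoc; apply: Rmult_le_compat_l => //; nra.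
    move: He1 He; rewrite /G; split_Rabs; lra.
  have : 0 <= (Ln N - Ln M) * / (INR p - 1) <= 3 * Ln p * (2 * / INR p).
    by split; [apply: Rmult_le_pos; lra|apply: Rmult_le_compat; lra].
  have : / INR p * G <= / INR p * (2 * G * Ln p) by apply: Rmult_le_compat_l; nra.
  have -> : (12 + 4 * G) * (Ln p / INR p) = (12 + 4 * G) * (Ln p * / INR p) by [].
  by split_Rabs; nra.
rewrite divn_small // /harmonic /val_harmonic /= Rplus_0_l Rmult_0_r Rminus_0_l Rabs_Ropp.
have l0 := Ln_ge0 N; have lN := Ln_le N1 (ltnW pN).
rewrite Rabs_right; last by apply: Rle_ge; apply: Rmult_le_pos; lra.
apply: Rle_trans (_ : Ln p * (2 * / INR p) <= _); first by apply: Rmult_le_compat; lra.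
by have : 0 <= Ln p * / INR p; [apply: Rmult_le_pos; lra|rewrite /Rdiv; nra].
Qed.

(** The increments of [ln ^ 2 / 2] differ from [ln k / k] by summands of the kind that [log_tail]
    sums. *)
Lemma lnk_sum N : (1 <= N)%N -> Rabs (nat_sum (fun k => Ln k * / INR k) N - Ln N ^ 2 / 2) <= log_tail 2.
Proof.
move=> N1; suff : Rabs (nat_sum (fun k => Ln k * / INR k) N - Ln N ^ 2 / 2) <= log_tail 2 - log_tail N.+1.
  by have := @log_tail_ge0 N.+1 ltac:(lia); lra.
elim: N N1 => // N IH _; case: N IH => [|N] IH.
  by rewrite /= /Ln /= ln_1 (_ : _ - _ = 0) ?Rabs_R0; [lra|field].
have {IH} := IH isT; set m := N.+1; rewrite -[nat_sum _ m.+1]/(nat_sum _ m + Ln m.+1 * / INR m.+1).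
have [d1 d2] := @Ln_S m isT; have m1 := @INR_ge1 m isT; have := @log_tail_step m.+1 isT; have l0 := Ln_ge0 m.+1.
set d := Ln m.+1 - Ln m in d1 d2; have -> : Ln m = Ln m.+1 - d by rewrite /d; ring.
set l := Ln m.+1 in l0 *; set k := INR m.+1 in d1 *.
have Ek : INR m = k - 1 by rewrite /k S_INR; ring.
rewrite Ek in d2 m1; have ik : 0 < / k by apply: Rinv_0_lt_compat; lra.
have E : / (k - 1) - / k = / (k * (k - 1)) by field; lra.
have e0 : 0 < / (k * (k - 1)) by apply: Rinv_0_lt_compat; nra.
have dd : d ^ 2 <= 2 * / (k * (k - 1)).
  have : / (k - 1) <= 2 * / k.
    have -> : 2 * / k = / (k / 2) by field; lra.
    by apply: Rinv_le_contravar; lra.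
  have -> : / (k * (k - 1)) = / k * / (k - 1) by field; lra.
  nra.
have x1 : 0 <= l * (d - / k) <= l * / (k * (k - 1)) by nra.
rewrite {2}/Rdiv => st.
have -> : forall s, s + l * / k - l ^ 2 / 2 = (s - (l - d) ^ 2 / 2) + (- (l * (d - / k)) + d ^ 2 / 2).
  by move=> s; field; lra.
have : 0 <= d ^ 2 by nra.
have : 0 <= l ^ 2 * / (k * (k - 1)) by apply: Rmult_le_pos; nra.
by split_Rabs; lra.
Qed.

Lemma C2_lim : exists C2, forall n, (2 <= n)%N ->
  Rabs (psum (fun p => Ln p / (INR p * (INR p - 1))) n - C2) <= log_tail n.
Proof.
apply: nested_limit => w z w2 wz.
have T := @log_tail_psum (fun p => Ln p / (INR p * (INR p - 1))) 1 w z w2 wz ltac:(lra).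
have F p : prime p -> 0 < / (INR p * (INR p - 1)) /\ 0 <= Ln p.
  by move=> /Ln_prime [p2 lp]; split; [apply: Rinv_0_lt_compat; nra|lra].
rewrite Rabs_right.
  rewrite Rmult_1_l in T; apply: T => p hp pr; rewrite Rmult_1_l; have [f1 f2] := F p pr.
  by apply: Rmult_le_compat_r; [lra|nra].
by apply: Rle_ge; apply: psum_nonneg => // p _ pr; have [f1 f2] := F p pr; apply: Rmult_le_pos; lra.
Qed.

(* Obtained by evaluating [sum_(k <= N) ln k / k] in two ways. *)
Lemma mertens2 : exists c C, 0 <= C /\ forall N, (1 <= N)%N ->
  Rabs (Ln N * mertens_sum N.+1 - mertens_sum2 N.+1 - Ln N ^ 2 / 2 - c * Ln N) <= C.
Proof.
have [g Hg] := harmonic_asym; have [CA [CA0 HA]] := mertens1; have [C [C0 Hh]] := val_harmonic_asym; have [C2 HC2] := C2_lim.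
have t2 := @log_tail_ge0 2 isT.
exists (- (g + C2)), (log_tail 2 + (16 + 16 + (C + 6) * log_tail 2) + Rabs g * CA + 2 * 10 ^ 5); split.
  have : 0 <= Rabs g * CA by apply: Rmult_le_pos; [apply: Rabs_pos|].
  have : 0 <= (C + 6) * log_tail 2 by apply: Rmult_le_pos; lra.
  by have := pow_lt 10 5 ltac:(lra); lra.
move=> N N1; have n1 := INR_ge1 N1; have l0 := Ln_ge0 N.
set y := fun p => (Ln N * (Ln p / INR p) + (-1) * (Ln p ^ 2 / INR p)) +
   (g * (Ln p / INR p) + Ln N * (Ln p / (INR p * (INR p - 1)))).
have S := log_sum_swap (fun k => / INR k) (ltnSn N); have LK := lnk_sum N1.
have D : Rabs (psum (fun p => Ln p * val_harmonic p N - y p) N.+1) <= 16 + 16 + (C + 6) * log_tail 2.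
  have := @psum_abs0 (fun p => Ln p * val_harmonic p N - y p)
     (fun p => 4 / INR N * Ln p + (C + 6) * (Ln p ^ 2 / (INR p * (INR p - 1)))) N.+1.
  rewrite psum_plus !psum_scal => H; apply: Rle_trans (H _) _ => {H}.
    move=> p pr hp; have [p2 lp] := Ln_prime pr; have pN : (p <= N)%N by lia.
    have [M1 MN [l1 l2] l3] := div_facts pr pN.
    rewrite val_harmonic_rec //; have := Hg _ M1; have := Hh p _ pr M1; move: M1 l1 l2 l3.
    set M := (N %/ p)%N => M1 l1 l2 l3.
    set e := val_harmonic p M - _; set e1 := harmonic M - Ln M - g => He He1.
    have im : / INR M <= 1 by rewrite -Rinv_1; apply: Rinv_le_contravar; [lra|apply: INR_ge1].
    have ipp : 0 < / (INR p * (INR p - 1)) by apply: Rinv_0_lt_compat; nra.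
    have ip : 0 < / INR p by apply: Rinv_0_lt_compat; lra.
    set t := Ln N - Ln M - Ln p.
    have -> : Ln p * (/ INR p * (harmonic M + val_harmonic p M)) - y p =
      Ln p * (/ INR p * (e1 - t)) + (Ln p * (/ INR p * e) - Ln p * (/ (INR p * (INR p - 1)) * (t + Ln p))).
      by rewrite /y /e /e1 /t; field; lra.
    have b1 : Rabs (/ INR p * (e1 - t)) <= 4 / INR N.
      rewrite Rabs_mult Rabs_right; last lra.
      apply: Rle_trans (_ : / INR p * (2 * (2 * INR p / INR N)) <= _); last by right; field; lra.
      by apply: Rmult_le_compat_l; [lra|move: He1; rewrite /t; split_Rabs; lra].
    have b2 : Rabs (/ INR p * e) <= C * (Ln p * / (INR p * (INR p - 1))).
      rewrite Rabs_mult Rabs_right; last lra.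
      apply: Rle_trans (_ : / INR p * (C * (Ln p / INR p)) <= _); first by apply: Rmult_le_compat_l; lra.
      have -> : / INR p * (C * (Ln p / INR p)) = C * (Ln p * (/ (INR p * INR p))) by field; lra.
      apply: Rmult_le_compat_l => //; apply: Rmult_le_compat_l; first lra.
      by apply: Rinv_le_contravar; nra.
    have b3 : 0 <= / (INR p * (INR p - 1)) * (t + Ln p) <= / (INR p * (INR p - 1)) * (3 * Ln p).
      by split; [apply: Rmult_le_pos|apply: Rmult_le_compat_l]; rewrite /t; lra.
    have -> : 4 / INR N * Ln p + (C + 6) * (Ln p ^ 2 / (INR p * (INR p - 1))) =
      Ln p * (4 / INR N + (C * (Ln p * / (INR p * (INR p - 1))) + 2 * (/ (INR p * (INR p - 1)) * (3 * Ln p)))).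
      by field; lra.
    have -> : Ln p * (/ INR p * (e1 - t)) + (Ln p * (/ INR p * e) - Ln p * (/ (INR p * (INR p - 1)) * (t + Ln p)))
      = Ln p * (/ INR p * (e1 - t) + (/ INR p * e - / (INR p * (INR p - 1)) * (t + Ln p))) by ring.
    rewrite Rabs_mult (Rabs_right (Ln p)); last lra.
    by apply: Rmult_le_compat_l; [lra|move: b1 b2 b3; split_Rabs; lra].
  have T := theta_le N; rewrite -/(theta N.+1).
  have : 4 / INR N * theta N.+1 <= 16.
    apply: Rle_trans (_ : 4 / INR N * (4 * INR N) <= _); last by right; field; lra.
    by apply: Rmult_le_compat_l => //; apply: Rmult_le_pos; [lra|apply/Rlt_le/Rinv_0_lt_compat; lra].
  have : psum (fun p => Ln p ^ 2 / (INR p * (INR p - 1))) N.+1 <= log_tail 2.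
    rewrite -(Rmult_1_l (log_tail 2)); apply: log_tail_psum0; first lra.
    move=> p pr; have [p2 lp] := Ln_prime pr; rewrite Rmult_1_l.
    by apply: Rmult_le_compat_r; [apply/Rlt_le/Rinv_0_lt_compat|]; nra.
  move=> h1 h2; have : (C + 6) * psum (fun p => Ln p ^ 2 / (INR p * (INR p - 1))) N.+1 <= (C + 6) * log_tail 2.
    by apply: Rmult_le_compat_l; lra.
  lra.
rewrite (@psum_ext _ (fun p => Ln p * val_harmonic p N + (-1) * y p)) in D; last by move=> *; ring.
rewrite psum_plus psum_scal /y !psum_plus !psum_scal -/(mertens_sum _) -/(mertens_sum2 _) in D.
rewrite S -/(val_harmonic _ _) in LK.
have HA1 := HA N N1; have HC := HC2 N.+1 ltac:(lia).
move: D LK HC; rewrite /val_harmonic; set X := psum _ N.+1; set Q := psum _ N.+1 => D LK HC.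
have b4 : Rabs (Ln N * (Q - C2)) <= 2 * 10 ^ 5.
  have lS : / 2 <= Ln N.+1 by have := @Ln_le 2 N.+1 isT ltac:(lia); have := Ln2_ge; lra.
  have lNS := @Ln_le N N.+1 N1 (leqnSn N).
  rewrite Rabs_mult Rabs_right; last lra.
  apply: Rle_trans (_ : Ln N.+1 * (10 ^ 5 / Ln N.+1 ^ 2) <= _).
    apply: Rmult_le_compat => //; first exact: Rabs_pos.
    by apply: Rle_trans HC _; apply: log_tail_le; lia.
  have -> : Ln N.+1 * (10 ^ 5 / Ln N.+1 ^ 2) = 10 ^ 5 * / Ln N.+1 by field; lra.
  rewrite (Rmult_comm 2); apply: Rmult_le_compat_l; first by apply: pow_le; lra.
  by have -> : 2 = / / 2 by [field]; apply: Rinv_le_contravar; lra.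
have b5 : Rabs (g * (mertens_sum N.+1 - Ln N)) <= Rabs g * CA.
  by rewrite Rabs_mult; apply: Rmult_le_compat_l => //; apply: Rabs_pos.
have -> : Ln N * mertens_sum N.+1 - mertens_sum2 N.+1 - Ln N ^ 2 / 2 - - (g + C2) * Ln N =
   - (X + -1 * (Ln N * mertens_sum N.+1 + -1 * mertens_sum2 N.+1 + (g * mertens_sum N.+1 + Ln N * Q)))
   + (X - Ln N ^ 2 / 2) - g * (mertens_sum N.+1 - Ln N) - Ln N * (Q - C2) by ring.
move: D LK b4 b5; split_Rabs; lra.
Qed.

(* The summands are only O(ln p / p), so boundedness expresses cancellation; it makes the sifting density
   inverse to a logarithm with relative error O(1 / ln^2). *)
Lemma key_sum : exists c C, 0 <= C /\ forall n, (2 <= n)%N ->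
  Rabs (psum (fun p => Ln p / INR p * (mertens_sum p - c - Ln p)) n) <= C.
Proof.
have [c [C [C0 H]]] := mertens2; have [CA [CA0 HA]] := mertens1; have t2 := @log_tail_ge0 2 isT.
exists c, (CA ^ 2 + log_tail 2 + Rabs c * CA + C); split.
  by have : 0 <= Rabs c * CA; [apply: Rmult_le_pos => //; apply: Rabs_pos|nra].
case=> // N N2; have N1 : (1 <= N)%N by lia.
(* Summing [mertens_sum] against its own increments gives half its square, up to half the sum of the
   squared increments; the latter converges. *)
have E n : psum (fun p => Ln p / INR p * mertens_sum p) n = mertens_sum n ^ 2 / 2 - psum (fun p => (Ln p / INR p) ^ 2) n / 2.
  elim: n => [|n IH]; first by rewrite /mertens_sum /=; lra.
  have -> : psum (fun p => Ln p / INR p * mertens_sum p) n.+1 =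
    psum (fun p => Ln p / INR p * mertens_sum p) n + (if prime n then Ln n / INR n * mertens_sum n else 0) by [].
  rewrite IH; have -> : mertens_sum n.+1 = mertens_sum n + (if prime n then Ln n / INR n else 0) by [].
  set q := psum _ n.
  have -> : psum (fun p => (Ln p / INR p) ^ 2) n.+1 = q + (if prime n then (Ln n / INR n) ^ 2 else 0) by [].
  by set r := Ln n / INR n; case: prime; field.
have Q : 0 <= psum (fun p => (Ln p / INR p) ^ 2) N.+1 <= log_tail 2.
  split.
    have := @psum_mono (fun p => (Ln p / INR p) ^ 2) 0 N.+1 ltac:(lia); apply => p _; exact: pow2_ge_0.
  rewrite -(Rmult_1_l (log_tail 2)); apply: log_tail_psum0; first lra.
  move=> p pr; have [p2 lp] := Ln_prime pr; rewrite Rmult_1_l.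
  have -> : (Ln p / INR p) ^ 2 = Ln p ^ 2 * / (INR p * INR p) by field; lra.
  apply: Rmult_le_compat; [nra| |nra|by apply: Rinv_le_contravar; nra].
  by apply/Rlt_le/Rinv_0_lt_compat; nra.
rewrite (@psum_ext _ (fun p => Ln p / INR p * mertens_sum p + ((- c) * (Ln p / INR p) + (-1) * (Ln p ^ 2 / INR p)))); last first.
  by move=> p _ pr; have [p2 _] := Ln_prime pr; field; lra.
rewrite !psum_plus !psum_scal E -/(mertens_sum _) -/(mertens_sum2 _).
have HN := H N N1; have AN := HA N N1.
set A := mertens_sum N.+1 in AN HN *; set l := Ln N in AN HN *; set q := psum _ _ in Q *.
have -> : A ^ 2 / 2 - q / 2 + (- c * A + -1 * mertens_sum2 N.+1) =
  (A - l) ^ 2 / 2 - q / 2 - c * (A - l) + (l * A - mertens_sum2 N.+1 - l ^ 2 / 2 - c * l) by field.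
have b1 : Rabs (c * (A - l)) <= Rabs c * CA by rewrite Rabs_mult; apply: Rmult_le_compat_l => //; apply: Rabs_pos.
have b2 : 0 <= (A - l) ^ 2 <= CA ^ 2.
  by split; [apply: pow2_ge_0|rewrite -(pow2_abs (A - l)); apply: pow_incr; split => //; apply: Rabs_pos].
by move: b1 b2 HN; split_Rabs; lra.
Qed.

(** * The sifting density *)

(** Dirichlet's test in quantitative form: bounded partial sums against a decreasing nonnegative
    weight. *)
Lemma psum_decr_weight (x Z : nat -> R) (B : R) (w z : nat) : (w <= z)%N ->
  (forall n, (w <= n)%N -> Rabs (psum x n) <= B) ->
  (forall n, (w <= n)%N -> 0 <= Z n.+1 <= Z n) ->
  Rabs (psum (fun p => x p * Z p) z - psum (fun p => x p * Z p) w) <= 2 * B * Z w.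
Proof.
move=> /subnKC <- HB HZ.
suff [H [z0 zw]] : Rabs (psum (fun p => x p * Z p) (w + (z - w)) - psum (fun p => x p * Z p) w
   - (psum x (w + (z - w)) * Z (w + (z - w))%N - psum x w * Z w)) <= B * (Z w - Z (w + (z - w))%N)
   /\ 0 <= Z (w + (z - w))%N /\ Z (w + (z - w))%N <= Z w.
  have b1 : Rabs (psum x (w + (z - w)) * Z (w + (z - w))%N) <= B * Z (w + (z - w))%N.
    by rewrite Rabs_mult (Rabs_right (Z _)); [apply: Rmult_le_compat_r => //; apply: HB; lia|lra].
  have b2 : Rabs (psum x w * Z w) <= B * Z w.
    by rewrite Rabs_mult (Rabs_right (Z w)); [apply: Rmult_le_compat_r; [lra|apply: HB]|lra].
  by move: H b1 b2; split_Rabs; lra.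
elim: (z - w)%N => [|d [IH [h0 h1]]].
  rewrite addn0 (_ : _ - _ - _ = 0) ?Rabs_R0; last ring.
  by have := HZ w (leqnn w); lra.
rewrite addnS; have [k0 k1] := HZ (w + d)%N ltac:(lia); split; last lra.
set n := (w + d)%N in IH h0 h1 k0 k1 *.
have Bn := HB n.+1 ltac:(rewrite /n; lia).
have Ex : psum x n.+1 = psum x n + (if prime n then x n else 0) by [].
have Ez : psum (fun p => x p * Z p) n.+1 = psum (fun p => x p * Z p) n + (if prime n then x n * Z n else 0) by [].
have : Rabs (psum x n.+1 * (Z n - Z n.+1)) <= B * (Z n - Z n.+1).
  by rewrite Rabs_mult (Rabs_right (Z n - Z n.+1)); [apply: Rmult_le_compat_r; lra|lra].
have -> : psum x n.+1 * (Z n - Z n.+1) = psum (fun p => x p * Z p) n.+1 - psum (fun p => x p * Z p) w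
  - (psum x n.+1 * Z n.+1 - psum x w * Z w) - (psum (fun p => x p * Z p) n - psum (fun p => x p * Z p) w
  - (psum x n * Z n - psum x w * Z w)).
  by rewrite Ex Ez; case: prime; ring.
move: IH; split_Rabs; lra.
Qed.

Lemma ln_1p_bounds y : 0 <= y -> y - y ^ 2 <= ln (1 + y) <= y.
Proof.
move=> y0; split; last by have := @ln_le_sub1 (1 + y) ltac:(lra); lra.
have := @ln_le_sub1 (/ (1 + y)) ltac:(apply: Rinv_0_lt_compat; lra); rewrite ln_Rinv; last lra.
have : / (1 + y) <= 1 - y + y ^ 2.
  apply: (Rmult_le_reg_r (1 + y)); first lra.
  by rewrite Rinv_l; nra.
lra.
Qed.

Lemma ln_1m_bounds x : 0 <= x <= / 2 -> x <= - ln (1 - x) <= x + 2 * x ^ 2.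
Proof.
move=> hx; split; first by have := @ln_le_sub1 (1 - x) ltac:(lra); lra.
rewrite -ln_Rinv; last lra.
have := @ln_le_sub1 (/ (1 - x)) ltac:(apply: Rinv_0_lt_compat; lra).
have : / (1 - x) <= 1 + x + 2 * x ^ 2.
  apply: (Rmult_le_reg_r (1 - x)); first lra.
  by rewrite Rinv_l; nra.
lra.
Qed.

Lemma exp_close t : Rabs t <= / 2 -> Rabs (exp t - 1) <= 2 * Rabs t.
Proof.
move=> h; have := exp_ineq1_le t; have := exp_ineq1_le (- t); rewrite exp_Ropp => h1 h2.
have : exp t * (1 - t) <= 1.
  apply: Rle_trans (_ : exp t * / exp t <= 1); last by rewrite Rinv_r; [lra|apply/Rgt_not_eq/exp_pos].
  by apply: Rmult_le_compat_l; [apply/Rlt_le/exp_pos|lra].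
by have := exp_pos t; move: h; split_Rabs; nra.
Qed.

Lemma Vprod_pos s : all prime s -> 0 < Vprod s.
Proof.
elim: s => [|p s IH] /=; first by lra.
move=> /andP[/prime_INR p2 /IH h]; apply: Rmult_lt_0_compat => //.
have : / INR p <= / 2 by apply: Rinv_le_contravar; lra.
lra.
Qed.

Lemma nat_ge_exists (x : R) : exists n, (2 <= n)%N /\ forall m, (n <= m)%N -> x <= Ln m.
Proof.
exists (BinInt.Z.to_nat (up (exp x))).+2; split=> // m hm.
rewrite -(ln_exp x); apply: ln_le_mono; first exact: exp_pos.
apply: Rle_trans (up_le _) _; apply: INR_ge; lia.
Qed.

Section Tau.
Variables (c CK CA : R).
Hypothesis CK0 : 0 <= CK.
Hypothesis key : forall n, (2 <= n)%N -> Rabs (psum (fun p => Ln p / INR p * (mertens_sum p - c - Ln p)) n) <= CK.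
Hypothesis CA0 : 0 <= CA.
Hypothesis mertens_ln : forall N, (1 <= N)%N -> Rabs (mertens_sum N.+1 - Ln N) <= CA.

(** An approximation to [ln n] that, like the sifting density, moves only at primes; with this [c]
    the sums of [key] are bounded. *)
Let Ah n := mertens_sum n - c.
Let B1 := CA + 1 + Rabs c.

Lemma B1_pos : 1 <= B1. Proof. by have := Rabs_pos c; rewrite /B1; lra. Qed.

Lemma Ah_ln n : (2 <= n)%N -> Rabs (Ah n - Ln n) <= B1.
Proof.
case: n => // N h; have N1 : (1 <= N)%N by lia.
have [h1 h2] := Ln_S N1; have n1 := INR_ge1 N1.
have : / INR N <= 1 by rewrite -Rinv_1; apply: Rinv_le_contravar; lra.
have : 0 < / INR N.+1 by apply: Rinv_0_lt_compat; rewrite S_INR; lra.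
have := mertens_ln N1; rewrite /Ah /B1; split_Rabs; lra.
Qed.

Let CD := 4 * CK + 2 * 10 ^ 5.

Lemma CD_pos : 1 <= CD. Proof. by rewrite /CD; lra. Qed.

Section N0.
Variable N0 : nat.
Hypothesis N02 : (2 <= N0)%N.
Hypothesis N0L : forall m, (N0 <= m)%N -> 2 * B1 + 10 + 2 * CD <= Ln m.

Lemma Ah_facts n : (N0 <= n)%N -> Ln n / 2 <= Ah n <= 2 * Ln n.
Proof.
by move=> h; have := N0L h; have := @Ah_ln n ltac:(lia); have := B1_pos; have := CD_pos; split_Rabs; lra.
Qed.

Lemma Ah_S n : Ah n.+1 = Ah n + (if prime n then Ln n / INR n else 0).
Proof. by rewrite /Ah -[mertens_sum n.+1]/(mertens_sum n + (if prime n then Ln n / INR n else 0)); ring. Qed.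

(** [exp (- D n)] is the sifting density times [Ah n], whose limit becomes [kap]. *)
Let D n := - ln (Vprod (plist n)) - ln (Ah n).
Let Z n := / (Ln n * Ah n).

Lemma Z_decr n : (N0 <= n)%N -> 0 <= Z n.+1 <= Z n.
Proof.
move=> h; have := N0L h; have [a1 a2] := Ah_facts h; have b1 := B1_pos; have cd := CD_pos.
have l := @Ln_le n n.+1 ltac:(lia) ltac:(lia) => L.
have aS : Ah n <= Ah n.+1.
  rewrite Ah_S; case: ifP => pr; last lra.
  have [p2 lp] := Ln_prime pr; have : 0 < Ln n / INR n by apply: Rdiv_lt_0_compat; lra.
  lra.
split; first by apply/Rlt_le/Rinv_0_lt_compat/Rmult_lt_0_compat; lra.
by apply: Rinv_le_contravar; [apply: Rmult_lt_0_compat|apply: Rmult_le_compat]; lra.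
Qed.

(** To first order [D] grows at [p] by [1 / p - ln p / (p * Ah p)], which is the summand of [key]
    times the decreasing weight [Z p]. Dirichlet's test then gives convergence at the rate
    [1 / (ln w) ^ 2]. *)
Lemma D_step p : (N0 <= p)%N -> prime p ->
  Rabs (Ln p / INR p * (Ah p - Ln p) * Z p - (D p.+1 - D p)) <= 6 / INR p ^ 2.
Proof.
move=> h pr; have := N0L h; have [a1 a2] := Ah_facts h; have b1 := B1_pos; have cd := CD_pos => L.
have [p2 lp] := Ln_prime pr; set x := / INR p; set y := Ln p / INR p / Ah p.
have x0 : 0 < x by apply: Rinv_0_lt_compat; lra.
have x2 : x <= / 2 by apply: Rinv_le_contravar; lra.
have y0 : 0 <= y by apply/Rlt_le/Rdiv_lt_0_compat; [apply: Rdiv_lt_0_compat|]; lra.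
have y2 : y <= 2 * x.
  apply/Rle_div_l; first lra.
  by rewrite /Rdiv -/x; nra.
have -> : Ln p / INR p * (Ah p - Ln p) * Z p = x - y by rewrite /x /y /Z; field; lra.
have -> : D p.+1 - D p = - ln (1 - x) - ln (1 + y).
  rewrite /D Ah_S pr /= pr /= -/x ln_mult; [|exact/Vprod_pos/plist_all|lra].
  have -> : Ah p + Ln p / INR p = Ah p * (1 + y) by rewrite /y; field; lra.
  by rewrite ln_mult; lra.
have := @ln_1m_bounds x ltac:(lra); have := ln_1p_bounds y0.
have -> : 6 / INR p ^ 2 = 6 * x ^ 2 by rewrite /x; field; lra.
by split_Rabs; nra.
Qed.

Lemma D_close w z : (N0 <= w)%N -> (w <= z)%N -> Rabs (D z - D w) <= CD / Ln w ^ 2.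
Proof.
move=> hw wz; have b1 := B1_pos; have cd := CD_pos; have L := N0L hw.
have := @psum_diff_abs_le (fun p => Ln p / INR p * (Ah p - Ln p) * Z p) D (fun p => 6 / INR p ^ 2) w z wz
  ltac:(by move=> p hp pr; apply: D_step => //; lia).
have T := @log_tail_psum (fun p => 6 / INR p ^ 2) 2 w z ltac:(lia) wz ltac:(lra).
have := @psum_decr_weight (fun p => Ln p / INR p * (Ah p - Ln p)) Z CK w z wz
  ltac:(by move=> n hn; apply: key; lia) ltac:(by move=> n hn; apply: Z_decr; lia).
move=> H1 H2.
have {}T : psum (fun p => 6 / INR p ^ 2) z - psum (fun p => 6 / INR p ^ 2) w <= 2 * log_tail w.
  apply: T => p hp pr; have [p2 lp] := Ln_prime pr.
  have -> : 6 / INR p ^ 2 = 2 * (3 * / (INR p * INR p)) by field; lra.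
  apply: Rmult_le_compat_l; first lra.
  apply: Rmult_le_compat; [lra|by apply/Rlt_le/Rinv_0_lt_compat; nra|nra|by apply: Rinv_le_contravar; nra].
have {}H2 : Rabs (psum (fun p => Ln p / INR p * (Ah p - Ln p) * Z p) z -
   psum (fun p => Ln p / INR p * (Ah p - Ln p) * Z p) w - (D z - D w)) <= 2 * log_tail w.
  apply: Rle_trans (H2 _) T => p hp np; rewrite /D Ah_S /= (negbTE np); f_equal; f_equal; ring.
have {}T := @log_tail_le w ltac:(lia).
have Zw : Z w <= 2 / Ln w ^ 2.
  have [a1 a2] := Ah_facts hw.
  have -> : 2 / Ln w ^ 2 = / (Ln w * (Ln w / 2)) by field; lra.
  by apply: Rinv_le_contravar; [apply: Rmult_lt_0_compat|apply: Rmult_le_compat_l]; lra.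
have : 2 * CK * Z w <= 2 * CK * (2 / Ln w ^ 2) by apply: Rmult_le_compat_l; lra.
have -> : CD / Ln w ^ 2 = 2 * CK * (2 / Ln w ^ 2) + 2 * (10 ^ 5 / Ln w ^ 2) by rewrite /CD; field; lra.
move: H1 H2; split_Rabs; lra.
Qed.

Variable l : R.
Hypothesis Dl : forall w, (N0 <= w)%N -> Rabs (D w - l) <= CD / Ln w ^ 2.

Let kap := exp (- l).
Let tau n := kap / Vprod (plist n).

Lemma tau_pos' n : 0 < tau n.
Proof. by apply: Rdiv_lt_0_compat; [apply: exp_pos|apply/Vprod_pos/plist_all]. Qed.

Lemma tau_S' n : tau n.+1 = if prime n then tau n / (1 - / INR n) else tau n.
Proof.
rewrite /tau /=; case: ifP => pr //=; have := Vprod_pos (plist_all n); have [p2 _] := Ln_prime pr => v.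
have : / INR n <= / 2 by apply: Rinv_le_contravar; lra.
by move=> h; field; split; [nra|lra].
Qed.

Lemma tau_Ah n : (N0 <= n)%N -> Rabs (tau n - Ah n) <= 4 * CD / Ln n.
Proof.
move=> h; have [a1 a2] := Ah_facts h; have b1 := B1_pos; have cd := CD_pos; have L := N0L h.
have E : tau n = Ah n * exp (D n - l).
  rewrite /tau /D /kap -[Vprod _](@exp_ln); last exact/Vprod_pos/plist_all.
  rewrite -[X in X * _](@exp_ln (Ah n)); last lra.
  rewrite ln_exp /Rdiv -exp_Ropp -!exp_plus; congr exp; lra.
have i0 : 0 < / Ln n by apply: Rinv_0_lt_compat; lra.
have dl := Dl h; have ds : CD / Ln n ^ 2 <= / 2.
  by apply/Rle_div_l; [apply: pow_lt; lra|nra].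
have := @exp_close (D n - l) ltac:(lra) => e.
rewrite E (_ : _ - _ = Ah n * (exp (D n - l) - 1)); last ring.
rewrite Rabs_mult Rabs_right; last lra.
apply: Rle_trans (_ : (2 * Ln n) * (2 * (CD / Ln n ^ 2)) <= _); last by right; field; lra.
by apply: Rmult_le_compat => //; [lra|apply: Rabs_pos|lra].
Qed.

Lemma tau_ln_large n : (N0 <= n)%N -> Rabs (tau n - Ln n) <= B1 + CD.
Proof.
move=> h; have := tau_Ah h; have := @Ah_ln n ltac:(lia); have L := N0L h; have b1 := B1_pos; have cd := CD_pos.
have : 4 * CD / Ln n <= CD by apply/Rle_div_l; [lra|nra].
by split_Rabs; lra.
Qed.

Lemma recip_psum_le n : psum (fun p => / INR p) n <= ln (tau n) - ln kap.
Proof.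
have v0 := Vprod_pos (plist_all n); have k0 : 0 < kap by apply: exp_pos.
rewrite /tau ln_div //.
have := ln_le_mono v0 (Vprod_le_exp (plist_all n)); rewrite ln_exp sigma_plist; lra.
Qed.

Lemma tau_conditions : exists C1 kap (tau : nat -> R), [/\ 1 <= C1, 0 < kap, forall n, 0 < tau n &
   forall n, tau n.+1 = if prime n then tau n / (1 - / INR n) else tau n] /\
  [/\ forall n, (2 <= n)%N -> Rabs (tau n - ln (INR n)) <= C1,
      forall n, Vprod (plist n) = kap / tau n &
      forall n, 1 <= tau n -> Rabs (Xi tau n) <= C1 * q4 (tau n)].
Proof.
have b1 := B1_pos; have cd := CD_pos; have k0 : 0 < kap by apply: exp_pos.
pose xa p := Rabs (tau p / INR p * (tau p - ln (INR p))).
pose C3 := 4 * CD + (B1 + CD) ^ 2.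
have xa0 : 0 <= psum xa N0 by have := @psum_mono xa 0 N0 isT (fun p _ => Rabs_pos _); rewrite /=; lra.
have C30 : 0 <= C3 by rewrite /C3; nra.
have XiE n : psum (fun p => tau p / INR p * (tau p - ln (INR p))) n = Xi tau n by [].
have small n : (n <= N0)%N -> Rabs (Xi tau n) <= psum xa N0.
  move=> h; apply: Rle_trans (_ : psum xa n <= _); last by apply: psum_mono => // p _; apply: Rabs_pos.
  by rewrite /Xi; apply: psum_abs0 => p _ _; rewrite /xa; lra.
(* Beyond [N0] the summand of [Xi] differs from that of [key] by [(ln p * (tau p - Ah p) + (tau p -
   ln p) ^ 2) / p], whose numerator is bounded. So only a multiple of the sum of [1 / p] remains,
   which is at most [ln (tau n)] up to a constant. *)
have large n : (N0 <= n)%N -> Rabs (Xi tau n) <= psum xa N0 + 2 * CK + C3 * psum (fun p => / INR p) n.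
  move=> h; have s := small N0 (leqnn N0).
  have k1 := key N02; have k2 := key (leq_trans N02 h).
  have := @psum_abs (fun p => tau p / INR p * (tau p - ln (INR p)) + (-1) * (Ln p / INR p * (mertens_sum p - c - Ln p)))
     (fun p => C3 * / INR p) N0 n h.
  rewrite !psum_plus !psum_scal !XiE => H.
  have R0 : 0 <= psum (fun p => / INR p) N0.
    have := @psum_mono (fun p => / INR p) 0 N0 isT; rewrite /=; apply=> p pr.
    by apply/Rlt_le/Rinv_0_lt_compat; have [] := Ln_prime pr; lra.
  have {}H : Rabs (Xi tau n + -1 * psum (fun p => Ln p / INR p * (mertens_sum p - c - Ln p)) n -
        (Xi tau N0 + -1 * psum (fun p => Ln p / INR p * (mertens_sum p - c - Ln p)) N0)) <= 
    C3 * psum (fun p => / INR p) n - C3 * psum (fun p => / INR p) N0.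
    apply: H => p hp pr; have [p2 lp] := Ln_prime pr; have hN : (N0 <= p)%N by lia.
    have t1 := tau_Ah hN; have t2 := tau_ln_large hN; have L := N0L hN.
    have -> : tau p / INR p * (tau p - ln (INR p)) + -1 * (Ln p / INR p * (mertens_sum p - c - Ln p))
       = (Ln p * (tau p - Ah p) + (tau p - Ln p) ^ 2) * / INR p by rewrite /Ah /Ln; field; lra.
    have ip : 0 < / INR p by apply: Rinv_0_lt_compat; lra.
    rewrite Rabs_mult (Rabs_right (/ INR p)); last lra.
    apply: Rmult_le_compat_r; first lra.
    have : Rabs (Ln p * (tau p - Ah p)) <= 4 * CD.
      rewrite Rabs_mult Rabs_right; last lra.
      apply: Rle_trans (_ : Ln p * (4 * CD / Ln p) <= _); last by right; field; lra.
      by apply: Rmult_le_compat_l; lra.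
    have : 0 <= (tau p - Ln p) ^ 2 <= (B1 + CD) ^ 2.
      by split; [apply: pow2_ge_0|rewrite -(pow2_abs (tau p - Ln p)); apply: pow_incr; split => //; apply: Rabs_pos].
    by rewrite /C3; split_Rabs; lra.
  have : 0 <= C3 * psum (fun p => / INR p) N0 by apply: Rmult_le_pos.
  move: H k1 k2 s; split_Rabs; lra.
set CX := psum xa N0 + 2 * CK + C3 * Rabs (ln kap) + 4 * C3.
exists (1 + (B1 + CD) + (tau N0 + Ln N0) + CX), kap, tau.
have tN := tau_pos' N0; have lN := Ln_ge0 N0.
have a0 : 0 <= C3 * Rabs (ln kap) by apply: Rmult_le_pos => //; apply: Rabs_pos.
have CX0 : 0 <= CX by rewrite /CX; lra.
split; first by split=> //; [lra|exact: tau_pos'|exact: tau_S'].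
split.
- move=> n n2; case: (leqP N0 n) => h; first by have := tau_ln_large h; rewrite -/(Ln n); lra.
  have := tau_pos' n; have := @tau_le tau tau_pos' tau_S' n N0 (ltnW h).
  have := Ln_ge0 n; have := @Ln_le n N0 ltac:(lia) (ltnW h).
  rewrite -/(Ln n); split_Rabs; lra.
- move=> n; have v0 := Vprod_pos (plist_all n); rewrite /tau; field; lra.
move=> n tn; have q1 : 1 <= q4 (tau n) by rewrite -(_ : q4 1 = 1); [apply: q4_le|rewrite /q4 !sqrt_1].
have : ln (tau n) <= 4 * q4 (tau n).
  rewrite -{1}(@q4_pow (tau n)); last lra.
  rewrite pow_exp_ln ?ln_exp; last lra.
  have := @ln_le_sub1 (q4 (tau n)) ltac:(lra); rewrite (_ : INR 4 = 4); last by rewrite /=; ring.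
  lra.
move=> lq; apply: Rle_trans (_ : CX * q4 (tau n) <= _); last by apply: Rmult_le_compat_r; lra.
have : Rabs (Xi tau n) <= psum xa N0 + 2 * CK + C3 * psum (fun p => / INR p) n.
  case: (leqP N0 n) => h; first exact: large.
  have := small n (ltnW h).
  have : 0 <= C3 * psum (fun p => / INR p) n.
    apply: Rmult_le_pos => //; have := @psum_mono (fun p => / INR p) 0 n isT; rewrite /=; apply=> p pr.
    by apply/Rlt_le/Rinv_0_lt_compat; have [] := Ln_prime pr; lra.
  lra.
have := recip_psum_le n => r.
have : C3 * psum (fun p => / INR p) n <= C3 * (4 * q4 (tau n) + Rabs (ln kap)).
  by apply: Rmult_le_compat_l => //; move: r lq; split_Rabs; lra.
rewrite /CX; nra.
Qed.
End N0.
End Tau.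

Theorem tau_exists : exists C1 kap (tau : nat -> R), [/\ 1 <= C1, 0 < kap, forall n, 0 < tau n &
   forall n, tau n.+1 = if prime n then tau n / (1 - / INR n) else tau n] /\
  [/\ forall n, (2 <= n)%N -> Rabs (tau n - ln (INR n)) <= C1,
      forall n, Vprod (plist n) = kap / tau n &
      forall n, 1 <= tau n -> Rabs (Xi tau n) <= C1 * q4 (tau n)].
Proof.
have [c [CK [CK0 key]]] := key_sum; have [CA [CA0 HA]] := mertens1.
have [N0 [N02 N0L]] := nat_ge_exists (2 * (CA + 1 + Rabs c) + 10 + 2 * (4 * CK + 2 * 10 ^ 5)).
have [l Hl] := nested_limit (D_close CK0 key CA0 HA N02 N0L).
exact: (tau_conditions CK0 key CA0 HA N02 N0L Hl).
Qed.

(** * Degrees: the lower bound *)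

Lemma Err_le (n : R -> R) (c L t : R) : 1 <= L -> 0 < t -> 0 <= n (L / t) <= c -> Err n L t <= c / t ^ 2 + / L ^ 2.
Proof.
move=> L1 t0 [n0 nc]; have q1 : 1 <= q4 L by rewrite -(_ : q4 1 = 1); [apply: q4_le|rewrite /q4 !sqrt_1].
have it : 0 < / t ^ 2 by apply: Rinv_0_lt_compat; apply: pow_lt.
have iq : 0 < / q4 L <= 1.
  by split; [apply: Rinv_0_lt_compat; lra|rewrite -Rinv_1; apply: Rinv_le_contravar; lra].
apply: Rplus_le_compat.
  apply: Rle_trans (_ : 1 * (n (L / t) / t ^ 2) <= _).
    by apply: Rmult_le_compat_r; [apply: Rmult_le_pos|]; lra.
  by rewrite Rmult_1_l; apply: Rmult_le_compat_r; lra.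
have E : L ^ 2 <= q4 L ^ 10.
  rewrite -{1}(@q4_pow L) -?pow_mult; last lra.
  by apply: Rle_pow; [lra|lia].
have L2 : 0 < L ^ 2 by apply: pow_lt; lra.
rewrite -(Rmult_1_l (/ L ^ 2)); apply: Rmult_le_compat.
- exact/Rlt_le/exp_pos.
- by apply/Rlt_le/Rinv_0_lt_compat; lra.
- rewrite -exp_0; apply: exp_le_mono.
  by have := Rdiv_lt_0_compat L t ltac:(lra) t0; lra.
- exact: Rinv_le_contravar.
Qed.

(** Up to [s = 3] both sieve functions are explicit. There [ln (s - 1) >= (s - 2) / 2] makes the
    lower bound linear in the distance from the sifting limit. *)
Theorem sieve_bounds : exists (a0 C1 M Cup L0 : R) (tau : nat -> R),
  [/\ 0 < a0, 1 <= C1, 1 <= M, 1 <= Cup & 1 <= L0] /\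
  (forall n, (2 <= n)%N -> Rabs (tau n - Ln n) <= C1) /\
  forall X A E z, 0 < X -> L0 <= ln X -> (2 <= z)%N -> L0 <= Ln z -> regular (pf z) X A E ->
  ln X <= 3 * tau z ->
  (2 * tau z <= ln X -> X * (a0 * ((ln X - 2 * tau z) / (tau z * ln X)) - M / tau z ^ 2) <= Sz A E z) /\
  Sz A E z <= X * (Cup / ln X).
Proof.
have [C1 [kap [tau [ [c1 k0 tp tS] [tL tV tX]]]]] := tau_exists.
have [F [f [nF [nf [om [K [k16 [ [omp K0 k160] [ [Fd fd nFl nfl] [ [nFL nfL nF0 nf0] [ [nF16 nf16 FE fE] [ [Fs F0 fn] [Flim flim f23]]]]]]]]]]]]] := sieve_functions.
have [M [M1 HM]] := linear_sieve tp tS c1 tL k0 tV tX omp K0 k160 Fd fd nFl nfl nFL nfL nF0 nf0 nF16 nf16 FE fE Fs F0 fn Flim flim.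
set L1 := Lmin _ _ _ _ _ _ in HM; have a0 : 0 < al kap om by apply: Rdiv_lt_0_compat.
exists (al kap om), C1, (M * (K + 1)), (1 + 2 * al kap om + 3 * M), (1 + Rabs L1 + T0 C1 + C1), tau.
have T : 1 <= T0 C1 by rewrite /T0; lra.
have L1p := Rle_abs L1; have L1q := Rabs_pos L1.
split; first by split; nra.
split; first exact: tL.
move=> X A E z X0 hX z2 hz reg L3; have := tL z z2; rewrite -/(Ln z) => tz.
have [||lo up] := HM X A E z X0 _ z2 _ reg; try by (move: tz; split_Rabs; lra).
set t := tau z in L3 lo up *; set L := ln X in hX L3 lo up *.
have t1 : 1 <= t by move: tz; rewrite -/t; split_Rabs; lra.
have E0 : L / t / t = L / t ^ 2 by field; lra.
split.
  move=> t2; have s2 : 2 <= L / t <= 3 by split; [apply/Rle_div_r|apply/Rle_div_l]; lra.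
  apply: Rle_trans (lo _); last lra.
  apply: Rmult_le_compat_l; first lra.
  have e3 : exp (- 3 * (L / t)) <= 1 by rewrite -exp_0; apply: exp_le_mono; lra.
  have nb : 0 <= nf (L / t) <= K.
    split; first by apply: nf0; lra.
    have := nfl (L / t) ltac:(lra); have := Rle_abs (nf (L / t)).
    have : K * exp (- 3 * (L / t)) <= K * 1 by apply: Rmult_le_compat_l.
    lra.
  have := @Err_le nf K L t ltac:(lra) ltac:(lra) nb => e.
  have H : M * Err nf L t <= M * (K + 1) / t ^ 2.
    rewrite /Rdiv Rmult_assoc; apply: Rmult_le_compat_l; first lra.
    have : / L ^ 2 <= / t ^ 2 by apply: Rinv_le_contravar; [apply: pow_lt; lra|apply: pow_incr; lra].
    by move: e; rewrite /Rdiv; lra.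
  suff : al kap om * ((L - 2 * t) / (t * L)) <= al kap om * (f (L / t) / t).
    by move=> h; apply: Rplus_le_compat => //; apply: Ropp_le_contravar.
  apply: Rmult_le_compat_l; first lra.
  rewrite f23 //.
  have lb : (L / t - 2) / 2 <= ln (L / t - 1).
    move: s2; set v := L / t => s2.
    have := @ln_le_sub1 (/ (v - 1)) ltac:(apply: Rinv_0_lt_compat; lra); rewrite ln_Rinv; last lra.
    suff : / (v - 1) <= 1 - (v - 2) / 2 by lra.
    apply: (Rmult_le_reg_r (v - 1)); first lra.
    by rewrite Rinv_l; [have := Rmult_le_pos (v - 2) (3 - v) ltac:(lra) ltac:(lra); lra|lra].
  have -> : (L - 2 * t) / (t * L) = 2 * ((L / t - 2) / 2) * / (L / t) / t by field; lra.
  apply: Rmult_le_compat_r; first by apply/Rlt_le/Rinv_0_lt_compat; lra.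
  apply: Rmult_le_compat_r; first by apply/Rlt_le/Rinv_0_lt_compat; lra.
  lra.
apply: Rle_trans up _; apply: Rmult_le_compat_l; first lra.
have s0 : 0 < L / t <= 3 by split; [apply: Rdiv_lt_0_compat|apply/Rle_div_l]; lra.
have [-> nFE] := Fs _ s0.
have iL : 0 < / L <= 1.
  by split; [apply: Rinv_0_lt_compat; lra|rewrite -Rinv_1; apply: Rinv_le_contravar; lra].
have nb : 0 <= nF (L / t) <= 2 / (L / t) ^ 2 by rewrite nFE; split; [apply/Rlt_le/Rdiv_lt_0_compat; [lra|apply: pow_lt; lra]|lra].
have := @Err_le nF (2 / (L / t) ^ 2) L t ltac:(lra) ltac:(lra) nb.
have -> : 2 / (L / t) ^ 2 / t ^ 2 + / L ^ 2 = 3 * / L * / L by field; lra.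
have -> : 2 / (L / t) / t = 2 * / L by field; lra.
move=> e; have : M * Err nF L t <= M * (3 * / L).
  apply: Rmult_le_compat_l; first lra.
  by apply: Rle_trans e _; have := Rmult_le_compat_l (/ L) (/ L) 1 ltac:(lra) ltac:(lra); lra.
move=> h.
have -> : (1 + 2 * al kap om + 3 * M) / L = / L + al kap om * (2 * / L) + M * (3 * / L) by field; lra.
by rewrite -/L -/t; lra.
Qed.

Definition in_class (rho : nat -> nat) (p j : nat) : bool := j == rho p %[mod p].

Definition dprod (s : seq nat) : nat := foldr muln 1%N s.

Lemma dprod_gt0 s : all prime s -> (0 < dprod s)%N.
Proof. by elim: s => //= p s IH /andP[/prime_gt0 p0 /IH]; rewrite muln_gt0 p0. Qed.

Lemma rprod_dprod s : rprod s = INR (dprod s).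
Proof. by elim: s => //= p s ->; rewrite mult_INR. Qed.

Lemma coprime_dprod p s : prime p -> all prime s -> p \notin s -> coprime p (dprod s).
Proof.
move=> pr; elim: s => [|q s IH] /=; first by rewrite coprimen1.
move=> /andP[qr hs]; rewrite inE negb_or => /andP[pq ps].
by rewrite coprimeMr IH // andbT prime_coprime // dvdn_prime2.
Qed.

Lemma crt_list rho s : uniq s -> all prime s ->
  exists c, forall j, all (fun p => in_class rho p j) s = (j == c %[mod dprod s]).
Proof.
elim: s => [|p s IH] /=; first by move=> _ _; exists 0%N => j; rewrite !modn1.
move=> /andP[ps us] /andP[pr hs]; have [c Hc] := IH us hs.
have cop := coprime_dprod pr hs ps.
exists (chinese p (dprod s) (rho p) c) => j.
by rewrite (chinese_remainder cop) Hc /in_class chinese_modl // chinese_modr.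
Qed.

Lemma count_modE c d m : (0 < d)%N ->
  count (fun j => j == c %[mod d]) (iota 0 m) = ((m + (d.-1 - c %% d)) %/ d)%N.
Proof.
move=> d0; have cd := ltn_pmod c d0; elim: m => [|m IH].
  by rewrite /= add0n divn_small //; lia.
rewrite -addn1 iotaD count_cat IH /= addn0 add0n addn1 addSn divnS //.
rewrite addnC; congr (nat_of_bool _ + _)%N.
rewrite -addnS.
have -> : (d.-1 - c %% d).+1 = (d - c %% d)%N by lia.
rewrite -(@eqn_modDr (d - c %% d)) -(modnDml c) subnKC ?modnn; last exact: ltnW.
by rewrite /dvdn.
Qed.

Lemma count_mod c d m : (0 < d)%N ->
  Rabs (INR (count (fun j => j == c %[mod d]) (iota 0 m)) - INR m / INR d) <= 1.
Proof.
move=> d0; rewrite count_modE //; have cd := ltn_pmod c d0.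
set q := (_ %/ d)%N; have d1 := INR_ge1 d0.
have h1 : (q * d <= m + d)%N.
  by have := leq_divM (m + (d.-1 - c %% d)) d; rewrite -/q; lia.
have h2 : (m <= q.+1 * d)%N.
  by have := ltn_ceil (m + (d.-1 - c %% d)) d0; rewrite -/q; lia.
have {}h1 : INR q * INR d <= INR m + INR d by rewrite -mult_INR -plus_INR; apply: INR_ge; lia.
have {}h2 : INR m <= (INR q + 1) * INR d by rewrite -S_INR -mult_INR; apply: INR_ge; lia.
have E : INR m / INR d * INR d = INR m by field; lra.
have u1 : INR q - 1 <= INR m / INR d by apply: (Rmult_le_reg_r (INR d)); lra.
have u2 : INR m / INR d <= INR q + 1 by apply: (Rmult_le_reg_r (INR d)); lra.
by split_Rabs; lra.
Qed.

(** By the Chinese remainder theorem the conditions from [s] amount to one class modulo the product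
    of [s], and consecutive integers meet a class within 1 of the expected number of times. *)
Lemma regular_interval P rho m : regular P (INR m) (iota 0 m) (in_class rho).
Proof.
move=> s us hs; have ap : all prime s by apply: sub_all hs => p /andP[].
have [c Hc] := crt_list rho us ap; rewrite rprod_dprod (eq_count Hc).
exact/count_mod/dprod_gt0.
Qed.

Lemma sift_loss A E (s t : seq nat) B :
  (forall p, p \in t -> INR (sift [seq i <- A | E p i] E s) <= B) ->
  INR (sift A E s) <= INR (sift A E (t ++ s)) + INR (size t) * B.
Proof.
elim: t => [|p t IH] H; first by rewrite /=; lra.
have -> : INR (size (p :: t)) = INR (size t) + 1 by rewrite -S_INR.
rewrite cat_cons sift_cons.
have {IH} := IH (fun q hq => H q (@mem_behead _ (p :: t) q hq)).
have := H p (mem_head _ _).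
have : INR (sift [seq i <- A | E p i] E (t ++ s)) <= INR (sift [seq i <- A | E p i] E s).
  by apply/INR_ge/sub_count => i; rewrite all_cat => /andP[].
lra.
Qed.

(** The product of distinct prime divisors of [a] divides [a]. *)
Lemma big_primes z a (s : seq nat) : (0 < a)%N -> uniq s -> (1 <= z)%N ->
  all (fun p => [&& prime p, p %| a & z <= p])%N s -> INR (size s) * Ln z <= Ln a.
Proof.
elim: s a => [|p s IH] a a0; first by move=> *; rewrite /= Rmult_0_l; apply: Ln_ge0.
move=> /andP[ps us] z1 /andP[/and3P[pr /dvdnP[b Eb] zp] hs].
have b0 : (0 < b)%N by case: b Eb a0 => // ->.
have : INR (size s) * Ln z <= Ln b.
  apply: IH => //; apply/allP => q qs; have /and3P[qr qa qz] := allP hs q qs.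
  rewrite qr qz andbT /=; move: qa; rewrite Eb Euclid_dvdM // => /orP[//|].
  by rewrite dvdn_prime2 // => /eqP e; rewrite -e qs in ps.
have p0 := prime_gt0 pr; have := Ln_le z1 zp.
have -> : INR (size (p :: s)) = INR (size s) + 1 by rewrite -S_INR.
by rewrite Eb LnM //; lra.
Qed.

Lemma nat_floor x : 0 <= x -> exists z, INR z <= x < INR z + 1.
Proof.
move=> x0; have [h1 h2] := archimed x.
have u1 : BinInt.Z.le (BinNums.Zpos BinNums.xH) (up x).
  by have : (IZR BinNums.Z0 < IZR (up x))%R; [lra|move=> /lt_IZR; lia].
exists (BinInt.Z.to_nat (BinInt.Z.sub (up x) 1)).
rewrite INR_IZR_INZ Znat.Z2Nat.id; last lia.
by rewrite minus_IZR; lra.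
Qed.

(* The sieve is run with all primes up to about [sqrt m]; the at most [ln n / ln sqrt m] larger prime
   factors of [a] each remove few of the survivors, by the upper bound sieve. *)
Theorem deg_bound : exists Q Lb, 1 <= Q /\ forall m n a rho, Lb <= Ln m -> (Q * Ln n) ^ 2 <= INR m ->
  (0 < a)%N -> (a <= n)%N ->
  INR m / Ln m ^ 2 <= INR (count (fun j => all (fun p => ~~ in_class rho p j) (primes a)) (iota 0 m)).
Proof.
have [a0 [C1 [M [Cup [L0 [tau [ [a00 C11 M1 Cup1 L01] [tL SB]]]]]]]] := sieve_bounds.
(* Near the sifting limit the main term [a0 * ((L - 2 * t) / (t * L))] has the order [1 / L ^ 2] of
   the error [M / t ^ 2]. With [Ln z] lowered by about [lc / 2] below [L / 2], [L - 2 * t] is at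
   least [(9 * M + 2) / (2 * a0)], which covers the error and leaves [2 / L ^ 2]. *)
pose lc := 2 * C1 + (9 * M + 2) / (2 * a0).
have lc0 : 2 <= lc.
  have : 0 < (9 * M + 2) / (2 * a0) by apply: Rdiv_lt_0_compat; lra.
  by rewrite /lc; lra.
(* At most [3 * ln n / L] prime factors of [a] are at least [z], and each removes at most
   [(4 * Cup + 1) * 2 * exp (lc / 2) / L] times the square root of [m]; [Q] brings the total below
   [m / L ^ 2]. *)
pose Q := 6 * (4 * Cup + 1) * exp (lc / 2).
have Q1 : 1 <= Q by rewrite /Q; have := exp_ineq1_le (lc / 2); nra.
exists Q, (128 + 12 * L0 + 12 * lc + 12 * C1); split=> // m n a rho hL hQ a1 an.
set L := Ln m in hL *; have M0 : 0 < INR m.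
  case: m @L hL hQ => [|m] L hL hQ; last by apply: lt_0_INR; lia.
  by move: hL; rewrite /L Ln_0; lra.
have mE : INR m = exp L by rewrite /L /Ln exp_ln.
pose x := exp ((L - lc) / 2).
have x4 : 4 <= x by have := exp_ineq1_le ((L - lc) / 2); rewrite /x; lra.
have [z [zx1 zx2]] := @nat_floor x ltac:(lra).
have z2 : (2 <= z)%N by apply/leP/INR_le; rewrite (_ : INR 2 = 2) //; lra.
have zr := INR_ge2 z2.
have lz1 : Ln z <= (L - lc) / 2 by rewrite -(ln_exp ((L - lc) / 2)) -/x; apply: ln_le_mono; lra.
have lz2 : (L - lc) / 2 - 1 <= Ln z.
  have : ln (x / 2) <= Ln z by apply: ln_le_mono; lra.
  rewrite ln_div; [|lra..]; rewrite /x ln_exp; have := @ln_le_sub1 2 ltac:(lra); lra.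
have tz := tL z z2; set t := tau z in tz.
have t3 : L <= 3 * t by move: tz; split_Rabs; lra.
have t2 : 2 * t <= L - (lc - 2 * C1) by move: tz; split_Rabs; lra.
have g0 : 0 < lc - 2 * C1 by rewrite /lc; have : 0 < (9 * M + 2) / (2 * a0); [apply: Rdiv_lt_0_compat|]; lra.
set A := iota 0 m; set E := in_class rho.
have low : 2 * (INR m / L ^ 2) <= Sz A E z.
  have [lo _] := SB (INR m) A E z M0 ltac:(rewrite -/(Ln m) -/L; lra) z2 ltac:(lra) (@regular_interval _ rho m) t3.
  move: lo; rewrite -/(Ln m) -/L -/t => /(_ ltac:(lra)); apply: Rle_trans.
  have -> : 2 * (INR m / L ^ 2) = INR m * (2 / L ^ 2) by rewrite /Rdiv; ring.
  apply: Rmult_le_compat_l; first lra.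
  have h1 : M / t ^ 2 <= 9 * M / L ^ 2.
    have -> : 9 * M / L ^ 2 = M / (L / 3) ^ 2 by field; lra.
    apply: Rmult_le_compat_l; first lra.
    by apply: Rinv_le_contravar; [apply: pow_lt; lra|apply: pow_incr; lra].
  have h2 : (9 * M + 2) / L ^ 2 <= a0 * ((L - 2 * t) / (t * L)).
    have -> : (9 * M + 2) / L ^ 2 = a0 * ((lc - 2 * C1) / ((L / 2) * L)) by rewrite /lc; field; lra.
    apply: Rmult_le_compat_l; first lra.
    apply: Rmult_le_compat; try lra.
      by apply/Rlt_le/Rinv_0_lt_compat; nra.
    by apply: Rinv_le_contravar; nra.
  have -> : 2 / L ^ 2 = (9 * M + 2) / L ^ 2 - 9 * M / L ^ 2 by field; lra.
  lra.
pose T := [seq p <- primes a | (z <= p)%N].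
pose B := (4 * Cup + 1) * (INR m / (INR z * L)).
have ex2 : exp (L / 2) * exp (L / 2) = INR m by rewrite -exp_plus mE; congr exp; field.
have mz : exp (L / 2) <= INR m / INR z.
  apply/Rle_div_r; first lra.
  rewrite -ex2; apply: Rmult_le_compat_l; first exact/Rlt_le/exp_pos.
  apply: Rle_trans zx1 _; apply: exp_le_mono; lra.
have HB p : p \in T -> INR (sift [seq i <- A | E p i] E (plist z)) <= B.
  rewrite mem_filter mem_primes => /andP[zp /and3P[pr _ _]].
  have [p2 lp] := Ln_prime pr.
  have reg : regular (pf z) (INR m / INR p) [seq i <- A | E p i] E.
    apply: (@regular_sub (fun q => predT q && (q != p))).
      by move=> q _ qz /=; rewrite neq_ltn (leq_trans qz zp).
    by apply: regular_filter => //; apply: (@regular_interval _ rho m).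
  have lnX : ln (INR m / INR p) = L - Ln p by rewrite ln_div; [|lra..].
  have X0 : 0 < INR m / INR p by apply: Rdiv_lt_0_compat; lra.
  have iz : 0 < / L by apply: Rinv_0_lt_compat; lra.
  have mpz : INR m / INR p <= INR m / INR z.
    by apply: Rmult_le_compat_l; [lra|apply: Rinv_le_contravar; [lra|apply: INR_ge]].
  have BE : B = INR m / INR z * (4 * Cup / L) + INR m / INR z * / L by rewrite /B; field; lra.
  (* Up to [p = m ^ (3 / 4)] the upper bound sieve applies, since [ln (m / p) >= L / 4]. For larger
     [p] even the trivial count [m / p + 1] is small enough. *)
  have [h|h] := Rle_lt_dec (Ln p) (3 / 4 * L).
    have [_ up] := SB _ _ _ z X0 ltac:(rewrite lnX; lra) z2 ltac:(lra) reg ltac:(rewrite lnX -/t; lra).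
    apply: Rle_trans up _; rewrite lnX.
    apply: Rle_trans (_ : INR m / INR z * (4 * Cup / L) <= _); last first.
      by rewrite BE; have := Rmult_le_pos (INR m / INR z) (/ L) ltac:(lra) ltac:(lra); lra.
    apply: Rmult_le_compat => //; try lra.
      by apply/Rlt_le/Rdiv_lt_0_compat; lra.
    have -> : 4 * Cup / L = Cup / (L / 4) by field; lra.
    by apply: Rmult_le_compat_l; [lra|apply: Rinv_le_contravar; lra].
  apply: Rle_trans (_ : INR (size [seq i <- A | E p i]) <= _); first exact/INR_ge/count_size.
  have c1 := regular_card reg.
  have c2 : INR m / INR p <= exp (L / 4).
    by rewrite -(exp_ln _ X0) lnX; apply: exp_le_mono; lra.
  have e4 : exp (L / 4) * exp (L / 4) = exp (L / 2) by rewrite -exp_plus; congr exp; field.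
  have e1 : 2 * L <= exp (L / 4).
    have := @exp_ge_pow 2 (L / 4) isT ltac:(lra); rewrite (_ : INR 2 = 2) //.
    have : 32 * (L / 4) <= (L / 4) ^ 2 by rewrite /= Rmult_1_r; apply: Rmult_le_compat_r; lra.
    lra.
  have e0 : 1 <= exp (L / 4) by lra.
  have : 2 * exp (L / 4) <= INR m / INR z * / L.
    apply: Rle_trans (_ : exp (L / 2) * / L <= _); last by apply: Rmult_le_compat_r; lra.
    have LL : 0 < L by lra.
    apply/(Rle_div_r _ _ _ LL).
    by rewrite -e4; have := Rmult_le_compat_l (exp (L / 4)) _ _ ltac:(lra) e1; lra.
  have : 0 <= INR m / INR z * (4 * Cup / L).
    by apply: Rmult_le_pos; [lra|apply/Rlt_le/Rdiv_lt_0_compat; lra].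
  by rewrite BE; move: c1; split_Rabs; lra.
have loss := sift_loss HB.
have TB : INR (size T) * B <= INR m / L ^ 2.
  have T1 : INR (size T) * Ln z <= Ln a.
    apply: big_primes => //; [by rewrite filter_uniq ?primes_uniq|lia|].
    by apply/allP => p; rewrite mem_filter mem_primes => /andP[-> /and3P[-> _ ->]].
  have T2 := Ln_le a1 an.
  have T3 : Q * Ln n <= exp (L / 2).
    have : (Q * Ln n) ^ 2 <= exp (L / 2) ^ 2 by rewrite /= Rmult_1_r (Rmult_1_r (exp _)) ex2; move: hQ; rewrite /= Rmult_1_r.
    by rewrite /= !Rmult_1_r => h; apply: Rsqr_incr_0_var; [|exact/Rlt_le/exp_pos].
  have s0 := pos_INR (size T).
  have T4 : INR (size T) <= exp (L / 2) / Q * (3 / L).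
    have T5 : INR (size T) * (L / 3) <= exp (L / 2) / Q.
      apply: Rle_trans (_ : Ln n <= _); last by apply/Rle_div_r; lra.
      by apply: Rle_trans T2; apply: Rle_trans T1; apply: Rmult_le_compat_l; lra.
    have -> : INR (size T) = INR (size T) * (L / 3) * (3 / L) by field; lra.
    by apply: Rmult_le_compat_r => //; apply/Rlt_le/Rdiv_lt_0_compat; lra.
  have B1 : B <= (4 * Cup + 1) * (2 * exp (L / 2) * exp (lc / 2) / L).
    apply: Rmult_le_compat_l; first lra.
    have -> : INR m / (INR z * L) = INR m / INR z / L by field; lra.
    apply: Rmult_le_compat_r; first by apply/Rlt_le/Rinv_0_lt_compat; lra.
    apply/Rle_div_l; first lra.
    have -> : INR m = 2 * exp (L / 2) * exp (lc / 2) * (x / 2).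
      have -> : 2 * exp (L / 2) * exp (lc / 2) * (x / 2) = exp (L / 2) * exp (lc / 2) * x by field.
      by rewrite mE /x -!exp_plus; congr exp; field.
    apply: Rmult_le_compat_l; last lra.
    by repeat apply: Rmult_le_pos; try (apply/Rlt_le/exp_pos); lra.
  have B0 : 0 <= B by apply: Rmult_le_pos; [lra|apply/Rlt_le/Rdiv_lt_0_compat; [lra|apply: Rmult_lt_0_compat; lra]].
  apply: Rle_trans (Rmult_le_compat _ _ _ _ s0 B0 T4 B1) _.
  right; rewrite -ex2 /Q; field; split; [lra|split; [exact/Rgt_not_eq/exp_pos|lra]].
apply: Rle_trans (_ : INR (sift A E (T ++ plist z)) <= _); first by have := Rle_trans _ _ _ low (Rle_trans _ _ _ loss (Rplus_le_compat_l _ _ _ TB)); lra.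
apply: INR_ge; apply: sub_count => j; rewrite all_cat => /andP[/allP h1 /allP h2].
apply/allP => p pa; case: (leqP z p) => zp; first by apply: h1; rewrite mem_filter zp.
by apply: h2; rewrite plistP zp andbT; move: pa; rewrite mem_primes => /and3P[].
Qed.

(** * Degrees: few vertices of small degree *)

Definition list_sum (f : nat -> R) (A : seq nat) : R := foldr (fun i x => f i + x) 0 A.

Lemma list_sum_le f g A : (forall i, i \in A -> f i <= g i) -> list_sum f A <= list_sum g A.
Proof.
elim: A => [|i A IH] H; first by rewrite /=; lra.
have := IH (fun j hj => H j (@mem_behead _ (i :: A) j hj)); have := H i (mem_head _ _).
by rewrite /=; lra.
Qed.

Lemma list_sum_plus f g A : list_sum (fun i => f i + g i) A = list_sum f A + list_sum g A.
Proof. by elim: A => [|i A IH] /=; [ring|rewrite IH; ring]. Qed.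

Lemma list_sum_scal c f A : list_sum (fun i => c * f i) A = c * list_sum f A.
Proof. by elim: A => [|i A IH] /=; [ring|rewrite IH; ring]. Qed.

Lemma list_sum_count (P : pred nat) A : list_sum (fun i => if P i then 1 else 0) A = INR (count P A).
Proof. by elim: A => [//|i A IH]; rewrite /= IH; case: (P i); rewrite ?add1n ?add0n ?S_INR; ring. Qed.

Lemma list_sum_filter (P : pred nat) f A : list_sum (fun i => if P i then f i else 0) A = list_sum f [seq i <- A | P i].
Proof. by elim: A => [//|i A IH]; rewrite /= IH; case: (P i) => /=; ring. Qed.

Lemma list_sum_psum (F : nat -> nat -> R) A n :
  list_sum (fun i => psum (fun p => F p i) n) A = psum (fun p => list_sum (F p) A) n.
Proof.
elim: A => [|i A IH] /=; first by rewrite psum_0.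
by rewrite IH -psum_plus.
Qed.

(* [wt E s i] is the inverse cube of the density left by the primes [p] of [s] with [E p i]. *)
Definition cw (p : nat) : R := (/ (1 - / INR p)) ^ 3.
Definition wt (E : nat -> nat -> bool) (s : seq nat) (i : nat) : R :=
  foldr (fun p x => (if E p i then cw p else 1) * x) 1 s.
Definition cprod (s : seq nat) : R := foldr (fun p x => cw p * x) 1 s.
Definition mprod (s : seq nat) : R := foldr (fun p x => (1 + (cw p - 1) / INR p) * x) 1 s.

Lemma ip_bounds p : prime p -> 0 < / INR p <= / 2.
Proof.
move=> /prime_INR p2; split; first by apply: Rinv_0_lt_compat; lra.
by apply: Rinv_le_contravar; lra.
Qed.

Lemma cw_ge1 p : prime p -> 1 <= cw p.
Proof.
move=> /ip_bounds h; rewrite /cw -(pow1 3); apply: pow_incr; split; first lra.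
by rewrite -{1}Rinv_1; apply: Rinv_le_contravar; lra.
Qed.

Lemma mprod_pos s : all prime s -> 1 <= mprod s.
Proof.
elim: s => [|p s IH] /=; [lra|move=> /andP[pr /IH h2]].
have := cw_ge1 pr; have := ip_bounds pr => h1 h3.
have : 0 <= (cw p - 1) / INR p by apply: Rmult_le_pos; lra.
nra.
Qed.

(** [wt] expands over the subsets of [s] into products of [cw p - 1]. The main terms reassemble to
    [mprod], and the remainders, at most 1 for each subset, to [cprod]. *)
Lemma moment s (P : pred nat) X A E : regular P X A E -> uniq s ->
  all (fun p => prime p && P p) s -> list_sum (wt E s) A <= X * mprod s + cprod s.
Proof.
elim: s P X A => [|p s IH] P X A reg.
  move=> _ _; have := regular_card reg.
  have -> : list_sum (wt E [::]) A = INR (size A).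
    elim: A {reg} => [//|i A IHA].
    have -> : list_sum (wt E [::]) (i :: A) = 1 + list_sum (wt E [::]) A by [].
    by rewrite IHA Rplus_comm -S_INR.
  by rewrite /=; split_Rabs; lra.
move=> /andP[ps us] /andP[/andP[pr Pp] hs].
have hs' : all (fun q => prime q && (P q && (q != p))) s.
  apply/allP => q qs; have /andP[-> ->] := allP hs q qs.
  by apply: contraNneq ps => <-.
have h1 := IH _ _ _ reg us hs; have h2 := IH _ _ _ (regular_filter pr Pp reg) us hs'.
have c1 := cw_ge1 pr.
have -> : list_sum (wt E (p :: s)) A = list_sum (wt E s) A + (cw p - 1) * list_sum (wt E s) [seq i <- A | E p i].
  rewrite -list_sum_filter -list_sum_scal -list_sum_plus; elim: A {reg h1 h2} => //= i A ->.
  by congr (_ + _); case: (E p i); ring.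
have : (cw p - 1) * list_sum (wt E s) [seq i <- A | E p i] <= (cw p - 1) * (X / INR p * mprod s + cprod s).
  by apply: Rmult_le_compat_l; lra.
have -> : X * mprod (p :: s) + cprod (p :: s) =
  X * mprod s + cprod s + (cw p - 1) * (X / INR p * mprod s + cprod s) by rewrite /= /Rdiv; ring.
lra.
Qed.

Definition odd_primes (w : nat) : seq nat := [seq p <- plist w | odd p].

Lemma odd_primesP w p : (p \in odd_primes w) = [&& odd p, prime p & (p < w)%N].
Proof. by rewrite mem_filter plistP. Qed.

Lemma odd_primes_uniq w : uniq (odd_primes w). Proof. exact/filter_uniq/plist_uniq. Qed.

Lemma odd_primes_all w : all prime (odd_primes w). Proof. by apply/allP => p; rewrite odd_primesP => /and3P[]. Qed.

Lemma odd_primes_S w : odd_primes w.+1 = if prime w && odd w then w :: odd_primes w else odd_primes w.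
Proof. by rewrite /odd_primes /=; case: (prime w) => //=. Qed.

(** [cw p] is [(p / (p - 1)) ^ 3], and the product of [k / (k - 1)] over all integers telescopes. *)
Lemma cprod_odd_primes w : (2 <= w)%N -> cprod (odd_primes w) <= (INR w - 1) ^ 3.
Proof.
elim: w => // w IH hw; case: (ltngtP w 1) => [|w2|->]; first by lia.
- have {IH} := IH w2; have r2 := INR_ge2 w2; rewrite odd_primes_S S_INR.
  have -> : INR w + 1 - 1 = INR w by ring.
  case: ifP => [/andP[pr _]|_] h.
    have -> : INR w ^ 3 = cw w * (INR w - 1) ^ 3 by rewrite /cw; field; lra.
    by rewrite /=; apply: Rmult_le_compat_l => //; have := cw_ge1 pr; lra.
  by apply: Rle_trans h _; apply: pow_incr; lra.
- have -> : odd_primes 2 = [::] by [].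
  by rewrite /cprod /= (_ : 1 + 1 - 1 = 1) ; lra.
Qed.

(* For odd [n], [odd_tail n - odd_tail n.+1] dominates the excess of the Euler factor of [mprod] at [n]. *)
Definition odd_tail (n : nat) : R := (3 / 2) / (2 * INR n./2 - 1).

(** [43 / 24] is the exact factor at 3. The later factors are dominated by a telescoping series over
    the odd numbers, which starts from [odd_tail 4 = 1 / 2]. *)
Lemma mprod_odd_primes n : (4 <= n)%N -> mprod (odd_primes n) <= 43 / 24 * exp (/ 2 - odd_tail n).
Proof.
elim: n => // n IH hn; case: (ltngtP n 3) => [|n3|->]; first by lia.
  have {IH} := IH n3; set h := n./2 => IH.
  have h2 : (2 <= h)%N by rewrite /h; lia.
  have r2 := INR_ge2 h2.
  have T1 : odd_tail n = (3 / 2) / (2 * INR h - 1) by [].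
  rewrite odd_primes_S; case: ifP => [/andP[pr od]|ne].
    have En : INR n = 2 * INR h + 1.
      by rewrite -{1}(odd_double_half n) od add1n S_INR -mul2n INRM2.
    have T2 : odd_tail n.+1 = (3 / 2) / (2 * INR h + 1).
      rewrite /odd_tail; have -> : (n.+1)./2 = h.+1 by rewrite /h; lia.
      by rewrite S_INR; f_equal; ring.
    have key : 1 + (cw n - 1) / INR n <= exp (odd_tail n - odd_tail n.+1).
      apply: Rle_trans (exp_ineq1_le _); apply: Rplus_le_compat_l.
      rewrite T1 T2 /cw En.
      have -> : ((/ (1 - / (2 * INR h + 1))) ^ 3 - 1) / (2 * INR h + 1) =
         (12 * INR h ^ 2 + 6 * INR h + 1) / (8 * INR h ^ 3 * (2 * INR h + 1)).
        by field; lra.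
      have -> : 3 / 2 / (2 * INR h - 1) - 3 / 2 / (2 * INR h + 1) = 3 / ((2 * INR h - 1) * (2 * INR h + 1)).
        by field; lra.
      have p1 : 0 < (2 * INR h - 1) * (2 * INR h + 1) by nra.
      have p2 : 0 < 8 * INR h ^ 3 * (2 * INR h + 1) by repeat apply: Rmult_lt_0_compat; try apply: pow_lt; lra.
      apply/(Rle_div_l _ _ _ p2).
      have -> : 3 / ((2 * INR h - 1) * (2 * INR h + 1)) * (8 * INR h ^ 3 * (2 * INR h + 1))
        = 24 * INR h ^ 3 / (2 * INR h - 1) by field; lra.
      have p3 : 0 < 2 * INR h - 1 by lra.
      apply/(Rle_div_r _ _ _ p3).
      have -> : (12 * INR h ^ 2 + 6 * INR h + 1) * (2 * INR h - 1) = 24 * INR h ^ 3 - 4 * INR h - 1 by ring.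
      lra.
    have -> : exp (/ 2 - odd_tail n.+1) = exp (odd_tail n - odd_tail n.+1) * exp (/ 2 - odd_tail n).
      by rewrite -exp_plus; congr exp; ring.
    rewrite [mprod _]/=.
    have m1 := mprod_pos (odd_primes_all n).
    apply: Rle_trans (_ : exp (odd_tail n - odd_tail n.+1) * mprod (odd_primes n) <= _).
      by apply: Rmult_le_compat_r; lra.
    have := Rmult_le_compat_l (exp (odd_tail n - odd_tail n.+1)) _ _ (Rlt_le _ _ (exp_pos _)) IH; lra.
  apply: Rle_trans IH _; apply: Rmult_le_compat_l; first lra.
  apply: exp_le_mono; suff : odd_tail n.+1 <= odd_tail n by lra.
  rewrite T1 /odd_tail; apply: Rmult_le_compat_l; first lra.
  apply: Rinv_le_contravar; first lra.
  have : INR h <= INR (n.+1)./2 by apply: INR_ge; rewrite /h; lia.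
  lra.
have -> : odd_primes 4 = [:: 3%N] by [].
rewrite /mprod /cw /odd_tail /= (_ : 1 + 1 = 2) //.
have -> : / 2 - 3 / 2 / (2 * 2 - 1) = 0 by field.
rewrite exp_0; right; field.
Qed.

Lemma mprod_le n : (4 <= n)%N -> mprod (odd_primes n) <= 32 / 10.
Proof.
move=> h; apply: Rle_trans (mprod_odd_primes h) _.
have T0 : 0 <= odd_tail n.
  have : (2 <= n./2)%N by lia.
  move=> /INR_ge2 r; apply: Rmult_le_pos; first lra.
  by apply/Rlt_le/Rinv_0_lt_compat; lra.
have : exp (/ 2 - odd_tail n) <= exp (/ 2) by apply: exp_le_mono; lra.
have : exp (/ 2) * exp (/ 2) = exp 1 by rewrite -exp_plus; congr exp; field.
have := exp_le_3; have := exp_pos (/ 2) => e0 e3 ee.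
have : exp (/ 2) <= 7 / 4 by nra.
lra.
Qed.

Lemma wt_Vprod E s i : all prime s -> Vprod [seq p <- s | E p i] ^ 3 * wt E s i = 1.
Proof.
elim: s => [|p s IH]; first by rewrite /= !Rmult_1_l.
move=> /andP[/ip_bounds pr hs]; have {IH} := IH hs.
rewrite [wt E (p :: s) i]/= -/(wt E s i) [filter _ (p :: s)]/=; case: (E p i) => h; last first.
  by rewrite -[RHS]h; ring.
have ipp : INR p <> 0 by move=> e; move: pr; rewrite e Rinv_0; lra.
have ip1 : INR p - 1 <> 0.
  by move=> e; move: pr; have -> : INR p = 1; [lra|rewrite Rinv_1; lra].
by rewrite [Vprod (_ :: _)]/= -[RHS]h /cw; field.
Qed.

Lemma recip_sum_Ln n : (2 <= n)%N -> psum (fun p => / INR p) n <= Ln n.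
Proof.
move=> h; have := @psum_tele_le (fun p => / INR p) (fun k => Ln k.-1) 2 n h.
rewrite psum2 (_ : Ln 2.-1 = 0); last by rewrite /Ln /= ln_1.
have : Ln n.-1 <= Ln n by apply: Ln_le; lia.
move=> l H; suff : psum (fun p => / INR p) n - 0 <= Ln n.-1 - 0 by lra.
have st p : (2 <= p < n)%N -> / INR p <= Ln p.+1.-1 - Ln p.-1.
  by case: p => [|p] hp //; have [] := @Ln_S p ltac:(lia).
apply: H => p hp _; first exact: st.
apply: Rle_trans (st p hp); apply/Rlt_le/Rinv_0_lt_compat; have := @INR_ge2 p ltac:(lia); lra.
Qed.

Lemma sigma_filter (P : pred nat) s : all prime s -> sigma [seq p <- s | P p] <= sigma s.
Proof.
elim: s => [|p s IH] /=; first by move=> _; lra.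
by move=> /andP[/ip_bounds pr /IH]; case: (P p) => /=; lra.
Qed.

Lemma sigma_plist_filter (P : pred nat) n :
  sigma [seq p <- plist n | P p] = psum (fun p => if P p then / INR p else 0) n.
Proof. by elim: n => //= n IH; case: ifP => /= _; [case: ifP => /= _|]; rewrite IH; ring. Qed.

Lemma sift_loss_sum A E (s t : seq nat) X :
  (forall p, p \in t -> INR (size [seq i <- A | E p i]) <= X / INR p + 1) ->
  INR (sift A E s) <= INR (sift A E (t ++ s)) + (X * sigma t + INR (size t)).
Proof.
elim: t => [|p t IH] H; first by rewrite /=; lra.
have -> : INR (size (p :: t)) = INR (size t) + 1 by rewrite -S_INR.
rewrite cat_cons sift_cons [sigma _]/= -/(sigma t).
have {IH} := IH (fun q hq => H q (@mem_behead _ (p :: t) q hq)).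
have := H p (mem_head _ _).
have : INR (sift [seq i <- A | E p i] E (t ++ s)) <= INR (size [seq i <- A | E p i]).
  exact/INR_ge/count_size.
rewrite /Rdiv; lra.
Qed.

Definition degree (a b m i : nat) : nat := count (fun j => coprime (a + 2 * i) (b + 2 * j)) (iota 0 m).
(* The residue [j] mod [p] with [p %| a + 2 j], for odd [p]. *)
Definition root_class (a p : nat) : nat := (a * p./2)%N.

(** [2 * p./2] is [- 1] modulo an odd [p], so [p./2] solves [1 + 2 * j = 0]. *)
Lemma in_root_class a p i : odd p -> in_class (root_class a) p i = (p %| a + 2 * i)%N.
Proof.
move=> od; have Ep : p = (2 * p./2).+1 by have := odd_double_half p; rewrite od -mul2n; lia.
rewrite /in_class /root_class; set h := p./2 in Ep *; apply/eqP/idP => [e|dv].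
  rewrite /dvdn -modnDmr -modnMmr e modnMmr modnDmr.
  by have -> : (a + 2 * (a * h) = a * p)%N; [nia|rewrite modnMl].
have -> : (i %% p = (i + (a + 2 * i) * h) %% p)%N by rewrite -modnDmr (eqP (dvdn_mulr h dv)) addn0.
by have -> : (i + (a + 2 * i) * h = i * p + a * h)%N; [nia|rewrite modnMDl].
Qed.

Lemma coprime_odd x y : odd (x + y) ->
  (forall p, prime p -> odd p -> p %| x -> ~~ (p %| y)) -> coprime x y.
Proof.
move=> od H; rewrite /coprime; apply/negPn/negP => g1.
have g0 : (0 < gcdn x y)%N by rewrite gcdn_gt0; case: x y od {H g1} => [|x] [|y].
have pr := @pdiv_prime (gcdn x y) ltac:(lia); set p := pdiv _ in pr.
have px : p %| x by apply: dvdn_trans (pdiv_dvd _) (dvdn_gcdl _ _).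
have py : p %| y by apply: dvdn_trans (pdiv_dvd _) (dvdn_gcdr _ _).
have po : odd p.
  have : p %| x + y by rewrite dvdn_add.
  by move=> /dvdnP[q e]; move: od; rewrite e oddM => /andP[].
by have := H p pr po px; rewrite py.
Qed.

Section Degree.
Variables (a b m n w : nat).
Hypothesis a0 : (0 < a)%N.
Hypothesis oab : odd (a + b).
Hypothesis an : forall i, (i < m)%N -> (a + 2 * i <= n)%N.
Hypothesis w3 : (3 <= w)%N.
Hypothesis m3 : (3 <= m)%N.

Let si i := [seq p <- odd_primes w | in_class (root_class a) p i].
(** Bounds the proportion of the candidate neighbours that the odd primes of [a + 2 * i] between [w]
    and [m] can remove, up to rounding. *)
Definition h1 i := psum (fun p => if [&& w <= p, odd p & in_class (root_class a) p i]%N then / INR p else 0) m.+1.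

Lemma Ln3 k : (3 <= k)%N -> 1 <= Ln k.
Proof.
move=> /(@Ln_le 3 k isT); apply: Rle_trans; rewrite /Ln (_ : INR 3 = 3); last by rewrite /=; ring.
by rewrite -{1}(ln_exp 1); apply: ln_le_mono; [apply: exp_pos|apply: exp_le_3].
Qed.

(** Brun's sieve treats the primes below [w]; all larger prime factors are removed by the union
    bound. There are at most [ln n] of them in [[w, m]], with rounding error 1 each, and at most
    [ln n] beyond [m], each removing at most two candidates: hence [3 * Ln n]. *)
Lemma V_upper r i : (i < m)%N -> Ln w <= INR r.+1 ->
  INR m * Vprod (si i) <= INR (degree a b m i) + INR m * h1 i + 3 * Ln n +
    (INR m * (Ln w ^ r / INR (fact r)) + (INR w + 1) ^ r.+1).
Proof.
move=> im hr; set x := (a + 2 * i)%N; have x0 : (0 < x)%N by rewrite /x; lia.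
have m0 : 0 < INR m by apply: lt_0_INR; lia.
set A := iota 0 m; set E := in_class (root_class b).
pose T1 := [seq p <- plist m.+1 | [&& w <= p, odd p & in_class (root_class a) p i]%N].
pose T2 := [seq p <- primes x | (m < p)%N].
have reg P : regular P (INR m) A E by apply: regular_interval.
have si_all : all prime (si i) by apply/allP => p; rewrite mem_filter => /andP[_ /(allP (odd_primes_all w))].
have card p : prime p -> INR (size [seq i <- A | E p i]) <= INR m / INR p + 1.
  move=> pr; have := regular_card (@regular_filter predT _ _ _ p pr isT (reg _)).
  by split_Rabs; lra.
have sg : sigma (si i) <= Ln w.
  apply: Rle_trans (sigma_filter _ (odd_primes_all w)) _.
  apply: Rle_trans (sigma_filter _ (plist_all w)) _.
  by rewrite sigma_plist; apply: recip_sum_Ln; lia.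
have sg0 := proj2 (Vprod_bound si_all).
have B : Rabs (INR (sift A E (si i)) - INR m * Vprod (si i)) <=
  INR m * (sigma (si i) ^ r / INR (fact r)) + (INR (size (si i)) + 1) ^ r.+1 := @brun r (si i) predT (INR m) A E (reg _) (filter_uniq _ (odd_primes_uniq w))
  ltac:(by apply: sub_all si_all => p ->) ltac:(lra) ltac:(lra).
have B1 : sigma (si i) ^ r / INR (fact r) <= Ln w ^ r / INR (fact r).
  apply: Rmult_le_compat_r; first by apply/Rlt_le/Rinv_0_lt_compat/INR_fact_lt_0.
  by apply: pow_incr.
have B2 : (INR (size (si i)) + 1) ^ r.+1 <= (INR w + 1) ^ r.+1.
  apply: pow_incr; have := pos_INR (size (si i)).
  have : INR (size (si i)) <= INR w.
    apply: INR_ge; rewrite size_filter; apply: leq_trans (count_size _ _) _.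
    by rewrite size_filter; apply: leq_trans (count_size _ _) (plist_size _).
  lra.
have L1 : INR (sift A E (si i)) <= INR (sift A E (T1 ++ si i)) + (INR m * h1 i + INR (size T1)).
  rewrite /h1 -sigma_plist_filter -/T1; apply: sift_loss_sum => p.
  by rewrite mem_filter plistP => /andP[_ /andP[pr _]]; apply: card.
have L2 : INR (sift A E (T1 ++ si i)) <= INR (sift A E (T2 ++ T1 ++ si i)) + (INR m * sigma T2 + INR (size T2)).
  by apply: sift_loss_sum => p; rewrite mem_filter mem_primes => /andP[_ /and3P[pr _ _]]; apply: card.
have S2 : INR m * sigma T2 <= INR (size T2).
  have : all (fun p => m < p)%N T2 by apply/allP => p; rewrite mem_filter => /andP[].
  elim: T2 {L2} => [|p T IH] /=; first by move=> _; lra.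
  move=> /andP[mp /IH]; rewrite -/(size T).+1.
  have : / INR p <= / INR m by apply: Rinv_le_contravar => //; apply: INR_ge; lia.
  have -> : (match size T with 0%N => 1 | _.+1 => INR (size T) + 1 end) = INR (size T) + 1.
    by case: (size T) => //=; ring.
  move=> h1 h2; have : INR m * / INR p <= INR m * / INR m by apply: Rmult_le_compat_l; lra.
  rewrite Rinv_r; lra.
have xn : Ln x <= Ln n by apply: Ln_le => //; apply: an.
have Z1 : INR (size T1) <= Ln n.
  have := @big_primes w x T1 x0 (filter_uniq _ (plist_uniq _)) ltac:(lia).
  have lw := Ln3 w3; have := pos_INR (size T1) => s0 H.
  have : INR (size T1) * Ln w <= Ln x.
    apply: H; apply/allP => p; rewrite mem_filter plistP => /andP[/and3P[-> od ev] /andP[-> _]].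
    by rewrite andbT /= -(in_root_class a i od).
  nra.
have Z2 : INR (size T2) <= Ln n.
  have := @big_primes m x T2 x0 (filter_uniq _ (primes_uniq _)) ltac:(lia).
  have lw := Ln3 m3; have := pos_INR (size T2) => s0 H.
  have : INR (size T2) * Ln m <= Ln x.
    apply: H; apply/allP => p; rewrite mem_filter mem_primes => /andP[mp /and3P[-> _ ->]].
    exact: ltnW.
  nra.
have D : INR (sift A E (T2 ++ T1 ++ si i)) <= INR (degree a b m i).
  apply: INR_ge; apply: sub_count => j; rewrite !all_cat => /and3P[/allP t2 /allP t1 /allP t0].
  apply: coprime_odd; first by rewrite (_ : (x + _ = a + b + (i + j).*2)%N) ?oddD ?odd_double ?addbF -?oddD // /x; lia.
  move=> p pr po px; rewrite -(in_root_class b j po).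
  have pi : in_class (root_class a) p i by rewrite in_root_class.
  case: (ltnP p w) => pw; first by apply: t0; rewrite mem_filter pi odd_primesP po pr.
  case: (ltnP m p) => pm; first by apply: t2; rewrite mem_filter pm mem_primes pr x0.
  by apply: t1; rewrite mem_filter pw po pi plistP pr ltnS.
have : INR m * (sigma (si i) ^ r / INR (fact r)) <= INR m * (Ln w ^ r / INR (fact r)).
  by apply: Rmult_le_compat_l; lra.
move: B; split_Rabs; lra.
Qed.

Lemma h1_ge0 i : 0 <= h1 i.
Proof.
have := @psum_mono (fun p => if [&& w <= p, odd p & in_class (root_class a) p i]%N then / INR p else 0) 0 m.+1 isT.
rewrite /=; apply=> p pr; case: ifP => _; last lra.
by have := ip_bounds pr; lra.
Qed.

(** A prime [p <= m] divides at most [2 * m / p] of the vertices, each time with weight [1 / p]; the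
    sum of [1 / p ^ 2] telescopes. *)
Lemma h1_sum : list_sum h1 (iota 0 m) <= 2 * INR m / (INR w - 1).
Proof.
have m0 : 0 < INR m by apply: lt_0_INR; lia.
rewrite /h1 (list_sum_psum (fun p i => if [&& w <= p, odd p & in_class (root_class a) p i]%N then / INR p else 0)).
apply: Rle_trans (_ : psum (fun p => 2 * INR m * (if (w <= p)%N then / INR p * / INR p else 0)) m.+1 <= _).
  apply: psum_le0 => p pr pm; case: (leqP w p) => wp /=; last first.
    by rewrite (_ : list_sum _ _ = 0); [lra|elim: (iota 0 m) => //= i s ->; ring].
  have ip := ip_bounds pr; have p2 := prime_INR pr.
  apply: Rle_trans (_ : list_sum (fun i => / INR p * (if in_class (root_class a) p i then 1 else 0)) (iota 0 m) <= _).
    by apply: list_sum_le => i _; case: (odd p) => /=; case: in_class; lra.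
  rewrite list_sum_scal list_sum_count -size_filter.
  have reg : regular predT (INR m) (iota 0 m) (in_class (root_class a)) by apply: regular_interval.
  have := regular_card (@regular_filter predT _ _ _ p pr isT reg).
  have : 1 <= INR m / INR p.
    have p0 : 0 < INR p by lra.
    by apply/(Rle_div_r _ _ _ p0); rewrite Rmult_1_l; apply: INR_ge; lia.
  set c := INR (size _) => h1 h2.
  have -> : 2 * INR m * (/ INR p * / INR p) = / INR p * (2 * (INR m / INR p)) by rewrite /Rdiv; ring.
  by apply: Rmult_le_compat_l; [lra|move: h2; split_Rabs; lra].
rewrite psum_scal; apply: Rmult_le_compat_l; first lra.
have w3r := @INR_ge 3 w w3; rewrite (_ : INR 3 = 3) in w3r; last by rewrite /=; ring.
have Z k : (k <= w)%N -> psum (fun p => if (w <= p)%N then / INR p * / INR p else 0) k = 0.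
  move=> kw; rewrite (@psum_ext _ (fun=> 0)); first exact: psum_0.
  by move=> p pk _; rewrite leqNgt (leq_trans pk kw).
have i0 : 0 < / (INR w - 1) by apply: Rinv_0_lt_compat; lra.
case: (leqP m.+1 w) => mw; first by rewrite (Z _ mw); lra.
have := @psum_tele_le (fun p => if (w <= p)%N then / INR p * / INR p else 0)
  (fun k => - / (INR k - 1)) w m.+1 (ltnW mw).
rewrite (Z w) // Rminus_0_r S_INR => H.
have st p : (w <= p)%N -> / INR p * / INR p <= - / (INR p.+1 - 1) - - / (INR p - 1).
  move=> hp; have := INR_ge hp => r; rewrite S_INR.
  have -> : - / (INR p + 1 - 1) - - / (INR p - 1) = / (INR p * (INR p - 1)) by field; lra.
  have -> : / INR p * / INR p = / (INR p * INR p) by field; lra.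
  by apply: Rinv_le_contravar; nra.
apply: Rle_trans (H _ _) _.
- by move=> p hp _; case: ifP => [|/negP]; [apply: st|lia].
- move=> p hp _; apply: Rle_trans (st p _); last lia.
  have := @INR_ge w p ltac:(lia) => r; apply: Rmult_le_pos; apply/Rlt_le/Rinv_0_lt_compat; lra.
have : 0 < / (INR m + 1 - 1) by apply: Rinv_0_lt_compat; lra.
lra.
Qed.

Lemma wt_sum : (4 <= w)%N -> list_sum (wt (in_class (root_class a)) (odd_primes w)) (iota 0 m) <= 32 / 10 * INR m + INR w ^ 3.
Proof.
move=> w4; have m0 : 0 < INR m by apply: lt_0_INR; lia.
have := @moment (odd_primes w) predT (INR m) (iota 0 m) (in_class (root_class a)) (@regular_interval predT _ _) (odd_primes_uniq w)
  ltac:(by apply: sub_all (odd_primes_all w) => p ->).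
have := @cprod_odd_primes w ltac:(lia); have := mprod_le w4; have := @INR_ge1 w ltac:(lia) => w1 h1 h2.
have : (INR w - 1) ^ 3 <= INR w ^ 3 by apply: pow_incr; lra.
have : INR m * mprod (odd_primes w) <= INR m * (32 / 10) by apply: Rmult_le_compat_l; lra.
lra.
Qed.

(* Markov's inequality for [h1 / delta + (y / V) ^ 3]: a vertex of small degree has [h1] large or [V] small. *)
Lemma count_low (P : pred nat) (delta y : R) : (4 <= w)%N -> 0 < delta -> 0 < y ->
  (forall i, (i < m)%N -> P i -> h1 i <= delta -> Vprod (si i) <= y) ->
  INR (count P (iota 0 m)) <= 2 * INR m / (INR w - 1) / delta + y ^ 3 * (32 / 10 * INR m + INR w ^ 3).
Proof.
move=> w4 d0 y0 H; rewrite -list_sum_count.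
have id0 : 0 < / delta by apply: Rinv_0_lt_compat.
apply: Rle_trans (_ : list_sum (fun i => / delta * h1 i + y ^ 3 * wt (in_class (root_class a)) (odd_primes w) i) (iota 0 m) <= _).
  apply: list_sum_le => i; rewrite mem_iota add0n => /= im.
  have a1 : 0 <= / delta * h1 i by apply: Rmult_le_pos; [lra|apply: h1_ge0].
  have W := wt_Vprod (in_class (root_class a)) i (odd_primes_all w).
  have V0 : 0 < Vprod (si i).
    by apply: Vprod_pos; apply/allP => p; rewrite mem_filter => /andP[_ /(allP (odd_primes_all w))].
  have a2 : 0 <= wt (in_class (root_class a)) (odd_primes w) i.
    have V3 : 0 < Vprod (si i) ^ 3 by apply: pow_lt.
    apply: (Rmult_le_reg_l (Vprod (si i) ^ 3)) => //; rewrite W Rmult_0_r; lra.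
  have a3 : 0 <= y ^ 3 * wt (in_class (root_class a)) (odd_primes w) i by apply: Rmult_le_pos => //; apply: pow_le; lra.
  case: ifP => Pi; last lra.
  have [hd|hd] := Rle_lt_dec (h1 i) delta.
    suff : 1 <= y ^ 3 * wt (in_class (root_class a)) (odd_primes w) i by lra.
    rewrite -W; apply: Rmult_le_compat_r => //.
    by apply: pow_incr; have := H i im Pi hd; rewrite /si in V0 *; lra.
  suff : 1 <= / delta * h1 i by lra.
  by rewrite -(Rinv_l delta); [apply: Rmult_le_compat_l|]; lra.
rewrite list_sum_plus !list_sum_scal; apply: Rplus_le_compat.
  rewrite (Rmult_comm (/ delta)); apply: Rmult_le_compat_r; [lra|exact: h1_sum].
by apply: Rmult_le_compat_l; [apply: pow_le; lra|apply: wt_sum].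
Qed.
End Degree.

Lemma loglog_large (l : R) : 10 ^ 5 <= l -> 1600 * l ^ 2 <= exp l.
Proof.
move=> hl; have := @exp_ge_pow 3 l isT ltac:(lra); rewrite (_ : INR 3 = 3); last by rewrite /=; ring.
have : 10 ^ 5 * l ^ 2 <= l ^ 3 by rewrite -(tech_pow_Rmult l 2); apply: Rmult_le_compat_r; [apply: pow2_ge_0|].
have := pow2_ge_0 l; lra.
Qed.

(* With [kap = k / m], the third moment bounds the proportion of degrees at most [k] by about
   [3.2 kap ^ 3], which is less than [kap] because [kap < 1 / 2] and [3.2 / 4 < 1]. *)
Theorem few_low : exists Lb, forall a b m n k : nat, (0 < a)%N -> odd (a + b) ->
  (forall i, (i < m)%N -> (a + 2 * i <= n)%N) -> Lb <= Ln m -> Ln n ^ 2 <= INR m ->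
  INR m / Ln m ^ 2 <= INR k -> (2 * k < m)%N ->
  (count (fun i => degree a b m i <= k)%N (iota 0 m) <= k)%N.
Proof.
exists (exp (10 ^ 5)) => a b m n k a0 oab an hL hn hk k2.
have m3 : (3 <= m)%N.
  rewrite ltnNge; apply/negP => m2; have := exp_ineq1_le (10 ^ 5).
  case: (posnP m) => [e|m1]; first by move: k2; rewrite e.
  by have := Ln_le m1 m2; have : Ln 2 <= 1 by [rewrite /Ln (_ : INR 2 = 2) //; have := @ln_le_sub1 2 ltac:(lra); lra]; lra.
have m0 : 0 < INR m by apply: lt_0_INR; lia.
set L := Ln m in hL hk *; pose l := ln L.
have e0 := exp_pos (10 ^ 5); have L0 : 0 < L by lra.
have LE : L = exp l by rewrite /l exp_ln.
have hl : 10 ^ 5 <= l by rewrite -(ln_exp (10 ^ 5)); apply: ln_le_mono; lra.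
have Ll := loglog_large hl; rewrite -LE in Ll.
have L5 : 10 ^ 5 <= L by rewrite LE; have := exp_ineq1_le l; lra.
have L1600 : 1600 * l <= L by nra.
have mE : INR m = exp L by rewrite /L /Ln exp_ln.
set u := / L; have u0 : 0 < u by apply: Rinv_0_lt_compat.
have u5 : u <= / 10 ^ 5 by apply: Rinv_le_contravar; lra.
have u3 : u ^ 3 = exp (- (3 * l)).
  by rewrite /u pow_inv cube_exp_ln // exp_Ropp.
(* With [w] near [L ^ 6], Markov's inequality for [h1] at the level [u ^ 3] loses only
   [2 * m * u ^ 3]. Taking [z.+2] makes [w - 1] exceed [L ^ 6]. *)
have [z [z1 z2]] := @nat_floor (L ^ 6) ltac:(apply: pow_le; lra).
set w := z.+2; have wR : INR w = INR z + 2 by rewrite /w !S_INR; ring.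
have L6 : L ^ 6 = exp (6 * l) by rewrite pow_exp_ln // (_ : INR 6 = 6) //=; ring.
have L61 : 10 ^ 5 <= L ^ 6.
  apply: Rle_trans L5 _; rewrite -{1}(pow_1 L); apply: Rle_pow; [lra|lia].
have w4 : (4 <= w)%N by apply/leP/INR_le; rewrite (_ : INR 4 = 4); [lra|rewrite /=; ring].
set lw := Ln w.
have lw1 : 6 * l <= lw by rewrite -(ln_exp (6 * l)) -L6; apply: ln_le_mono; lra.
have lw2 : lw <= 6 * l + 1.
  rewrite -(ln_exp (6 * l + 1)) exp_plus -L6; apply: ln_le_mono; first lra.
  have := exp_ineq1_le 1; nra.
(* [9 >= exp 2], so [pow_fact_exp_neg] applies with [k = 2] and bounds the truncation error by
   [exp (- r)], far below [u ^ 3]. *)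
have [q [q1 q2]] := @nat_floor (9 * lw) ltac:(lra).
set r := q.+1; have rR : INR r = INR q + 1 by rewrite /r S_INR.
have e1 : lw ^ r / INR (fact r) <= u ^ 3.
  apply: Rle_trans (@pow_fact_exp_neg lw 2 r _ _) _; first lra.
    have -> : exp 2 = exp 1 * exp 1 by rewrite -exp_plus; congr exp; ring.
    have := exp_le_3; have := exp_pos 1 => h1 h2.
    have : exp 1 * exp 1 <= 9 by nra.
    by move=> h3; have := Rmult_le_compat_l lw _ _ ltac:(lra) h3; lra.
  by rewrite u3; apply: exp_le_mono; lra.
set E := exp (L / 2); have E0 : 0 < E := exp_pos _.
have EE : E * E = INR m by rewrite -exp_plus mE; congr exp; field.
have e2 : (INR w + 1) ^ r.+1 <= E.
  rewrite pow_exp_ln; last lra.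
  apply: exp_le_mono; have : ln (INR w + 1) <= lw + 1.
    rewrite -(ln_exp (lw + 1)) exp_plus /lw /Ln exp_ln; last lra.
    by apply: ln_le_mono; [lra|have := exp_ineq1_le 1; nra].
  move=> h; have h0 : 0 <= ln (INR w + 1) by rewrite -ln_1; apply: ln_le_mono; lra.
  rewrite (S_INR r); apply: Rle_trans (_ : (54 * l + 11) * (6 * l + 2) <= _).
    by apply: Rmult_le_compat; lra.
  nra.
have e3 : Ln n <= E.
  have := Ln_ge0 n => n0; apply: Rsqr_incr_0_var; last lra.
  by rewrite /Rsqr EE; move: hn; rewrite /= Rmult_1_r.
have e4 : 4 * E <= INR m * u ^ 3.
  have h : 4 * L ^ 3 <= E.
    have -> : L ^ 3 = exp (3 * l) by apply: cube_exp_ln.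
    apply: Rle_trans (_ : exp 3 * exp (3 * l) <= _).
      by apply: Rmult_le_compat_r; [apply/Rlt_le/exp_pos|have := exp_ineq1_le 3; lra].
    by rewrite -exp_plus; apply: exp_le_mono; lra.
  have -> : 4 * E = 4 * L ^ 3 * E * u ^ 3 by rewrite /u; field; lra.
  apply: Rmult_le_compat_r; first by apply: pow_le; lra.
  by rewrite -EE; apply: Rmult_le_compat_r; lra.
pose kap := INR k / INR m; have kE : INR k = kap * INR m by rewrite /kap; field; lra.
have kap1 : u ^ 2 <= kap.
  have -> : u ^ 2 = INR m / L ^ 2 / INR m by rewrite /u; field; lra.
  by apply: Rmult_le_compat_r => //; apply/Rlt_le/Rinv_0_lt_compat.
have kap2 : kap <= / 2.
  apply: (Rmult_le_reg_r (INR m)) => //; rewrite -kE.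
  have : INR (2 * k) <= INR m by apply: INR_ge; lia.
  by rewrite INRM2; lra.
have u2 : 0 < u ^ 2 by apply: pow_lt.
have u3p : 0 < u ^ 3 by apply: pow_lt.
(* All losses are multiples of [u ^ 3], whereas [kap >= u ^ 2]; they therefore disturb [kap] by less
   than one percent. *)
have C := @count_low a b m w a0 oab ltac:(lia) m3 (fun i => degree a b m i <= k)%N (u ^ 3) (kap + 3 * u ^ 3) w4 u3p ltac:(lra).
apply/leP/INR_le; apply: Rle_trans (C _) _ => {C}.
  move=> i im dk hd; have V := @V_upper a b m n w a0 oab an ltac:(lia) m3 r i im.
  have {V} := V ltac:(rewrite (S_INR r) -/lw; lra); rewrite -/lw.
  set v := Vprod _ => V; apply: (Rmult_le_reg_l (INR m)) => //.
  have dk' : INR (degree a b m i) <= INR k by apply: INR_ge.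
  have t1 : INR m * h1 a m w i <= INR m * u ^ 3 by apply: Rmult_le_compat_l; lra.
  have t2 : INR m * (lw ^ r / INR (fact r)) <= INR m * u ^ 3 by apply: Rmult_le_compat_l; lra.
  by rewrite Rmult_plus_distr_l -/(INR m * kap) (Rmult_comm _ kap) -kE; lra.
have t1 : 2 * INR m / (INR w - 1) / u ^ 3 <= 2 * (INR m * u ^ 3).
  have -> : 2 * (INR m * u ^ 3) = 2 * INR m * / L ^ 6 / u ^ 3 by rewrite /u; field; lra.
  apply: Rmult_le_compat_r; first by apply/Rlt_le/Rinv_0_lt_compat.
  by apply: Rmult_le_compat_l; [lra|apply: Rinv_le_contravar; lra].
have t2 : INR w ^ 3 <= / 10 * INR m.
  rewrite (cube_exp_ln (_ : 0 < INR w)); last lra.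
  apply: Rle_trans (_ : / exp 10 * exp L <= _).
    by rewrite -exp_Ropp -exp_plus; apply: exp_le_mono; rewrite -/(Ln w) -/lw; lra.
  rewrite -mE; apply: Rmult_le_compat_r; first lra.
  by apply: Rinv_le_contravar; [lra|have := exp_ineq1_le 10; lra].
have y0 : 0 <= kap + 3 * u ^ 3 <= kap * (101 / 100).
  split; first lra.
  have -> : u ^ 3 = u ^ 2 * u by ring.
  have : u ^ 2 * u <= kap * u by apply: Rmult_le_compat_r; lra.
  have : kap * u <= kap * / 10 ^ 5 by apply: Rmult_le_compat_l; lra.
  lra.
(* [kap <= 1 / 2] gives [kap ^ 3 <= kap / 4], and [26 / 100] also covers the disturbance; what
   counts in the end is that [26 / 100 * (33 / 10) < 1]. *)
have y3 : (kap + 3 * u ^ 3) ^ 3 <= kap * (26 / 100).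
  apply: Rle_trans (pow_incr _ _ 3 y0) _; rewrite Rpow_mult_distr.
  have -> : kap ^ 3 * (101 / 100) ^ 3 = kap * (kap ^ 2 * (101 / 100) ^ 3) by ring.
  apply: Rmult_le_compat_l; first lra.
  have : kap ^ 2 <= / 2 ^ 2 by rewrite -pow_inv; apply: pow_incr; lra.
  lra.
have y30 : 0 <= (kap + 3 * u ^ 3) ^ 3 by apply: pow_le; lra.
have t3 : (kap + 3 * u ^ 3) ^ 3 * (32 / 10 * INR m + INR w ^ 3) <= kap * (26 / 100) * (33 / 10 * INR m).
  apply: Rmult_le_compat => //; last lra.
  by have : 0 <= INR w ^ 3; [apply: pow_le; lra|lra].
have t4 : INR m * u ^ 3 <= INR k * / 10 ^ 5.
  rewrite kE; have -> : INR m * u ^ 3 = u ^ 2 * u * INR m by ring.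
  have -> : kap * INR m * / 10 ^ 5 = kap * / 10 ^ 5 * INR m by ring.
  apply: Rmult_le_compat_r; first lra.
  by apply: Rmult_le_compat; lra.
have k0 := pos_INR k.
apply: Rle_trans (Rplus_le_compat _ _ _ _ t1 t3) _.
have -> : kap * (26 / 100) * (33 / 10 * INR m) = 26 / 100 * (33 / 10) * INR k by rewrite kE; ring.
lra.
Qed.

(** * Matchings *)

Section Hall.
Variables (T U : finType) (R : T -> U -> bool).

Definition nbrs (S : {set T}) : {set U} := [set y | [exists x in S, R x y]].

Lemma nbrsP (S : {set T}) y : reflect (exists2 x, x \in S & R x y) (y \in nbrs S).
Proof. by rewrite inE; apply: (iffP existsP) => [ [x /andP[]]|[x xS Rxy]]; exists x => //; rewrite xS. Qed.

(** Induction on [#|A|]. If a nonempty proper subset is tight, it is matched first and the rest is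
    matched outside its neighbours; otherwise every such subset has a neighbour to spare and any
    edge at [x0] may be removed. Both reductions shrink [A] and [B], which are parameters for this
    reason. *)
Lemma hall_in (A : {set T}) (B : {set U}) :
  (forall S : {set T}, S \subset A -> #|S| <= #|nbrs S :&: B|)%N ->
  (0 < #|U|)%N ->
  exists f : T -> U, (forall x, x \in A -> R x (f x) /\ f x \in B) /\ {in A &, injective f}.
Proof.
move=> H U0; move En : #|A| => n; elim/ltn_ind: n A B En H => n IH A B En H.
have [A0|/set0Pn[x0 x0A]] := eqVneq A set0.
  have [u _] := card_gt0P U0.
  by exists (fun=> u); rewrite A0; split => [x|x y]; rewrite inE.
case: (boolP [exists S : {set T}, [&& S \proper A, S != set0 & #|nbrs S :&: B| <= #|S|]%N]) => [|no].
  move=> /existsP[S /and3P[SA S0 tight]].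
  have SsA := proper_sub SA.
  have cS : #|nbrs S :&: B| = #|S| by apply/eqP; rewrite eqn_leq tight H.
  have ltS : (#|S| < n)%N by rewrite -En; apply: proper_card.
  have [|f [f1 f2]] := IH _ ltS S (nbrs S :&: B) (erefl _).
    move=> S' S'S; rewrite (_ : nbrs S' :&: _ = nbrs S' :&: B); first by apply: H; apply: subset_trans SsA.
    apply/setP => y; rewrite !in_setI; case: (boolP (y \in nbrs S')) => //= /nbrsP[x xS' Rxy].
    by rewrite (_ : y \in nbrs S) //; apply/nbrsP; exists x => //; apply: (subsetP S'S).
  have cA : #|A :\: S| = (n - #|S|)%N by rewrite cardsD (setIidPr SsA) En.
  have ltA : (#|A :\: S| < n)%N by rewrite cA; move: S0; rewrite -card_gt0; lia.
  have [|g [g1 g2]] := IH _ ltA (A :\: S) (B :\: nbrs S) (erefl _).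
    move=> S' S'A; have dj : S' :&: S = set0.
      by apply/eqP; rewrite setI_eq0 disjoint_subset; apply/subsetP => x /(subsetP S'A); rewrite !inE => /andP[].
    have := H (S' :|: S); rewrite cardsU dj cards0 subn0.
    move=> /(_ _); rewrite subUset SsA (subset_trans S'A (subsetDl _ _)) => /(_ isT).
    have sub : nbrs (S' :|: S) :&: B \subset (nbrs S' :&: (B :\: nbrs S)) :|: (nbrs S :&: B).
      apply/subsetP => y; rewrite !in_setU !in_setI !in_setD => /andP[/nbrsP[x]]; rewrite inE => xS Rxy yB.
      rewrite yB !andbT; case: (boolP (y \in nbrs S)) => yS; rewrite ?orbT //= orbF andbT.
      case/orP: xS => xS; first by apply/nbrsP; exists x.
      by case/negP: yS; apply/nbrsP; exists x.
    move=> h; have := subset_leq_card sub.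
    have := cardsU (nbrs S' :&: (B :\: nbrs S)) (nbrs S :&: B); rewrite cS; lia.
  exists (fun x => if x \in S then f x else g x); split.
    move=> x xA; case: ifP => xS; first by have [? ] := f1 x xS; rewrite inE => /andP[].
    by have [|? ] := g1 x; rewrite !inE ?xS ?xA // => /andP[].
  have fgx x y : x \in S -> y \in A -> y \notin S -> f x != g y.
    move=> xS yA yS; apply/eqP => e; have [_] := f1 x xS; have [|_] := g1 y; first by rewrite inE yS yA.
    by rewrite -e !inE => /andP[/negP n1 _] /andP[].
  move=> x y xA yA /=; case: ifP => xS; case: ifP => yS e.
  - exact: f2.
  - by have := fgx x y xS yA (negbT yS); rewrite e eqxx.
  - by have := fgx y x yS xA (negbT xS); rewrite e eqxx.
  - by apply: g2 => //; rewrite inE ?xS ?yS.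
have [y0 y0N y0B] : exists2 y, R x0 y & y \in B.
  have := H [set x0]; rewrite sub1set x0A cards1 => /(_ isT) /card_gt0P[y].
  by rewrite in_setI => /andP[/nbrsP[x]]; rewrite inE => /eqP -> Rxy yB; exists y.
have cA : #|A :\ x0| = n.-1 by rewrite -En (cardsD1 x0 A) x0A.
have ltA : (#|A :\ x0| < n)%N by rewrite cA; have : (0 < #|A|)%N; [apply/card_gt0P; exists x0|lia].
have [|g [g1 g2]] := IH _ ltA (A :\ x0) (B :\ y0) (erefl _).
  move=> S SA; have [->|S0] := eqVneq S set0; first by rewrite cards0.
  have Sp : S \proper A.
    by apply: sub_proper_trans SA _; rewrite properD1.
  move: no; rewrite negb_exists => /forallP /(_ S); rewrite Sp S0 /= -ltnNge => h.
  have := cardsD1 y0 (nbrs S :&: B); rewrite setIDA; case: (_ \in _); lia.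
exists (fun x => if x == x0 then y0 else g x); split.
  move=> x xA; case: eqVneq => [->|ne]; first by split.
  by have [|? ] := g1 x; rewrite !inE ?ne ?xA // => /andP[].
have gy x : x \in A -> x != x0 -> g x != y0.
  by move=> xA ne; have [|_] := g1 x; rewrite !inE ?ne ?xA // => /andP[].
move=> x y xA yA /=; case: eqVneq => [->|nx]; case: eqVneq => [->|ny] e //.
- by have := gy y yA ny; rewrite -e eqxx.
- by have := gy x xA nx; rewrite e eqxx.
- by apply: g2 => //; rewrite !inE ?nx ?ny.
Qed.

Lemma hall : (forall S : {set T}, #|S| <= #|nbrs S|)%N -> (0 < #|U|)%N ->
  exists f : T -> U, (forall x, R x (f x)) /\ injective f.
Proof.
move=> H U0; have [|f [f1 f2]] := @hall_in setT setT _ U0; first by move=> S _; rewrite setIT.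
by exists f; split => [x|x y]; [have [] := f1 x (in_setT x)|apply: f2; rewrite in_setT].
Qed.
End Hall.

Lemma count_ord m (P : pred nat) : count P (iota 0 m) = #|[set i : 'I_m | P i]|.
Proof. by rewrite -val_enum_ord count_map cardsE cardE size_filter -enumT. Qed.

Definition perfect_matching (a b m : nat) (f : nat -> nat) :=
  [/\ forall i, (i < m)%N -> (f i < m)%N /\ coprime (a + 2 * i) (b + 2 * f i),
      forall i j, (i < m)%N -> (j < m)%N -> f i = f j -> i = j &
      forall j, (j < m)%N -> exists2 i, (i < m)%N & f i = j].

Theorem progression_matching : exists Q Lb, 1 <= Q /\ forall a b m n : nat,
  (0 < a)%N -> (0 < b)%N -> odd (a + b) ->
  (forall i, (i < m)%N -> (a + 2 * i <= n)%N) -> (forall i, (i < m)%N -> (b + 2 * i <= n)%N) ->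
  Lb <= Ln m -> (Q * Ln n) ^ 2 <= INR m -> exists f, perfect_matching a b m f.
Proof.
have [Q [L1 [Q1 DB]]] := deg_bound; have [L2 FL] := few_low.
exists Q, (1 + Rmax 0 (Rmax L1 L2)); split=> // a b m n a0 b0 oab an bn hL hQ.
have M1 := Rmax_l L1 L2; have M2 := Rmax_r L1 L2; have n0 := Ln_ge0 n.
have M3 := Rmax_l 0 (Rmax L1 L2); have M4 := Rmax_r 0 (Rmax L1 L2).
have hn : Ln n ^ 2 <= INR m.
  by apply: Rle_trans hQ; apply: pow_incr; split=> //; nra.
have deg x y i : (0 < x)%N -> odd (x + y) -> (forall i, (i < m)%N -> (x + 2 * i <= n)%N) ->
    (i < m)%N -> INR m / Ln m ^ 2 <= INR (degree x y m i).
  move=> x0 oxy xn im; apply: Rle_trans (DB m n (x + 2 * i)%N (root_class y) _ hQ _ (xn i im)) _; [lra|lia|].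
  apply: INR_ge; apply: sub_count => j /allP h.
  apply: coprime_odd.
    by rewrite (_ : (x + 2 * i + _ = x + y + (i + j).*2)%N) ?oddD ?odd_double ?addbF -?oddD //; lia.
  by move=> p pr po px; rewrite -in_root_class //; apply: h; rewrite mem_primes pr px andbT; lia.
have m0 : (0 < m)%N.
  by case: m hL {an bn hQ hn deg} => //; rewrite Ln_0; lra.
pose Rl (i j : 'I_m) := coprime (a + 2 * i) (b + 2 * j).
have [||f [f1 f2]] := @hall _ _ Rl; last first.
- exists (fun i => if insub i is Some k then val (f k) else 0%N); split.
  + by move=> i im; rewrite insubT /=; split; [apply: ltn_ord|apply: (f1 (Ordinal im))].
  + move=> i j im jm; rewrite !insubT /= => /val_inj /f2 e.
    by have := congr1 val e.
  + move=> j jm; have [g gK Kg] := injF_bij f2; exists (g (Ordinal jm)); first exact: ltn_ord.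
    by rewrite insubT // => h; rewrite (_ : Sub _ _ = g (Ordinal jm)) ?Kg //; apply: val_inj.
- by rewrite card_ord.
(* If [S] violates Hall's condition and has at least [m / 2] neighbours, the vertices outside the
   neighbourhood violate it on the other side with fewer than [m / 2] neighbours. *)
move=> S; rewrite leqNgt; apply/negP => viol.
have [i0 i0S] : exists i, i \in S by apply/card_gt0P; lia.
have cS : (#|S| <= m)%N by have := max_card (mem S); rewrite card_ord.
have dgS (i : 'I_m) : i \in S -> (degree a b m i <= #|nbrs Rl S|)%N.
  move=> iS; rewrite /degree count_ord; apply/subset_leq_card/subsetP => j; rewrite !inE => h.
  by apply/existsP; exists i; rewrite iS.
(* Every vertex of [S] has degree at most [#|nbrs Rl S|]; [deg] at one of them supplies the lower
   bound on this number that [few_low] requires. *)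
case: (ltnP (2 * #|nbrs Rl S|) m) => k2.
  have := FL a b m n #|nbrs Rl S| a0 oab an ltac:(lra) hn _ k2; rewrite count_ord => F.
  have : (#|S| <= #|nbrs Rl S|)%N.
    apply: leq_trans (F _); first by apply/subset_leq_card/subsetP => i iS; rewrite inE; apply: dgS.
    apply: Rle_trans (deg a b i0 a0 oab an (ltn_ord i0)) _.
    by apply: INR_ge; apply: dgS.
  lia.
have cN := cardsC (nbrs Rl S); have cSC := cardsC S; rewrite card_ord in cN cSC.
have oba : odd (b + a) by rewrite addnC.
have dgN (j : 'I_m) : j \in ~: nbrs Rl S -> (degree b a m j <= #|~: S|)%N.
  move=> jN; rewrite /degree count_ord; apply/subset_leq_card/subsetP => i; rewrite !inE => h.
  apply/negP => iS; move: jN; rewrite inE => /negP; apply; apply/nbrsP; exists i => //.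
  by rewrite /Rl coprime_sym.
have [j0 j0N] : exists j, j \in ~: nbrs Rl S by apply/card_gt0P; lia.
have := FL b a m n #|~: S| b0 oba bn ltac:(lra) hn _ ltac:(lia); rewrite count_ord => F.
have : (#|~: nbrs Rl S| <= #|~: S|)%N; last by lia.
apply: leq_trans (F _); first by apply/subset_leq_card/subsetP => j jN; rewrite inE; apply: dgN.
apply: Rle_trans (deg b a j0 b0 oba bn (ltn_ord j0)) _.
by apply: INR_ge; apply: dgN.
Qed.

Lemma Ln_trunc_log n : (2 <= n)%N -> Ln n <= 2 * INR (trunc_log 2 n).
Proof.
move=> n2; have /andP[_ h] := @trunc_log_bounds 2 n isT ltac:(lia).
have t1 : (1 <= trunc_log 2 n)%N by rewrite trunc_log_gt0.
have := @Ln_le n (2 ^ (trunc_log 2 n).+1) ltac:(lia) (ltnW h).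
have l2 : Ln 2 <= 1 by rewrite /Ln (_ : INR 2 = 2) //; have := @ln_le_sub1 2 ltac:(lra); lra.
have pw k : Ln (2 ^ k) <= INR k.
  elim: k => [|k IH]; first by rewrite /Ln expn0 /= ln_1; lra.
  by rewrite expnS LnM ?expn_gt0 // S_INR; lra.
have := pw (trunc_log 2 n).+1; rewrite S_INR; have := INR_ge1 t1; lra.
Qed.

(** [v] is the first element of the interval with the parity of [x]. *)
Lemma parity_index (u m x v : nat) : (u <= x < u + 2 * m)%N -> (u <= v <= u.+1)%N -> odd v = odd x ->
  exists2 i, (i < m)%N & x = (v + 2 * i)%N.
Proof.
move=> /andP[ux xu] /andP[uv vu] e.
have vx : (v <= x)%N.
  rewrite leqNgt; apply/negP => xv; have E : v = x.+1 by lia.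
  by move: e; rewrite E /=; case: (odd x).
have E : (2 * (x - v)./2 = x - v)%N.
  by have := odd_double_half (x - v); rewrite oddB // e addbb add0n -mul2n.
by exists ((x - v)./2); rewrite ?E; lia.
Qed.

(** Stated over the natural numbers alone, with the binary logarithm in place of [ln], so that it
    carries over from the reals used so far to any [realType] at the cost of a constant. *)
Theorem interval_matching : exists c m0 : nat, (0 < c)%N /\ forall m n a b : nat,
  (m0 <= m)%N -> (c * trunc_log 2 n ^ 2 <= m)%N -> (0 < a)%N -> (0 < b)%N ->
  (a + 2 * m <= n.+1)%N -> (b + 2 * m <= n.+1)%N ->
  exists s : nat -> nat,
   [/\ forall x, (a <= x < a + 2 * m)%N -> (b <= s x < b + 2 * m)%N /\ coprime x (s x),
       forall x y, (a <= x < a + 2 * m)%N -> (a <= y < a + 2 * m)%N -> s x = s y -> x = y &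
       forall y, (b <= y < b + 2 * m)%N -> exists2 x, (a <= x < a + 2 * m)%N & s x = y].
Proof.
have [Q [Lb [Q1 PM]]] := progression_matching.
have [N [N2 HN]] := nat_ge_exists Lb.
(* [Ln n <= 2 * trunc_log 2 n] turns [Q ^ 2] into [4 * Q ^ 2]. *)
have [c [_ cQ]] := @nat_floor (4 * Q ^ 2) ltac:(nra).
exists c.+1, N; split=> // m n a b Nm hm a0 b0 an bn.
have n2 : (2 <= n)%N by lia.
have hQ : (Q * Ln n) ^ 2 <= INR m.
  have l0 := Ln_ge0 n; have l1 := Ln_trunc_log n2; have t0 := pos_INR (trunc_log 2 n).
  apply: Rle_trans (_ : (Q * (2 * INR (trunc_log 2 n))) ^ 2 <= _).
    by apply: pow_incr; split; [apply: Rmult_le_pos; lra|apply: Rmult_le_compat_l; lra].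
  have -> : (Q * (2 * INR (trunc_log 2 n))) ^ 2 = 4 * Q ^ 2 * (INR (trunc_log 2 n) * INR (trunc_log 2 n)) by ring.
  apply: Rle_trans (INR_ge hm); rewrite expnS expn1 !mult_INR S_INR.
  by apply: Rmult_le_compat_r; [apply: Rmult_le_pos|lra].
(* The first even and the first odd element of each interval. *)
pose ae := (a + odd a)%N; pose ao := (a + ~~ odd a)%N.
pose be := (b + odd b)%N; pose bo := (b + ~~ odd b)%N.
have eae : odd ae = false by rewrite /ae oddD; case: (odd a).
have oao : odd ao by rewrite /ao oddD; case: (odd a).
have ebe : odd be = false by rewrite /be oddD; case: (odd b).
have obo : odd bo by rewrite /bo oddD; case: (odd b).
have le1 (x : bool) : (x <= 1)%N by case: x.
have [f [f1 f2 f3]] : exists f, perfect_matching ae bo m f.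
  apply: PM (HN m Nm) hQ; rewrite /ae /bo.
  - lia.
  - lia.
  - by rewrite oddD -/ae -/bo eae obo.
  - by move=> i im; have := le1 (odd a); lia.
  - by move=> i im; have := le1 (~~ odd b); lia.
have [g [g1 g2 g3]] : exists g, perfect_matching ao be m g.
  apply: PM (HN m Nm) hQ; rewrite /ao /be.
  - lia.
  - lia.
  - by rewrite oddD -/ao -/be oao ebe.
  - by move=> i im; have := le1 (~~ odd a); lia.
  - by move=> i im; have := le1 (odd b); lia.
pose s x := if odd x then (be + 2 * g (x - ao)./2)%N else (bo + 2 * f (x - ae)./2)%N.
have half u i : ((u + 2 * i - u)./2 = i)%N by rewrite addKn mul2n doubleK.
have sE i : s (ae + 2 * i)%N = (bo + 2 * f i)%N.
  by rewrite /s oddD eae oddM half.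
have sO i : s (ao + 2 * i)%N = (be + 2 * g i)%N.
  by rewrite /s oddD oao oddM half.
have ind x : (a <= x < a + 2 * m)%N -> if odd x then exists2 i, (i < m)%N & x = (ao + 2 * i)%N
   else exists2 i, (i < m)%N & x = (ae + 2 * i)%N.
  by move=> hx; case: ifP => ox; apply: parity_index hx _ _; rewrite ?ox // /ae /ao -addn1 leq_addr leq_add2l le1.
have jnd x : (b <= x < b + 2 * m)%N -> if odd x then exists2 i, (i < m)%N & x = (bo + 2 * i)%N
   else exists2 i, (i < m)%N & x = (be + 2 * i)%N.
  by move=> hx; case: ifP => ox; apply: parity_index hx _ _; rewrite ?ox // /be /bo -addn1 leq_addr leq_add2l le1.
have rng (u i : nat) (e : bool) : (i < m)%N -> (u <= u + e + 2 * i < u + 2 * m)%N by move=> im; have := le1 e; lia.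
exists s; split.
- move=> x hx; have := ind x hx; case: ifP => ox [i im ->].
    by rewrite sO; have [gi cg] := g1 i im; split=> //; apply: rng.
  by rewrite sE; have [fi cf] := f1 i im; split=> //; apply: rng.
- move=> x y hx hy e; have := ind x hx; have := ind y hy.
  have so z : (a <= z < a + 2 * m)%N -> odd (s z) = ~~ odd z.
    by move=> hz; rewrite /s; case: ifP => oz; rewrite oddD oddM ?ebe ?obo.
  have : odd x = odd y by apply: negb_inj; rewrite -so // -so // e.
  move: e; case: (odd y) => /[swap] -> e [j jm Ey] [i im Ex]; move: e; rewrite Ex Ey ?sO ?sE => e.
    by rewrite (g2 i j im jm _) //; lia.
  by rewrite (f2 i j im jm _) //; lia.
- move=> y hy; have := jnd y hy; case: ifP => oy [j jm ->].
    by have [i im <-] := f3 j jm; exists (ae + 2 * i)%N; [apply: rng|rewrite sE].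
  by have [i im <-] := g3 j jm; exists (ao + 2 * i)%N; [apply: rng|rewrite sO].
Qed.

End Sieve.

Import Order.TTheory GRing.Theory Num.Theory.
Local Open Scope classical_set_scope.
Local Open Scope ring_scope.

(** * Passage to an arbitrary [realType] *)

Lemma trunc_log_le_ln (R : realType) (n : nat) : (0 < n)%N ->
  (trunc_log 2 n)%:R <= 2 * ln (n%:R : R).
Proof.
move=> n0; set t := trunc_log 2 n.
have ln2 : 1 <= 2 * ln (2 : R).
  have h : ln ((2 : R)^-1) <= - 2^-1.
    rewrite -(expRK (- 2^-1)) ler_ln ?posrE ?invr_gt0 ?expR_gt0 //.
    apply: le_trans (expR_ge1Dx _).
    by rewrite lerBrDr [leRHS]splitr mul1r.
  rewrite lnV ?posrE // lerN2 in h.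
  by rewrite -[leLHS](@mulfV R 2) // ler_pM2l.
have : ln ((2 : R) ^+ t) <= ln (n%:R : R).
  have /andP[h _] := @trunc_log_bounds 2 n isT n0.
  by rewrite ler_ln ?posrE ?exprn_gt0 ?ltr0n // -natrX ler_nat.
rewrite lnXn // => h; apply: le_trans (ler_wpM2l (ler0n _ 2) h).
by rewrite mulrnAr -[leRHS]mulr_natr; apply: ler_peMl; rewrite ?ler0n.
Qed.

Theorem theorem1 (R : realType) :
  exists (c : R) (n0 : nat), 0 < c /\
    forall n : nat, (n0 <= n)%N ->
    forall m : nat, c * (ln (n%:R : R)) ^+ 2 < m%:R ->
    forall I J : set nat,
      interval_of_length (2 * m)%N I -> interval_of_length (2 * m)%N J ->
      I `<=` initial_segment n -> J `<=` initial_segment n ->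
      exists sigma : nat -> nat, coprime_matching I J sigma.
Proof.
have [c [m0 [c0 IM]]] := Sieve.interval_matching.
(* The factor 4 comes from [trunc_log 2 n <= 2 * ln n], squared. For [n >= 2 ^ m0.+1] the binary
   logarithm exceeds [m0], and then so does [m]. *)
exists (4 * c)%:R, (2 ^ m0.+1)%N; split; first by rewrite ltr0n muln_gt0.
move=> n n2 m hm I J [a [a0 ->]] [b [b0 ->]] aI bJ.
have n1 : (0 < n)%N by apply: leq_trans n2; rewrite expn_gt0.
have t0 : (m0.+1 <= trunc_log 2 n)%N.
  by rewrite -(@trunc_expnK 2 m0.+1) //; apply: leq_trunc_log.
have cm : (c * trunc_log 2 n ^ 2 <= m)%N.
  rewrite -(ler_nat R); apply: le_trans (ltW hm).
  rewrite (natrM _ c) natrX (natrM _ 4) (mulrC 4%:R) -mulrA; apply: ler_wpM2l; first exact: ler0n.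
  have -> : 4%:R * ln n%:R ^+ 2 = (2 * ln n%:R) ^+ 2 :> R by rewrite exprMn -natrX.
  have h := trunc_log_le_ln R n1.
  by apply: lerXn2r => //; rewrite nnegrE ?ler0n //; apply: le_trans h; rewrite ler0n.
have mm : (m0 < m)%N.
  apply: leq_trans (t0) (leq_trans _ cm).
  by apply: leq_trans (leq_pmull _ c0); rewrite expnS expn1 leq_pmulr // (leq_trans _ t0).
(* The inclusion is tested at the largest element [k + 2 * m - 1], which exists because [m] is
   positive. *)
have top k : [set x | (k <= x < k + 2 * m)%N] `<=` initial_segment n -> (k + 2 * m <= n.+1)%N.
  move=> /(_ (k + (2 * m).-1)%N); rewrite /initial_segment /=.
  have m2 : (0 < 2 * m)%N by rewrite muln_gt0 (leq_trans _ mm).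
  rewrite leq_addr ltn_add2l ltn_predL m2 => /(_ isT) /andP[_ h].
  by rewrite -(prednK m2) addnS ltnS.
have [s [s1 s2 s3]] := IM m n a b (ltnW mm) cm a0 b0 (top a aI) (top b bJ).
exists s; split; last by move=> x /s1 [].
split.
- by move=> x /s1 [].
- by move=> x y /set_mem hx /set_mem hy; apply: s2.
- by move=> y /s3 [x hx <-]; exists x.
Qed.
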